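(* Let $I=(n_1,\dots,n_l)$ be a composition of $n$. Suppose $p>n_i$ whenever $G_i$ is taken to be $G(r_i,a_i,n_i)$. (1) If $G_i=G(r_i,a_i,n_i)$ with $r_i\mid q-1$ for all $i=1,\dots,l$, then $\mathcal{A}^{G_I}$ is a free module of rank $2^n a_1\cdots a_l$ over the algebra $\mathcal{P}^{\overline{G_I}}$, where $\overline{G_I}=\left(G(r_1,1,n_1)\times\cdots\times G(r_l,1,n_l)\right)\ltimes U_I$. (2) If there is $0\le a\le l$ such that $G_i=\mathrm{GL}_{n_i}(q)$ for $i=1,\dots,a$ and $G_i=G(r_i,1,n_i)$ for $i=a+1,\dots,l$, then $\mathcal{A}^{G_I}$ is a free module of rank $2^n$ over the algebra $\mathcal{P}^{G_I}$.
   Context: Let $p$ be a prime, $q=p^r$ with $r\ge 1$, and let $I=(n_1,\dots,n_l)$ be a composition of $n$ (positive integers with sum $n$). $V=\mathbb{F}_q^n$, $\mathcal{P}=S^\bullet(V)=\mathbb{F}_q[x_1,\dots,x_n]$, and $\mathcal{A}=\mathbb{F}_q[x_1,\dots,x_n]\otimes E[y_1,\dots,y_n]$ with $E[y_1,\dots,y_n]=\wedge^\bullet(V)$ the exterior algebra. $g=(g_{ij})\in \mathrm{GL}_n(q)$ acts by algebra automorphisms with $g x_j=\sum_i g_{ij}x_i$, $g y_j=\sum_i g_{ij}y_i$. For subgroups $G_i\subseteq \mathrm{GL}_{n_i}(q)$, $G_I\subseteq\mathrm{GL}_n(q)$ is the group of all block upper triangular matrices (block sizes $n_1,\dots,n_l$)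 whose $i$-th diagonal block lies in $G_i$ and whose blocks above the diagonal are arbitrary; $U_I$ is the group of such matrices with all diagonal blocks equal to identity matrices. $G_1\times\cdots\times G_l$ is viewed as the group of block diagonal matrices, so $G_I=(G_1\times\cdots\times G_l)\ltimes U_I$. For positive integers $a\mid m$, $G(m,a,k)\subseteq\mathrm{GL}_k(q)$ is the group $S_k\ltimes A(m,a,k)$, where $S_k$ is the group of permutation matrices and $A(m,a,k)=\{\mathrm{diag}(w_1,\dots,w_k): w_j\in\mathbb{F}_q,\ w_j^m=(w_1\cdots w_k)^{m/a}=1\}$. *)

(* Defs.v *)
From HB Require Import structures.
From mathcomp Require Import all_boot all_order all_algebra all_fingroup.
From mathcomp Require Export mpoly.

Set Implicit Arguments.
Unset Strict Implicit.
Unset Printing Implicit Defensive.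

Import GRing.Theory.
Local Open Scope ring_scope.

(* The exterior algebra over R on n generators y_0, ..., y_(n-1), as the free *)
(* R-module on the monomials y_S = y_i1 y_i2 ... y_ik, for S = {i1 < ... < ik}. *)
(* For R = F[x_1, ..., x_n] this is F[x_1, ..., x_n] (x)_F E[y_1, ..., y_n].    *)
Definition extalg (n : nat) (R : comNzRingType) : Type :=
  {ffun {set 'I_n} -> R^o}.

(* The number of transpositions needed to sort the word y_S y_T. *)
Definition ninv (n : nat) (S T : {set 'I_n}) : nat :=
  (\sum_(i in S) \sum_(j in T) (j < i))%N.

Section ExtAlg.
Variables (n : nat) (R : comNzRingType).
Local Notation E := (extalg n R).
Implicit Types (S T U : {set 'I_n}) (u v w : E).

HB.instance Definition _ := GRing.Lmodule.copy E {ffun {set 'I_n} -> R^o}.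

Definition ext_mon (S : {set 'I_n}) : E := [ffun T => (S == T)%:R].

Definition ext_one : E := ext_mon set0.

(* y_S y_T is (-1)^(ninv S T) y_(S :|: T) if S and T are disjoint, else 0. *)
Definition ext_mul (u v : E) : E :=
  [ffun U : {set 'I_n} =>
     \sum_(S : {set 'I_n} | S \subset U)
        (-1) ^+ ninv S (U :\: S) * u S * v (U :\: S)].

Let esgn S T : R := if [disjoint S & T] then (-1) ^+ ninv S T else 0.
Let sc S T U : R := if S :|: T == U then esgn S T else 0.

Let ext_mulE u v U : ext_mul u v U = \sum_S \sum_T sc S T U * u S * v T.
Proof.
rewrite ffunE [RHS](bigID (fun S : {set 'I_n} => S \subset U)) /= [X in _ + X]big1 ?addr0.
  apply: eq_bigr => S sSU.
  have eU : S :|: U :\: S = U.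
    by rewrite -{1}(setIidPr sSU) setID.
  have dU : [disjoint S & U :\: S].
    by rewrite -setI_eq0; apply/eqP/setP=> i; rewrite !inE; case: (i \in S).
  rewrite (bigD1 (U :\: S)) //= /sc eU eqxx /esgn dU big1 ?addr0 // => T neT.
  case: eqP => [eT|]; last by rewrite !mul0r.
  case: ifP => [dST|]; last by rewrite !mul0r.
  case/eqP: neT; rewrite -eT setDUl setDv set0U; apply/esym/setDidPl.
  by rewrite disjoint_sym.
move=> S nsSU; apply: big1 => T _; rewrite /sc; case: eqP => [eU|]; last by rewrite !mul0r.
by case/negP: nsSU; rewrite -eU subsetUl.
Qed.

Let ninvUl S T U : [disjoint S & T] -> ninv (S :|: T) U = (ninv S U + ninv T U)%N.
Proof. by move=> dST; rewrite /ninv -bigU //; apply: eq_bigl => i; rewrite inE. Qed.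

Let ninvUr S T U : [disjoint T & U] -> ninv S (T :|: U) = (ninv S T + ninv S U)%N.
Proof.
move=> dTU; rewrite /ninv -big_split; apply: eq_bigr => i _.
by rewrite -bigU //; apply: eq_bigl => j; rewrite inE.
Qed.

Let disjUl S T U : [disjoint S :|: T & U] = [disjoint S & U] && [disjoint T & U].
Proof. by rewrite -!setI_eq0 setIUl setU_eq0. Qed.

Let disjUr S T U : [disjoint U & S :|: T] = [disjoint U & S] && [disjoint U & T].
Proof. by rewrite -!setI_eq0 setIUr setU_eq0. Qed.

Let esgnA S T U :
  esgn S (T :|: U) * esgn T U = esgn (S :|: T) U * esgn S T.
Proof.
rewrite /esgn disjUl disjUr.
case: (boolP [disjoint S & T]) => dST /=; last by rewrite !(mul0r, mulr0).
case: (boolP [disjoint T & U]) => dTU; last by rewrite andbF !(mul0r, mulr0).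
rewrite andbT; case: ifP => dSU; last by rewrite !(mul0r, mulr0).
rewrite ninvUl // ninvUr // -!exprD; congr (_ ^+ _).
by rewrite -addnA addnC.
Qed.

Let scA S T U W : \sum_V sc S V W * sc T U V = \sum_V sc V U W * sc S T V.
Proof.
rewrite (bigD1 (T :|: U)) //= [RHS](bigD1 (S :|: T)) //= ?big1 ?addr0.
- by rewrite /sc !eqxx setUA; case: ifP => _; rewrite ?esgnA // !mul0r.
- by move=> V /negPf; rewrite /sc eq_sym => ->; rewrite mulr0.
by move=> V /negPf; rewrite /sc eq_sym => ->; rewrite mulr0.
Qed.

Let ext_mulA : associative ext_mul.
Proof.
move=> u v w; apply/ffunP=> W; rewrite !ext_mulE.
transitivity (\sum_S \sum_T \sum_U
   (\sum_V sc S V W * sc T U V) * (u S * v T * w U)).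
  apply: eq_bigr => S _.
  under eq_bigr do rewrite ext_mulE big_distrr /=.
  rewrite exchange_big /=; apply: eq_bigr => T _.
  under eq_bigr do rewrite big_distrr /=.
  rewrite exchange_big /=; apply: eq_bigr => U _.
  rewrite big_distrl; apply: eq_bigr => V _ /=.
  rewrite !mulrA; congr (_ * _ * _).
  by rewrite -!mulrA; congr (_ * _); rewrite mulrC.
transitivity (\sum_V \sum_U \sum_S \sum_T
   (sc V U W * sc S T V) * (u S * v T * w U)).
  under eq_bigr do under eq_bigr do under eq_bigr do rewrite scA big_distrl /=.
  under eq_bigr do under eq_bigr do rewrite exchange_big /=.
  under eq_bigr do rewrite exchange_big /=.
  rewrite exchange_big /=; apply: eq_bigr => V _.
  under eq_bigr do rewrite exchange_big /=.
  by rewrite exchange_big.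
apply: eq_bigr => V _; apply: eq_bigr => U _.
rewrite ext_mulE big_distrr big_distrl; apply: eq_bigr => S _ /=.
rewrite big_distrr big_distrl; apply: eq_bigr => T _ /=.
by rewrite !mulrA.
Qed.

Let ext_mul1l : left_id ext_one ext_mul.
Proof.
move=> u; apply/ffunP=> U; rewrite ffunE (bigD1 set0) ?sub0set //= big1 => [|S].
  by rewrite setD0 /ninv big_set0 ffunE eqxx addr0 !mul1r.
by case/andP=> _; rewrite ffunE eq_sym => /negPf->; rewrite mulr0 mul0r.
Qed.

Let ext_mul1r : right_id ext_one ext_mul.
Proof.
move=> u; apply/ffunP=> U; rewrite ffunE (bigD1 U) //= big1 => [|S].
  rewrite setDv /ninv big1 => [|i _]; last by rewrite big_set0.
  by rewrite ffunE eqxx addr0 mul1r mulr1.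
case/andP=> sSU neS; rewrite ffunE eq_sym; case: eqP => [/eqP|]; last by rewrite mulr0.
rewrite setD_eq0 => sUS; case/eqP: neS; apply/eqP.
by rewrite eqEsubset sSU.
Qed.

Let ext_mulDl : left_distributive ext_mul +%R.
Proof.
move=> u v w; apply/ffunP=> U; rewrite !ffunE -big_split; apply: eq_bigr => S _ /=.
by rewrite ffunE mulrDr mulrDl.
Qed.

Let ext_mulDr : right_distributive ext_mul +%R.
Proof.
move=> u v w; apply/ffunP=> U; rewrite !ffunE -big_split; apply: eq_bigr => S _ /=.
by rewrite ffunE mulrDr.
Qed.

Let ext_one_neq0 : ext_one != 0.
Proof.
by apply/eqP=> /ffunP/(_ set0)/eqP; rewrite !ffunE eqxx oner_eq0.
Qed.

HB.instance Definition _ := GRing.Zmodule_isNzRing.Build E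
  ext_mulA ext_mul1l ext_mul1r ext_mulDl ext_mulDr ext_one_neq0.

Let ext_scaleAl (a : R) u v : a *: (u * v) = (a *: u) * v.
Proof.
apply/ffunP=> U; rewrite !ffunE scaler_sumr; apply: eq_bigr => S _.
rewrite ffunE; set x := v _; set y := u S.
by rewrite /GRing.scale /= !mulrA; congr (_ * _ * _); rewrite mulrC.
Qed.

HB.instance Definition _ :=
  GRing.Lmodule_isLalgebra.Build R E ext_scaleAl.

Let ext_scaleAr (a : R) u v : a *: (u * v) = u * (a *: v).
Proof.
apply/ffunP=> U; rewrite !ffunE scaler_sumr; apply: eq_bigr => S _.
rewrite ffunE; set x := v _; set y := u S.
by rewrite /GRing.scale /= mulrCA.
Qed.

HB.instance Definition _ :=
  GRing.Lalgebra_isAlgebra.Build R E ext_scaleAr.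

Definition ext_gen (i : 'I_n) : E := ext_mon [set i].

Lemma ext_monM S T : ext_mon S * ext_mon T =
  if [disjoint S & T] then (-1) ^+ ninv S T *: ext_mon (S :|: T) else 0.
Proof.
apply/ffunP=> U; rewrite [LHS]ext_mulE (bigD1 S) //= [X in _ + X]big1 ?addr0.
  rewrite (bigD1 T) //= big1 ?addr0.
    rewrite /sc /esgn !ffunE !eqxx !mulr1.
    case: (boolP [disjoint S & T]) => _; rewrite !ffunE; last by case: ifP.
    by case: eqP => _; rewrite ?scaler0 // [RHS]mulr1.
  by move=> V /negPf; rewrite [ext_mon T V]ffunE eq_sym => ->; rewrite mulr0.
move=> V /negPf neV; apply: big1 => W _.
by rewrite [ext_mon S V]ffunE eq_sym neV mulr0 mul0r.
Qed.

Lemma ext_sum_mon u : u = \sum_S u S *: ext_mon S.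
Proof.
apply/ffunP=> U; rewrite sum_ffunE (bigD1 U) //= big1 => [|S /negPf neS].
  by rewrite !ffunE eqxx addr0 [RHS]mulr1.
by rewrite !ffunE neS scaler0.
Qed.

Lemma ext_gen_sqr i : ext_gen i * ext_gen i = 0.
Proof. by rewrite ext_monM -setI_eq0 setIid -cards_eq0 cards1. Qed.

Lemma ext_gen_anti i j : ext_gen i * ext_gen j = - (ext_gen j * ext_gen i).
Proof.
have [-> | neq_ij] := eqVneq i j; first by rewrite ext_gen_sqr oppr0.
rewrite !ext_monM !disjoints1 !inE [j == i]eq_sym (negPf neq_ij) /= setUC -scaleNr.
congr (_ *: _); rewrite /ninv !big_set1.
case: (ltngtP i j) => [||/val_inj/eqP]; rewrite ?opprK //.
by rewrite (negPf neq_ij).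
Qed.

Lemma ext_lin_anti (a b : 'I_n -> R) :
  (\sum_i a i *: ext_gen i) * (\sum_i b i *: ext_gen i) =
  - ((\sum_i b i *: ext_gen i) * (\sum_i a i *: ext_gen i)).
Proof.
rewrite !mulr_suml -sumrN.
under eq_bigr do rewrite mulr_sumr.
under [RHS]eq_bigr do rewrite mulr_sumr -sumrN.
rewrite exchange_big; apply: eq_bigr => i _; apply: eq_bigr => j _ /=.
by rewrite -!scalerAl -!scalerAr ext_gen_anti !scalerN scalerA mulrC -scalerA.
Qed.

Lemma ext_lin_sqr (a : 'I_n -> R) :
  (\sum_i a i *: ext_gen i) * (\sum_i a i *: ext_gen i) = 0.
Proof.
pose e (r : seq 'I_n) : E := \sum_(i <- r) a i *: ext_gen i.
suff: forall r, uniq r -> e r * e r = 0 by apply; apply: index_enum_uniq.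
have eE r : uniq r -> e r = \sum_i (if i \in r then a i else 0) *: ext_gen i.
  move=> Ur; rewrite /e big_uniq //= big_mkcond /=.
  by apply: eq_bigr => i _; case: ifP; rewrite ?scale0r.
elim=> [|i r IHr] /=; first by rewrite /e big_nil mul0r.
case/andP=> _ Ur; rewrite /e big_cons -/(e r) mulrDl !mulrDr IHr //.
rewrite -scalerAl -scalerAr ext_gen_sqr !scaler0 add0r addr0 eE //.
have -> : a i *: ext_gen i =
    \sum_j (if j == i then a i else 0) *: ext_gen j.
  rewrite (bigD1 i) //= eqxx big1 ?addr0 // => j /negPf->.
  by rewrite scale0r.
by rewrite ext_lin_anti addNr.
Qed.

End ExtAlg.

(* The additive map sending a y_S to f a times the product of the z_j, j in S, *)
(* in increasing order of j.                                                  *)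
Definition ext_lift (n : nat) (R : comNzRingType) (B : algType R)
    (f : R -> R) (z : 'I_n -> B) (u : extalg n R) : B :=
  \sum_(S : {set 'I_n}) f (u S) *: \prod_(j in S) z j.

(* If the z_j anticommute and have square zero, ext_lift f z is the unique    *)
(* ring morphism with a |-> f a and y_j |-> z_j.                              *)
Section ExtLift.
Variables (n : nat) (R : comNzRingType) (B : algType R).
Variables (f : {rmorphism R -> R}) (z : 'I_n -> B).
Hypothesis zz : forall i, z i * z i = 0.
Hypothesis zC : forall i j, z i * z j = - (z j * z i).
Implicit Types S T : {set 'I_n}.

Let zS S : B := \prod_(j in S) z j.

Let zS_in i T : i \in T -> z i * zS T = 0.
Proof.
move=> iT; rewrite /zS.
have: i \in index_enum 'I_n by rewrite mem_index_enum.
elim: (index_enum _) => [|k r IHr] //; rewrite inE big_cons.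
have [<- _ | neq_ik] /= := eqVneq i k; last move/IHr => {}IHr.
  by rewrite iT mulrA zz mul0r.
case: ifP => // _; rewrite mulrA zC mulNr -mulrA IHr mulr0 oppr0 //.
Qed.

Let zS_notin i T : i \notin T ->
  z i * zS T = (-1) ^+ (\sum_(j in T) (j < i))%N * zS (i |: T).
Proof.
move=> niT; rewrite /zS.
have: i \in index_enum 'I_n by rewrite mem_index_enum.
have: sorted (fun a b : 'I_n => (a < b)%N) (index_enum 'I_n).
  have -> : index_enum 'I_n = enum 'I_n by rewrite enumT [LHS]unlock.
  by have := iota_ltn_sorted 0 n; rewrite -val_enum_ord sorted_map.
elim: (index_enum _) => [|k r IHr] //= srt_r.
have min_k : all (fun j : 'I_n => (k < j)%N) r.
  by apply: (order_path_min _ srt_r) => a b c; apply: ltn_trans.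
move/path_sorted/IHr: srt_r => {}IHr; rewrite inE !big_cons.
have [eq_ik _ | neq_ik] /= := eqVneq i k.
  rewrite -{}eq_ik in min_k *.
  have -> : (\sum_(j <- r | j \in T) (j < i) = 0)%N.
    rewrite big_seq_cond big1 // => j /andP[rj _].
    by have /ltnW := allP min_k j rj; rewrite leqNgt => /negPf->.
  rewrite !inE eqxx (negPf niT) /= mul1r; congr (_ * _).
  rewrite big_seq_cond [RHS]big_seq_cond.
  apply: eq_bigl => j; rewrite !inE; case: eqP => [->|] //.
  by case: (boolP (i \in r)) => // /(allP min_k); rewrite /= ltnn.
move=> ri; have {}IHr := IHr ri.
have lt_ki : (k < i)%N by apply: (allP min_k).
rewrite !inE eq_sym (negPf neq_ik) /=; case: ifP => // _.
by rewrite lt_ki mulrA zC mulNr -mulrA IHr exprS mulN1r mulNr !mulrA commr_sign.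
Qed.

Let zS_mul S T : zS S * zS T =
  if [disjoint S & T] then (-1) ^+ ninv S T * zS (S :|: T) else 0.
Proof.
have [m] := ubnP #|S|; elim: m S => // m IHm S le_Sm.
have [-> | [i Si]] := set_0Vmem S.
  by rewrite -setI_eq0 set0I eqxx set0U /ninv big_set0 /zS big_set0 !mul1r.
have niS : i \notin S :\ i by rewrite !inE eqxx.
have defS : i |: S :\ i = S by rewrite setD1K.
have -> : zS S = (-1) ^+ (\sum_(j in S :\ i) (j < i))%N * (z i * zS (S :\ i)).
  by rewrite zS_notin // mulrA -exprD addnn -mul2n exprM sqrrN expr1n expr1n mul1r defS.
rewrite -!mulrA IHm; last by rewrite (cardsD1 i S) Si in le_Sm.
have -> : [disjoint S & T] = (i \notin T) && [disjoint S :\ i & T].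
  by rewrite -{1}defS -!setI_eq0 setIUl setU_eq0 setI_eq0 disjoints1.
case: (boolP [disjoint S :\ i & T]) => dST; last by rewrite andbF !mulr0.
rewrite andbT [z i * (_ * _)]mulrA commr_sign -[_ * z i * _]mulrA.
case: (boolP (i \in T)) => iT /=.
  by rewrite zS_in ?mulr0 // inE iT orbT.
rewrite zS_notin ?inE ?eqxx //= setUA defS !mulrA -!exprD; congr (_ * _).
rewrite -[LHS]signr_odd -[RHS]signr_odd; congr (_ ^+ nat_of_bool _).
have -> : (\sum_(j in S :\ i :|: T) (j < i))%N =
   (\sum_(j in S :\ i) (j < i) + \sum_(j in T) (j < i))%N.
  by rewrite -bigU //; apply: eq_bigl => j; rewrite inE.
have -> : ninv S T = (\sum_(j in T) (j < i) + ninv (S :\ i) T)%N.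
  by rewrite /ninv (big_setD1 i).
rewrite !oddD. by do 3! case: (odd _).
Qed.

Lemma ext_lift_mon S : ext_lift f z (ext_mon R S) = \prod_(j in S) z j.
Proof.
rewrite /ext_lift (bigD1 S) //= ffunE eqxx rmorph1 scale1r [X in _ + X]big1 ?addr0 // => T.
by rewrite ffunE eq_sym => /negPf->; rewrite rmorph0 scale0r.
Qed.

Lemma ext_lift_gen i : ext_lift f z (ext_gen R i) = z i.
Proof. by rewrite ext_lift_mon big_set1. Qed.

Lemma ext_liftD : {morph ext_lift f z : u v / u + v}.
Proof.
move=> u v; rewrite -big_split; apply: eq_bigr => S _ /=.
by rewrite ffunE rmorphD scalerDl.
Qed.

Lemma ext_liftZ a u : ext_lift f z (a *: u) = f a *: ext_lift f z u.
Proof.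
rewrite scaler_sumr; apply: eq_bigr => S _.
by rewrite ffunE rmorphM scalerA.
Qed.

Lemma ext_lift1 : ext_lift f z 1 = 1.
Proof. by rewrite [LHS]ext_lift_mon big_set0. Qed.

Lemma ext_liftM : {morph ext_lift f z : u v / u * v}.
Proof.
have lift0 : ext_lift f z 0 = 0 by rewrite -(scale0r 0) ext_liftZ rmorph0 scale0r.
have lift_sum (r : seq {set 'I_n}) F :
    ext_lift f z (\sum_(S <- r) F S) = \sum_(S <- r) ext_lift f z (F S).
  exact: (big_morph _ ext_liftD lift0).
move=> u v; rewrite [u]ext_sum_mon [v]ext_sum_mon mulr_suml !lift_sum mulr_suml.
apply: eq_bigr => S _; rewrite mulr_sumr lift_sum mulr_sumr.
apply: eq_bigr => T _.
rewrite -scalerAl -scalerAr !ext_liftZ -scalerAl -scalerAr; do 2!congr (_ *: _).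
rewrite ext_monM !ext_lift_mon [RHS]zS_mul; case: ifP => _ //.
rewrite ext_liftZ rmorphXn rmorphN1 ext_lift_mon -/(zS _).
elim: (ninv S T) => [|k IHk]; first by rewrite scale1r mul1r.
by rewrite !exprS -scalerA IHk scaleN1r mulN1r mulNr.
Qed.

End ExtLift.

Section Invariants.
Variables (n : nat) (F : finFieldType).
Local Notation P := {mpoly F[n]}.
Local Notation A := (extalg n P).
Implicit Types (g : 'M[F]_n) (G : {set 'M[F]_n}).

(* g x_j = \sum_i g_ij x_i *)
Definition poly_act g (p : P) : P :=
  p \mPo [tuple \sum_(i < n) g i j *: 'X_i | j < n].

(* g y_j = \sum_i g_ij y_i *)
Definition ext_act_gen g (j : 'I_n) : A :=
  \sum_(i < n) (g i j)%:MP *: ext_gen P i.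

Definition ext_act g : A -> A := ext_lift (poly_act g) (ext_act_gen g).

HB.instance Definition _ g := GRing.RMorphism.copy (poly_act g)
  (comp_mpoly [tuple \sum_(i < n) g i j *: 'X_i | j < n]).

Lemma poly_actX g j : poly_act g 'X_j = \sum_(i < n) g i j *: 'X_i.
Proof. by rewrite /poly_act comp_mpolyXU -tnth_nth tnth_mktuple. Qed.

Lemma ext_actX g j : ext_act g (ext_gen P j) = ext_act_gen g j.
Proof. exact: ext_lift_gen. Qed.

Lemma ext_actD g : {morph ext_act g : u v / u + v}.
Proof. exact: ext_liftD. Qed.

Lemma ext_actZ g (p : P) (u : A) :
  ext_act g (p *: u) = poly_act g p *: ext_act g u.
Proof. exact: ext_liftZ. Qed.

Lemma ext_act1 g : ext_act g 1 = 1.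
Proof. exact: ext_lift1. Qed.

Lemma ext_actM g : {morph ext_act g : u v / u * v}.
Proof.
by apply: ext_liftM => [i|i j]; [apply: ext_lin_sqr | apply: ext_lin_anti].
Qed.

Definition poly_invariants G : {pred P} :=
  [pred p | [forall g in G, poly_act g p == p]].

Definition ext_invariants G : {pred A} :=
  [pred u | [forall g in G, ext_act g u == u]].

End Invariants.

(* The subset M of V is a free module of rank N over the subring K of R.       *)
Definition free_of_rank (R : comNzRingType) (V : lmodType R)
    (K : {pred R}) (M : {pred V}) (N : nat) : Prop :=
  [/\ 0 \in M, {in M &, forall u v, u + v \in M},
      {in K & M, forall c u, c *: u \in M}
    & exists b : 'I_N -> V,
      [/\ forall k, b k \in M,
          {in M, forall u, exists2 c : 'I_N -> R,
             forall k, c k \in K & u = \sum_k c k *: b k}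
        & forall c : 'I_N -> R, (forall k, c k \in K) ->
             \sum_k c k *: b k = 0 -> forall k, c k = 0]].

Definition GL (F : finFieldType) (k : nat) : {set 'M[F]_k} :=
  [set g | g \in unitmx].

(* A(m,a,k) and G(m,a,k) = S_k |x A(m,a,k), for 0 < m, 0 < a and a %| m.     *)
Definition Adiag (F : finFieldType) (m a k : nat) : {set 'M[F]_k} :=
  [set diag_mx w | w : 'rV[F]_k &
     [forall j, w 0 j ^+ m == 1] && ((\prod_j w 0 j) ^+ (m %/ a) == 1)].

Definition Gimp (F : finFieldType) (m a k : nat) : {set 'M[F]_k} :=
  [set s *m d | s in [set perm_mx t | t : 'S_k], d in Adiag F m a k].

(* G_I = (G_1 x ... x G_l) |x U_I, for the block sizes n_ 0, ..., n_ (l - 1).  *)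
Definition parabolic (F : finFieldType) (l : nat) (n_ : 'I_l -> nat)
    (G : forall i, {set 'M[F]_(n_ i)}) : {set 'M[F]_(\sum_i n_ i)} :=
  [set g : 'M[F]_(\sum_i n_ i) |
     [forall i, submxblock g i i \in G i] &&
     [forall i : 'I_l, forall j : 'I_l, (j < i)%N ==> (submxblock g i j == 0)]].

(* Main.v *)
From HB Require Import structures.
Require Import Defs.
From mathcomp Require Import all_boot all_order all_algebra all_fingroup all_solvable all_field.
From mathcomp Require Import ring zify.

(* Fix a character chi of G.  The elements of A on which G acts by chi are shown *)
(* to have a P^G-basis of 2^n elements; part (2) is the case chi = 1, and for    *)
(* part (1) A^(G_I) splits, under the diagonal torus of the larger group, into   *)
(* the semi-invariants for a_1 ... a_l characters.                               *)
(*   The basis is built block by block.  Contracting by vectors of Frobenius     *)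
(* powers of the additive polynomials F_m (X) = prod (X + c), c in the span of   *)
(* x_1, ..., x_m, commutes with G, and an iterated graded commutator of these    *)
(* contractions with multiplication by y_1 ... y_m is, up to sign, multiplication*)
(* by the Moore determinant.  This writes every semi-invariant u, up to that     *)
(* determinant, as contractions of y_1 ... y_m times contractions of u;          *)
(* transvections in G show that the determinant divides the coefficients that    *)
(* occur, so it can be cancelled.  Inside a monomial block the roles are         *)
(* exchanged: multiplications by the 1-forms psi_k and a contraction by all the  *)
(* basis vectors give a Vandermonde determinant.  The remaining coefficients are *)
(* polynomial semi-invariants, which are multiples of an explicit product of     *)
(* linear forms.  The family spans A after inverting P, so it is independent.    *)

(** Fix a character chi of G that is a product of powers of the [delta b] over the monomial blocks.
    The core is [semi_invariants_basis]: the elements of A on which G acts by chi have a basis of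
    2^n elements over the G-invariant polynomials. Independence is a rank count: 2^n elements that
    span A after inverting nonzero polynomials are linearly independent ([rlspan_free]), and
    uniqueness of coefficients then forces the coefficients of a semi-invariant to be invariant
    ([invariant_coef]). What has to be proved is that every semi-invariant is a combination of the
    family with polynomial, not merely rational, coefficients.

    For one block of type GL, let Y be the product of its y_j, and c_1, ..., c_m equivariant
    contractions with c_1 ... c_m Y equal to the Moore determinant L up to sign. The iterated graded
    commutator of multiplication by Y with the c_j is multiplication by L up to sign; expanding it
    writes L u as a signed sum of words c_K (Y c_K' u), where K' is the complement of K
    ([moore_engine]). Up to the y_j of earlier blocks, Y c_K' u is a polynomial times Y.
    Transvections in G force each linear factor of L to divide that polynomial, and the quotient,
    being a polynomial semi-invariant, is a multiple of an explicit generator ([FF_dvd]). Cancelling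
    L expresses u in the family of the words c_K Y times the generator. A monomial block has no
    transvections inside it. There the two kinds of operators are exchanged ([theta_engine]):
    multiplications by 1-forms take the place of the c_j, contraction by all basis vectors takes the
    place of Y, and a Vandermonde determinant takes the place of L.

    Blocks are glued by induction ([gens_semi_inv_span]). If u involves only the y_j of the first
    b+1 blocks, the Moore commutator for the first b blocks writes [Del b] times u as [Del b] times
    members of the span plus a term in the y_j of the first b blocks, so u is in the span up to a
    semi-invariant with one block less.

    That polynomial semi-invariants are multiples of one generator ([generator_dvd]) holds because
    torus elements and reflections, conjugated by transvections, force pairwise coprime linear
    forms, with multiplicities, to divide them.

    Part (2) is the trivial character. For part (1), write Gbar for the larger group; G_I is cut out
    of it by the conditions that [delta b] to the power r_b/a_b is 1. Averaging over diagonal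
    elements splits the invariants of G_I into the semi-invariants of Gbar for a_1 ... a_l
    characters, each part being free of rank 2^n. *)

Section BlockTriangularInvariants.
Set Implicit Arguments.
Unset Strict Implicit.
Unset Printing Implicit Defensive.
Import GRing.Theory.
Local Open Scope ring_scope.

(** * Contractions and graded commutators on an exterior algebra *)

Section Exterior.
Variables (n : nat) (R : comNzRingType).
Local Notation E := (extalg n R).
Local Notation y := (ext_gen R).
Implicit Types (i j k : 'I_n) (S T U : {set 'I_n}) (u v w : E) (X Y : 'I_n -> R).

Definition nbelow i T : nat := (\sum_(k in T) (k < i))%N.

Lemma nbelowU1 i j T : j \notin T -> nbelow i (j |: T) = ((j < i) + nbelow i T)%N.
Proof. by move=> njT; rewrite /nbelow big_setU1. Qed.

Lemma nbelowD1 i T : nbelow i (T :\ i) = nbelow i T.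
Proof.
have [iT|niT] := boolP (i \in T); last by rewrite (setDidPl _) // disjoint_sym disjoints1.
by rewrite -[in RHS](setD1K iT) nbelowU1 ?setD11 // ltnn.
Qed.

Lemma signr_sqr m : (-1) ^+ m * (-1) ^+ m = 1 :> R.
Proof. by rewrite -exprD addnn -mul2n exprM sqrrN !expr1n. Qed.

Lemma signr_scaleK m u : (-1) ^+ m *: ((-1) ^+ m *: u) = u.
Proof. by rewrite scalerA signr_sqr scale1r. Qed.

Lemma ext_genM j u T :
  (y j * u) T = if j \in T then (-1) ^+ nbelow j T * u (T :\ j) else 0.
Proof.
have -> : (y j * u) T = \sum_(S : {set 'I_n} | S \subset T)
    (-1) ^+ ninv S (T :\: S) * (y j) S * u (T :\: S) by rewrite [LHS]ffunE.
case: ifP => jT; last first.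
  apply: big1 => S sST; rewrite ffunE; case: eqP => [eS|]; last by rewrite mulr0 mul0r.
  by rewrite -eS sub1set jT in sST.
rewrite (bigD1 [set j]) ?sub1set //= big1 ?addr0 => [|S /andP[_ /negPf neS]].
  rewrite ffunE eqxx mulr1 /ninv big_set1; congr (_ ^+ _ * _).
  exact: nbelowD1.
by rewrite ffunE eq_sym neS mulr0 mul0r.
Qed.

(** Every monomial is, up to sign, an iterated left product of generators. Identities between
    operators can thus be checked on 1 and against [y i * _], where contractions have the simple
    rule [ctr_gen]. *)
Lemma ext_ind (Q : E -> Prop) :
  Q 1 -> (forall u v, Q u -> Q v -> Q (u + v)) -> (forall a u, Q u -> Q (a *: u)) ->
  (forall i u, Q u -> Q (y i * u)) -> forall u, Q u.
Proof.
move=> Q1 QD QZ QM u; rewrite [u]ext_sum_mon.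
have Qmon S : Q (ext_mon R S).
  have [m] := ubnP #|S|; elim: m S => // m IHm S leS.
  have [-> // | [i Si]] := set_0Vmem S.
  have -> : ext_mon R S = (-1) ^+ nbelow i S *: (y i * ext_mon R (S :\ i)).
    apply/ffunP=> T; rewrite [RHS]ffunE /= ext_genM !ffunE.
    case: ifP => [iT|niT]; last first.
      by rewrite scaler0; case: eqP => // eS; rewrite -eS Si in niT.
    case: (S =P T) => [<-|neST].
      by rewrite eqxx mulr1 /GRing.scale /= -exprD addnn -mul2n exprM sqrrN !expr1n.
    case: eqP => [eST|]; last by rewrite mulr0 scaler0.
    by case: neST; rewrite -(setD1K Si) eST setD1K.
  by apply/QZ/QM/IHm; rewrite (cardsD1 i S) Si in leS.
apply: (big_ind Q) => [|//|S _]; last exact/QZ/Qmon.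
by rewrite -(scale0r 1); apply: QZ.
Qed.

Lemma extDE u v T : (u + v) T = u T + v T. Proof. by rewrite ffunE. Qed.
Lemma extNE u T : (- u) T = - u T. Proof. by rewrite ffunE. Qed.
Lemma extZE a u T : (a *: u) T = a * u T. Proof. by rewrite ffunE. Qed.
Lemma ext_sumE (I : Type) (r : seq I) (P : pred I) (f : I -> E) T :
  (\sum_(i <- r | P i) f i) T = \sum_(i <- r | P i) f i T.
Proof. by rewrite sum_ffunE. Qed.

(** The interior product by the vector X: the odd antiderivation sending [y i] to [X i], given by
    coefficients so that linearity is immediate. *)
Definition ctr X u : E :=
  [ffun T : {set 'I_n} => \sum_(i | i \notin T) (-1) ^+ nbelow i T * X i * u (i |: T)].

Lemma ctrE X u T :
  ctr X u T = \sum_(i | i \notin T) (-1) ^+ nbelow i T * X i * u (i |: T).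
Proof. by rewrite ffunE. Qed.

Lemma ctr_is_linear X : linear (ctr X).
Proof.
move=> a u v; apply/ffunP=> T; rewrite extDE extZE !ctrE mulr_sumr -big_split.
by apply: eq_bigr => i _; rewrite extDE extZE /=; ring.
Qed.
HB.instance Definition _ X := GRing.isLinear.Build R E E _ (ctr X) (ctr_is_linear X).

Lemma ctr1 X : ctr X 1 = 0.
Proof.
apply/ffunP=> T; rewrite ctrE [RHS]ffunE; apply: big1 => i _.
rewrite ffunE; case: eqP => [/setP/(_ i)|]; last by rewrite mulr0.
by rewrite !inE eqxx.
Qed.

Lemma ctr_gen X j u : ctr X (y j * u) = X j *: u - y j * ctr X u.
Proof.
apply/ffunP=> T; rewrite ctrE extDE extNE extZE ext_genM.
under eq_bigr do rewrite ext_genM.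
have [jT|njT] := boolP (j \in T).
  have key : \sum_(i | i \notin T) (-1) ^+ nbelow i T * X i *
     (if j \in i |: T then (-1) ^+ nbelow j (i |: T) * u ((i |: T) :\ j) else 0)
    = - ((-1) ^+ nbelow j T * \sum_(i | i \notin T) (-1) ^+ nbelow i (T :\ j) * X i *
       u (i |: T :\ j)).
    rewrite mulr_sumr -sumrN; apply: eq_bigr => i niT.
    have neij : i != j by apply: contraNneq niT => ->.
    rewrite !inE jT orbT nbelowU1 //.
    rewrite -{1}(setD1K jT) nbelowU1 ?setD11 //.
    have -> : (i |: T) :\ j = i |: T :\ j.
      apply/setP=> k; rewrite !inE; case: (k =P j) => [->|] //=.
      by rewrite eq_sym (negPf neij).
    (* The minus sign of the antiderivation rule comes from here: exactly one of i < j and j < i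
       holds. *)
    have : (-1) ^+ (j < i)%N * (-1) ^+ (i < j)%N = -1 :> R.
      rewrite -exprD; case: (ltngtP i j) => // /val_inj/eqP.
      by rewrite (negPf neij).
    rewrite !exprD; set a := (-1) ^+ _; set b := (-1) ^+ _; set c := (-1) ^+ _.
    set d := (-1) ^+ _; set e := X i; set f := u _ => ab.
    by transitivity ((a * b) * (c * d * e * f)); [ring | rewrite ab; ring].
  rewrite key ctrE [in RHS](bigD1 j) ?setD11 //=.
  rewrite setD1K // nbelowD1.
  rewrite mulrDr opprD addrA -!mulrA.
  rewrite [_ * (_ * (X j * _))]mulrA -exprD addnn -mul2n exprM sqrrN !expr1n mul1r subrr add0r.
  congr (- (_ * _)); apply: eq_big => [i|i _]; last by rewrite -mulrA.
  by rewrite !inE; case: (i =P j) => [->|_]; rewrite ?jT ?andbT.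
rewrite oppr0 addr0 (bigD1 j) //= setU11 big1 ?addr0 => [|i /andP[niT neij]].
  rewrite nbelowU1 // ltnn setU1K //.
  transitivity ((-1) ^+ nbelow j T * (-1) ^+ nbelow j T * (X j * u T)).
    by ring.
  by rewrite -exprD addnn -mul2n exprM sqrrN !expr1n mul1r.
by rewrite !inE eq_sym (negPf neij) (negPf njT) mulr0.
Qed.

Lemma ctr_lin X (a : 'I_n -> R) u :
  ctr X ((\sum_i a i *: y i) * u) =
  (\sum_i a i * X i) *: u - (\sum_i a i *: y i) * ctr X u.
Proof.
rewrite !mulr_suml scaler_suml linear_sum -sumrB; apply: eq_bigr => i _.
by rewrite -!scalerAl linearZ /= ctr_gen scalerBr scalerA.
Qed.

Lemma ctr_anti X Y u : ctr X (ctr Y u) = - ctr Y (ctr X u).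
Proof.
elim/ext_ind: u => [|u v Hu Hv|a u Hu|i u Hu].
- by rewrite !ctr1 !linear0.
- by rewrite !linearD /= Hu Hv.
- by rewrite !linearZ /= Hu scalerN.
rewrite !ctr_gen !linearB /= !linearZ /= !ctr_gen Hu mulrN.
by rewrite [in RHS]scalerN !opprD !opprK [RHS]addrCA.
Qed.

Lemma ctr_sqr X u : ctr X (ctr X u) = 0.
Proof.
elim/ext_ind: u => [|u v Hu Hv|a u Hu|i u Hu].
- by rewrite ctr1 linear0.
- by rewrite !linearD /= Hu Hv addr0.
- by rewrite !linearZ /= Hu scaler0.
by rewrite !ctr_gen !linearB /= !linearZ /= !ctr_gen Hu mulr0 subr0 subrr.
Qed.

Lemma ctr_comb (I : Type) (r : seq I) (P : pred I) (a : I -> R) (Z : I -> 'I_n -> R) X u :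
  (forall i, X i = \sum_(k <- r | P k) a k * Z k i) ->
  ctr X u = \sum_(k <- r | P k) a k *: ctr (Z k) u.
Proof.
move=> XE; apply/ffunP=> T; rewrite ext_sumE ctrE.
under [RHS]eq_bigr do rewrite extZE ctrE mulr_sumr.
rewrite exchange_big /=; apply: eq_bigr => i _.
rewrite XE mulr_sumr mulr_suml; apply: eq_bigr => k _; ring.
Qed.

(** The grading involution, which supplies the sign of the graded Leibniz rule [ctrM] without any
    homogeneity assumption. *)
Definition einv u : E := [ffun T : {set 'I_n} => (-1) ^+ #|T| * u T].

Lemma einvE u T : einv u T = (-1) ^+ #|T| * u T. Proof. by rewrite ffunE. Qed.

Lemma einv_is_linear : linear einv.
Proof.
move=> a u v; apply/ffunP=> T; rewrite extDE extZE !einvE extDE extZE; ring.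
Qed.
HB.instance Definition _ := GRing.isLinear.Build R E E _ einv einv_is_linear.

Lemma einv_mon S : einv (ext_mon R S) = (-1) ^+ #|S| *: ext_mon R S.
Proof.
apply/ffunP=> T; rewrite einvE extZE !ffunE.
by case: eqP => [->|]; rewrite ?mulr0.
Qed.

Lemma einv1 : einv 1 = 1.
Proof. by rewrite einv_mon cards0 scale1r. Qed.

Lemma einv_gen j u : einv (y j * u) = - (y j * einv u).
Proof.
apply/ffunP=> T; rewrite extNE einvE !ext_genM; case: ifP => jT; last by rewrite mulr0 oppr0.
rewrite einvE (cardsD1 j T) jT exprS; ring.
Qed.

Lemma einv_ctr X u : einv (ctr X u) = - ctr X (einv u).
Proof.
elim/ext_ind: u => [|u v Hu Hv|a u Hu|i u Hu].
- by rewrite einv1 ctr1 !linear0.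
- by rewrite !linearD /= Hu Hv.
- by rewrite !linearZ /= Hu.
rewrite einv_gen linearN /= !ctr_gen linearB /= linearZ /= einv_gen Hu.
by rewrite mulrN !opprK.
Qed.

Lemma ctrM X u v : ctr X (u * v) = ctr X u * v + einv u * ctr X v.
Proof.
elim/ext_ind: u => [|u w Hu Hw|a u Hu|i u Hu].
- by rewrite einv1 ctr1 !mul1r mul0r add0r.
- by rewrite mulrDl !linearD /= Hu Hw !mulrDl addrACA.
- by rewrite -!scalerAl !linearZ /= Hu -!scalerAl scalerDr.
by rewrite -mulrA !ctr_gen Hu einv_gen mulrBl -scalerAl mulrDr mulNr !mulrA opprD addrA.
Qed.

Lemma ext_gen_mon j S : j \notin S ->
  y j * ext_mon R S = (-1) ^+ nbelow j S *: ext_mon R (j |: S).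
Proof.
move=> njS; rewrite ext_monM disjoints1 njS; congr (_ ^+ _ *: _).
by rewrite /ninv big_set1.
Qed.

Lemma ext_monU1 j S : j \notin S ->
  ext_mon R (j |: S) = (-1) ^+ nbelow j S *: (y j * ext_mon R S).
Proof. by move=> njS; rewrite ext_gen_mon // signr_scaleK. Qed.

Lemma ext_gen_mon0 j S : j \in S -> y j * ext_mon R S = 0.
Proof. by move=> jS; rewrite ext_monM disjoints1 jS. Qed.

End Exterior.

(** * Iterated graded commutators of operators, and supports of exterior elements *)

Section ExteriorOps.
Variables (n : nat) (R : comNzRingType).
Local Notation E := (extalg n R).
Local Notation y := (ext_gen R).
Implicit Types (S T U : {set 'I_n}) (u v w : E) (X Y : 'I_n -> R).
Implicit Types (Q : pred {set 'I_n}).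

Definition lform (a : 'I_n -> R) : E := \sum_i a i *: y i.

Definition lmul (a u : E) : E := a * u.
Lemma lmul_is_linear a : linear (lmul a).
Proof. by move=> c u v; rewrite /lmul mulrDr scalerAr. Qed.
HB.instance Definition _ a := GRing.isLinear.Build R E E _ (lmul a) (lmul_is_linear a).

(** In [qout] and in [qin] the head of [js] is the operator nearest to the one in the middle, which
    matches the way [gcomm] peels it off. *)
Definition qout (I : Type) (q : I -> E -> E) (js : seq I) u := foldl (fun v j => q j v) u js.
Definition qin (I : Type) (q : I -> E -> E) (js : seq I) u := foldr q u js.

(* Iterated graded commutator of [O] with the operators [q j]; [d] is the      *)
(* parity of the degree of [O].                                               *)
Fixpoint gcomm (I : Type) (q : I -> E -> E) (d : nat) (js : seq I) (O : E -> E) : E -> E :=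
  if js is j :: js' then
    gcomm q d.+1 js' (fun u => q j (O u) - (-1) ^+ d *: O (q j u))
  else O.

Section Comm.
Variables (I : eqType) (q : I -> {linear E -> E}).
Implicit Types (K : pred I) (js : seq I) (O : E -> E).
Local Notation qo := (qout (fun j => q j)).
Local Notation qi := (qin (fun j => q j)).

Lemma qoutD js u v : qo js (u + v) = qo js u + qo js v.
Proof. by elim: js u v => //= j js IH u v; rewrite linearD IH. Qed.

Lemma qoutZ js a u : qo js (a *: u) = a *: qo js u.
Proof. by elim: js u => //= j js IH u; rewrite linearZ IH. Qed.

Lemma qinZ js a u : qi js (a *: u) = a *: qi js u.
Proof. by elim: js => //= j js IH; rewrite IH linearZ. Qed.

Let filterU j K js : j \notin js ->
  (filter [pred i | (i == j) || K i] js = filter K js) *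
  (filter (predC [pred i | (i == j) || K i]) js = filter (predC K) js) *
  (filter [pred i | (i != j) && K i] js = filter K js) *
  (filter (predC [pred i | (i != j) && K i]) js = filter (predC K) js) *
  (has [pred i | (i != j) && K i] js = has K js).
Proof.
move=> njs.
by do 4?split; (try apply: eq_in_filter); (try apply: eq_in_has) => i ijs /=;
  case: eqP ijs njs => // -> ->.
Qed.

(** Expanding the commutator gives one signed word for each set [K] of operators sent to the left of
    [O]. As the coefficients are signs, W need only be stable under sums and opposites, not under
    scalars. *)
Lemma gcommP (W : E -> Prop) d js O u : uniq js ->
  (forall u v, W u -> W v -> W (u + v)) -> (forall u, W u -> W (- u)) ->
  (forall K, W (qo (filter K js) (O (qi (filter (predC K) js) u)))) ->
  W (gcomm (fun j => q j) d js O u).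
Proof.
move=> + WD WN; elim: js d O => [|j js IH] d O /= => [_ WO|/andP[njs Ujs] WO].
  exact: (WO xpred0).
apply: IH => // K; rewrite qoutD -scaleNr qoutZ; apply: WD.
  by have := WO [pred i | (i == j) || K i]; rewrite !filterU //= eqxx.
rewrite scaleNr; apply: (WN); rewrite -signr_odd.
have {WO} := WO [pred i | (i != j) && K i]; rewrite !filterU //= eqxx /= => WO.
by case: (odd d); rewrite ?scaleN1r ?scale1r //; apply: WN.
Qed.

(** Isolates the single word with all operators to the right of [O]; it serves to evaluate a
    commutator at a point where all other words vanish. *)
Lemma gcomm_tail (W : E -> Prop) d js O u : uniq js -> W 0 ->
  (forall u v, W u -> W v -> W (u + v)) -> (forall a u, W u -> W (a *: u)) ->
  (forall K, has K js -> W (qo (filter K js) (O (qi (filter (predC K) js) u)))) ->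
  exists b : bool, W (gcomm (fun j => q j) d js O u - (-1) ^+ b *: O (qi js u)).
Proof.
move=> + W0 WD WZ; elim: js d O => [|j js IH] d O /= => [_ _|/andP[njs Ujs] WO].
  by exists false; rewrite scale1r subrr.
have WO1 K : W (qo (filter K js) (q j (O (qi (filter (predC K) js) u)))).
  by have := WO [pred i | (i == j) || K i]; rewrite !filterU //= eqxx; apply.
have WO2 K : has K js -> W (qo (filter K js) (O (q j (qi (filter (predC K) js) u)))).
  by have := WO [pred i | (i != j) && K i]; rewrite !filterU //= eqxx.
have [|b Wb] := IH d.+1 (fun u => q j (O u) - (-1) ^+ d *: O (q j u)) Ujs.
  move=> K hK; rewrite qoutD -scaleNr qoutZ; apply: WD => //; exact/WZ/WO2.
exists (~~ odd d (+) b); set G := gcomm _ _ _ _ _ in Wb *.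
have {}WO1 : W (q j (O (qi js u))).
  have := WO1 xpred0; rewrite filter_pred0 /=.
  by rewrite (eq_filter (a2 := predT)) ?filter_predT.
suff <- : G - (-1) ^+ b *: (q j (O (qi js u)) - (-1) ^+ d *: O (q j (qi js u)))
   + (-1) ^+ b *: q j (O (qi js u)) =
   G - (-1) ^+ (~~ odd d (+) b) *: O (q j (qi js u)) by exact/WD/WZ.
rewrite -addrA; congr (_ + _); rewrite scalerBr opprB scalerA subrK.
rewrite -scaleNr; congr (_ *: _).
rewrite signr_addb signrN signr_odd; ring.
Qed.
End Comm.

(** By the graded Leibniz rule, the commutator of [ctr X] with multiplication by a homogeneous [a]
    is multiplication by [ctr X a], of the opposite parity. *)
Lemma gcomm_lmul (I : eqType) (Z : I -> 'I_n -> R) d js a O u :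
  (forall u, O u = a * u) -> einv a = (-1) ^+ d *: a ->
  gcomm (fun j => ctr (Z j)) d js O u = qout (fun j => ctr (Z j)) js a * u.
Proof.
elim: js d a O => //= j js IH d a O eO ea; apply: IH => [v|].
  by rewrite !eO ctrM ea scalerAl addrK.
by rewrite einv_ctr ea linearZ /= -scaleNr exprS mulN1r.
Qed.

(** Linear combinations of d-fold compositions of contractions, up to pointwise equality of
    operators. *)
Inductive ctrop : nat -> (E -> E) -> Prop :=
| Ctrop0 s O of (forall u, O u = s *: u) : ctrop 0 O
| CtropS d X O O' of ctrop d O & (forall u, O' u = ctr X (O u)) : ctrop d.+1 O'
| CtropD d O1 O2 O' of ctrop d O1 & ctrop d O2 & (forall u, O' u = O1 u + O2 u) : ctrop d O'
| CtropZ d s O O' of ctrop d O & (forall u, O' u = s *: O u) : ctrop d O'.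

Lemma ctrop_lin d O : ctrop d O -> (forall u v, O (u + v) = O u + O v) *
  (forall a u, O (a *: u) = a *: O u).
Proof.
elim=> {d O}[s O eO|d X O O' _ [OD OZ] eO|d O1 O2 O' _ [D1 Z1] _ [D2 Z2] eO|d s O O' _ [OD OZ] eO].
- by split=> [u v|a u]; rewrite !eO ?scalerDr // !scalerA mulrC.
- by split=> [u v|a u]; rewrite !eO ?OD ?OZ ?linearD ?linearZ.
- by split=> [u v|a u]; rewrite !eO ?D1 ?D2 ?Z1 ?Z2 ?scalerDr // addrACA.
by split=> [u v|a u]; rewrite !eO ?OD ?OZ ?scalerDr // !scalerA mulrC.
Qed.

(** The graded commutator of a 1-form with one contraction is the scalar pairing of the two
    ([ctr_lin]), so each commutator removes one contraction. *)
Lemma ctrop_comm (a : 'I_n -> R) d O : ctrop d O ->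
  let O' u := lform a * O u - (-1) ^+ d *: O (lform a * u) in
  if d is d'.+1 then ctrop d' O' else forall u, O' u = 0.
Proof.
elim=> {d O}[s O eO|d X O O' cO IH eO|d O1 O2 O' c1 IH1 c2 IH2 eO|d s O O' cO IH eO] /=.
- by move=> u; rewrite !eO scale1r -scalerAr subrr.
- have [OD OZ] := ctrop_lin cO.
  pose s := \sum_i a i * X i.
  have cs : ctrop d (fun u => s *: O u) by apply: (CtropZ cO).
  have e u : lform a * O' u - (-1) ^+ d.+1 *: O' (lform a * u) =
     s *: O u - ctr X (lform a * O u - (-1) ^+ d *: O (lform a * u)).
    rewrite !eO linearB linearZ /= ctr_lin -/s -/(lform a) !opprB.
    by rewrite addrCA [s *: _ + _]addrC subrK exprS mulN1r scaleNr scalerN opprK linearZ /= addrC.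
  case: d IH cs {cO} e => [|d] IH cs e.
    by apply: (CtropZ (s := 1) cs) => u; rewrite e IH linear0 subr0 scale1r.
  apply: (CtropD cs (O2 := fun u => -1 *: ctr X (lform a * O u - (-1) ^+ d.+1 *: O (lform a * u)))).
    by apply: (CtropZ (CtropS IH (fun _ => erefl _))).
  by move=> u; rewrite e scaleN1r.
- have e u : lform a * O' u - (-1) ^+ d *: O' (lform a * u) =
     (lform a * O1 u - (-1) ^+ d *: O1 (lform a * u)) +
     (lform a * O2 u - (-1) ^+ d *: O2 (lform a * u)).
    by rewrite !eO mulrDr scalerDr opprD addrACA.
  case: d IH1 IH2 {c1 c2} e => [|d] H1 H2 e; first by move=> u; rewrite e H1 H2 addr0.
  exact: (CtropD H1 H2).
have e u : lform a * O' u - (-1) ^+ d *: O' (lform a * u) =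
   s *: (lform a * O u - (-1) ^+ d *: O (lform a * u)).
  by rewrite !eO -scalerAr scalerBr !scalerA [s * _]mulrC.
case: d IH {cO} e => [|d] IH e; first by move=> u; rewrite e IH scaler0.
exact: (CtropZ IH).
Qed.

Lemma ctrop0P O : ctrop 0 O -> exists s, forall u, O u = s *: u.
Proof.
suff H d : ctrop d O -> d = 0%N -> exists s, forall u, O u = s *: u by move/H; apply.
elim=> {d O}//.
- by move=> s O eO _; exists s.
- move=> d O1 O2 O' _ IH1 _ IH2 eO d0.
  have [[s1 e1] [s2 e2]] := (IH1 d0, IH2 d0).
  by exists (s1 + s2) => u; rewrite eO e1 e2 scalerDl.
move=> d s O O' _ IH eO d0; have [s1 e1] := IH d0.
by exists (s * s1) => u; rewrite eO e1 scalerA.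
Qed.

(** As many commutators as contractions leave only a scalar. The parity hypothesis makes the signs
    used by [gcomm] those of the degree of [O]. *)
Lemma gcomm_ctrop (I : eqType) (t : I -> 'I_n -> R) d js O :
  ctrop (size js) O -> odd (size js) = odd d ->
  exists s, forall u, gcomm (fun j => lmul (lform (t j))) d js O u = s *: u.
Proof.
elim: js d O => [|j js IH] d O /= cO ed; first exact: ctrop0P.
apply: IH; last by rewrite /= -ed negbK.
have /= := ctrop_comm (t j) cO.
by rewrite -(signr_odd _ d) -ed -(signr_odd _ (size js).+1).
Qed.

Definition supp Q u := forall T, u T != 0 -> Q T.

Lemma supp0 Q : supp Q 0.
Proof. by move=> T; rewrite ffunE eqxx. Qed.

Lemma suppD Q u v : supp Q u -> supp Q v -> supp Q (u + v).
Proof.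
move=> Qu Qv T; rewrite extDE; have [->|/Qu //] := eqVneq (u T) 0.
by rewrite add0r; apply: Qv.
Qed.

Lemma suppZ Q a u : supp Q u -> supp Q (a *: u).
Proof.
move=> Qu T; rewrite extZE => auT; apply: Qu; apply: contraNneq auT => ->.
by rewrite mulr0 eqxx.
Qed.

Lemma suppN Q u : supp Q u -> supp Q (- u).
Proof. by move=> Qu; rewrite -scaleN1r; apply: suppZ. Qed.

Lemma supp_sum Q (I : Type) (r : seq I) (P : pred I) (f : I -> E) :
  (forall i, P i -> supp Q (f i)) -> supp Q (\sum_(i <- r | P i) f i).
Proof. by move=> Qf; apply: big_ind => //; [apply: supp0 | apply: suppD]. Qed.

Lemma supp_mon Q S : Q S -> supp Q (ext_mon R S).
Proof. by move=> QS T; rewrite ffunE; case: (S =P T) => [<-|]; rewrite ?eqxx. Qed.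

Lemma suppW Q Q' u : subpred Q Q' -> supp Q u -> supp Q' u.
Proof. by move=> sQ Qu T /Qu/sQ. Qed.

Lemma suppM Q1 Q2 Q u v : supp Q1 u -> supp Q2 v ->
  (forall S T, [disjoint S & T] -> Q1 S -> Q2 T -> Q (S :|: T)) -> supp Q (u * v).
Proof.
move=> Qu Qv QQ; rewrite [u]ext_sum_mon [v]ext_sum_mon mulr_suml.
apply: supp_sum => S _; rewrite mulr_sumr; apply: supp_sum => T _.
rewrite -scalerAl -scalerAr scalerA.
have [uS|/Qu QS] := eqVneq (u S) 0; first by rewrite uS mul0r scale0r; apply: supp0.
have [vT|/Qv QT] := eqVneq (v T) 0; first by rewrite vT mulr0 scale0r; apply: supp0.
rewrite ext_monM; case: ifP => dST; last by rewrite scaler0; apply: supp0.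
by apply/suppZ/suppZ/supp_mon/QQ.
Qed.

Lemma supp_ctr Q Q' X u : supp Q u ->
  (forall i T, i \notin T -> Q (i |: T) -> X i != 0 -> Q' T) -> supp Q' (ctr X u).
Proof.
move=> Qu QQ T; rewrite ctrE; apply: contraR => nQT; apply/eqP/big1 => i niT.
have [->|Xi] := eqVneq (X i) 0; first by rewrite mulr0 mul0r.
have [->|/Qu QiT] := eqVneq (u (i |: T)) 0; first by rewrite mulr0.
by case/negP: nQT; apply: QQ QiT Xi.
Qed.

Lemma supp_mulmon Q S u : supp Q u -> supp (fun T => (S \subset T) && Q (T :\: S)) (ext_mon R S * u).
Proof.
move=> Qu; apply: (suppM (Q1 := pred1 S) (supp_mon _) Qu) => /=; first by apply/eqP.
move=> S' T dST /eqP eS QT; rewrite eS in dST *; rewrite subsetUl /=.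
rewrite setDUl setDv set0U (setDidPl _) // disjoint_sym //.
Qed.

Lemma mulmon_factor S u : supp (fun T => S \subset T) u ->
  exists2 v, u = ext_mon R S * v & supp (fun T => [exists U : {set 'I_n}, (u U != 0) && (T == U :\: S)]) v.
Proof.
move=> Su; exists (\sum_(T : {set 'I_n} | S \subset T) (u T * (-1) ^+ ninv S (T :\: S)) *: ext_mon R (T :\: S)).
  rewrite mulr_sumr [LHS]ext_sum_mon (bigID (fun T : {set 'I_n} => S \subset T)) /=.
  rewrite [X in _ + X]big1 ?addr0 => [|T nST]; last first.
    have [->|/Su] := eqVneq (u T) 0; first by rewrite scale0r.
    by rewrite (negPf nST).
  apply: eq_bigr => T sST; rewrite -scalerAr ext_monM.
  have -> : [disjoint S & T :\: S].
    by rewrite -setI_eq0; apply/eqP/setP=> i; rewrite !inE; case: (i \in S).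
  rewrite scalerA -mulrA -exprD addnn -mul2n exprM sqrrN !expr1n mulr1.
  by rewrite -{1}(setIidPr sST) setID.
apply: supp_sum => T sST; have [->|uT] := eqVneq (u T) 0.
  by rewrite mul0r scale0r; apply: supp0.
by apply/suppZ/supp_mon/existsP; exists T; rewrite uT eqxx.
Qed.
End ExteriorOps.

(** * Divisibility by products of linear forms *)

Section Polynomials.
Section Divides.
Variable D : idomainType.
Implicit Types a b c f h : D.

Definition mdvd a b := exists h, b = h * a.

(* [b] is a nonzerodivisor modulo [a]. *)
Definition cop a b := forall h, mdvd a (b * h) -> mdvd a h.

Lemma mdvd0 a : mdvd a 0. Proof. by exists 0; rewrite mul0r. Qed.
Lemma mdvdD a b c : mdvd a b -> mdvd a c -> mdvd a (b + c).
Proof. by move=> [h ->] [k ->]; exists (h + k); rewrite mulrDl. Qed.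
Lemma mdvd_mull a b c : mdvd a b -> mdvd a (c * b).
Proof. by move=> [h ->]; exists (c * h); rewrite mulrA. Qed.
Lemma mdvd_mulr a b c : mdvd a b -> mdvd a (b * c).
Proof. by rewrite mulrC; apply: mdvd_mull. Qed.
Lemma mdvdN a b : mdvd a b -> mdvd a (- b).
Proof. by rewrite -mulN1r; apply: mdvd_mull. Qed.
Lemma mdvdd a : mdvd a a. Proof. by exists 1; rewrite mul1r. Qed.
Lemma mdvd_sum a (I : Type) (r : seq I) (P : pred I) (f : I -> D) :
  (forall i, P i -> mdvd a (f i)) -> mdvd a (\sum_(i <- r | P i) f i).
Proof. by move=> df; apply: big_ind => //; [apply: mdvd0 | apply: mdvdD]. Qed.

Lemma cop1 a : cop a 1. Proof. by move=> h; rewrite mul1r. Qed.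
Lemma copM a b c : cop a b -> cop a c -> cop a (b * c).
Proof. by move=> ab ac h; rewrite -mulrA => /ab/ac. Qed.
Lemma cop1l a : cop 1 a. Proof. by move=> h _; exists h; rewrite mulr1. Qed.
Lemma copMl a b c : cop a c -> cop b c -> cop (a * b) c.
Proof.
move=> ac bc h [k e].
have [k' eh] : mdvd a h by apply: ac; exists (k * b); rewrite e; ring.
have [a0|a_neq0] := eqVneq a 0; first by exists 0; rewrite eh a0 mulr0 mul0r.
have [k2 e2] : mdvd b k'.
  apply: bc; exists k; apply: (mulfI a_neq0); move: e; rewrite eh => e.
  by transitivity (c * (k' * a)); [ring | rewrite e; ring].
by exists k2; rewrite eh e2; ring.
Qed.
Lemma cop_mdvd a b f : cop a b -> mdvd a f -> mdvd b f -> mdvd (a * b) f.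
Proof.
move=> ab af [h e]; have [k eh] : mdvd a h by apply: ab; rewrite mulrC -e.
by exists k; rewrite e eh; ring.
Qed.
Lemma cop_prod a (I : Type) (r : seq I) (P : pred I) (f : I -> D) :
  (forall i, P i -> cop a (f i)) -> cop a (\prod_(i <- r | P i) f i).
Proof. by move=> cf; apply: big_ind => //; [apply: cop1 | apply: copM]. Qed.
Lemma cop_prodl a (I : Type) (r : seq I) (P : pred I) (f : I -> D) :
  (forall i, P i -> cop (f i) a) -> cop (\prod_(i <- r | P i) f i) a.
Proof.
by move=> cf; apply: (big_ind (cop^~ a)) => //; [apply: cop1l | move=> x y; apply: copMl].
Qed.
Lemma copX a b k : cop a b -> cop a (b ^+ k).
Proof. by move=> ab; elim: k => [|k IH]; [apply: cop1 | rewrite exprS; apply: copM]. Qed.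
Lemma copXl a b k : cop a b -> cop (a ^+ k) b.
Proof. by move=> ab; elim: k => [|k IH]; [apply: cop1l | rewrite exprS; apply: copMl]. Qed.

(** Takes the place of unique factorization: [cop] is only ever established from pairs of linear
    forms. *)
Lemma prod_mdvd (I : eqType) (r : seq I) (P : pred I) (f : I -> D) h : uniq r ->
  (forall i j, i \in r -> j \in r -> P i -> P j -> i != j -> cop (f i) (f j)) ->
  (forall i, i \in r -> P i -> mdvd (f i) h) -> mdvd (\prod_(i <- r | P i) f i) h.
Proof.
elim: r => [|i r IH] /=; first by rewrite big_nil => _ _ _; exists h; rewrite mulr1.
case/andP=> nir Ur cf df; rewrite big_cons.
have {}IH : mdvd (\prod_(i <- r | P i) f i) h.
  by apply: IH => // [j k jr kr|j jr]; [apply: cf | apply: df]; rewrite inE ?jr ?kr orbT.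
case: ifP => // Pi; apply: cop_mdvd => //; last by apply: df; rewrite ?mem_head.
rewrite big_seq_cond; apply: cop_prod => j /andP[jr Pj].
apply: cf; rewrite ?mem_head // ?inE ?jr ?orbT //.
by apply: contraNneq nir => ->.
Qed.

End Divides.

Variables (n : nat) (F : finFieldType).
Local Notation P := {mpoly F[n]}.
Local Notation A := (extalg n P).
Implicit Types (g h : 'M[F]_n) (p : P) (u v : A) (c d : 'rV[F]_n).

Definition lin c : P := \sum_i c 0 i *: 'X_i.

Lemma lin_is_linear : linear lin.
Proof.
move=> a c d; rewrite /lin scaler_sumr -big_split; apply: eq_bigr => i _.
by rewrite !mxE scalerDl scalerA.
Qed.
HB.instance Definition _ := GRing.isLinear.Build F 'rV[F]_n P _ lin lin_is_linear.

Lemma lin_delta i : lin (delta_mx 0 i) = 'X_i.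
Proof.
rewrite /lin (bigD1 i) //= mxE !eqxx scale1r big1 ?addr0 // => j /negPf ne.
by rewrite mxE ne andbF scale0r.
Qed.

Lemma lin_coef c i : (lin c)@_(U_(i)) = c 0 i.
Proof.
rewrite raddf_sum (bigD1 i) //= mcoeffZ mcoeffX eqxx mulr1 big1 ?addr0 // => j /negPf ne.
rewrite mcoeffZ mcoeffX; case: eqP => [/mnmP/(_ j)|]; last by rewrite mulr0.
by rewrite !mnm1E eqxx eq_sym ne.
Qed.

Lemma lin_eq0 c : (lin c == 0) = (c == 0).
Proof.
apply/eqP/eqP => [c0|->]; last by rewrite linear0.
by apply/rowP=> i; rewrite -lin_coef c0 mcoeff0 mxE.
Qed.

Lemma poly_actZ g (a : F) p : poly_act g (a *: p) = a *: poly_act g p.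
Proof. exact: comp_mpolyZ. Qed.

Lemma poly_actC g (a : F) : poly_act g a%:MP = a%:MP.
Proof. exact: comp_mpolyC. Qed.

Lemma poly_act_lin g c : poly_act g (lin c) = lin (c *m g^T).
Proof.
rewrite rmorph_sum /=.
under eq_bigr => i _ do rewrite poly_actZ poly_actX scaler_sumr.
rewrite exchange_big; apply: eq_bigr => i _ /=.
rewrite mxE scaler_suml; apply: eq_bigr => j _.
by rewrite scalerA mxE.
Qed.

Lemma poly_actX_lin g i : poly_act g 'X_i = lin (\row_k g k i).
Proof. by rewrite poly_actX; apply: eq_bigr => j _; rewrite mxE. Qed.

Lemma mpoly_gen (Q : P -> Prop) : (forall a : F, Q a%:MP) -> (forall i, Q 'X_i) ->
  (forall p q, Q p -> Q q -> Q (p + q)) -> (forall p q, Q p -> Q q -> Q (p * q)) ->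
  forall p, Q p.
Proof.
move=> QC QX QD QM p; rewrite [p]mpolyE; apply: (big_ind Q) => // [|m _].
  by rewrite -mpolyC0; apply: QC.
rewrite -mul_mpolyC mpolyXE_id; apply: (QM) => //.
apply: (big_ind Q) => // [|i _]; first by rewrite -mpolyC1; apply: QC.
by elim: (m i) => [|k IH]; [rewrite expr0 -mpolyC1; apply: QC | rewrite exprS; apply: QM].
Qed.

Lemma poly_actM g h p : poly_act (g *m h) p = poly_act g (poly_act h p).
Proof.
elim/mpoly_gen: p => [a|i|p q Hp Hq|p q Hp Hq].
- by rewrite !poly_actC.
- rewrite !poly_actX_lin poly_act_lin; congr lin.
  by apply/rowP=> j; rewrite !mxE; apply: eq_bigr => k _; rewrite !mxE mulrC.
- by rewrite !rmorphD /= Hp Hq.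
by rewrite !rmorphM /= Hp Hq.
Qed.

Lemma poly_act1 p : poly_act 1%:M p = p.
Proof.
elim/mpoly_gen: p => [a|i|p q Hp Hq|p q Hp Hq].
- by rewrite !poly_actC.
- rewrite poly_actX_lin -[RHS]lin_delta; congr lin.
  by apply/rowP=> j; rewrite !mxE eqxx.
- by rewrite !rmorphD /= Hp Hq.
by rewrite !rmorphM /= Hp Hq.
Qed.

Lemma ext_act_sum g (I : Type) (r : seq I) (Q : pred I) (f : I -> A) :
  ext_act g (\sum_(i <- r | Q i) f i) = \sum_(i <- r | Q i) ext_act g (f i).
Proof.
apply: (big_morph _ (ext_actD g)).
by rewrite -(scale0r 1) ext_actZ rmorph0 !scale0r.
Qed.

Lemma ext_act_genE g j : ext_act_gen g j = lform (fun i => (g i j)%:MP).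
Proof. by []. Qed.

Lemma ext_act_genM g h i :
  ext_act (g *m h) (ext_gen P i) = ext_act g (ext_act h (ext_gen P i)).
Proof.
rewrite (ext_actX h) (ext_actX (g *m h)) /ext_act_gen ext_act_sum.
under [RHS]eq_bigr => k _ do rewrite ext_actZ ext_actX poly_actC /ext_act_gen scaler_sumr.
rewrite exchange_big; apply: eq_bigr => k _ /=.
under [RHS]eq_bigr do rewrite scalerA.
rewrite -scaler_suml mxE rmorph_sum /=; congr (_ *: _); apply: eq_bigr => j _.
by rewrite rmorphM mulrC.
Qed.

Lemma ext_actMM g h u : ext_act (g *m h) u = ext_act g (ext_act h u).
Proof.
elim/ext_ind: u => [|u v Hu Hv|a u Hu|i u Hu].
- by rewrite !ext_act1.
- by rewrite !ext_actD Hu Hv.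
- by rewrite !ext_actZ Hu poly_actM.
by rewrite (ext_actM (g *m h)) (ext_actM h) (ext_actM g) Hu ext_act_genM.
Qed.

Lemma ext_act_id u : ext_act 1%:M u = u.
Proof.
have gen i : ext_act 1%:M (ext_gen P i) = ext_gen P i.
  rewrite ext_actX /ext_act_gen (bigD1 i) //= mxE eqxx scale1r big1 ?addr0 // => k /negPf ne.
  by rewrite mxE ne scale0r.
elim/ext_ind: u => [|u v Hu Hv|a u Hu|i u Hu].
- by rewrite !ext_act1.
- by rewrite !ext_actD Hu Hv.
- by rewrite !ext_actZ Hu poly_act1.
by rewrite ext_actM Hu gen.
Qed.

(** If the [X j] transform under g as the y_j do, the antiderivation sending y_j to [X j] commutes
    with g. *)
Lemma ext_act_ctr g (X : 'I_n -> P) u :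
  (forall j, poly_act g (X j) = \sum_i (g i j)%:MP * X i) ->
  ext_act g (ctr X u) = ctr X (ext_act g u).
Proof.
move=> eX; elim/ext_ind: u => [|u v Hu Hv|a u Hu|i u Hu].
- by rewrite ext_act1 !ctr1 -(scale0r 1) ext_actZ rmorph0 !scale0r.
- by rewrite linearD /= !ext_actD linearD /= Hu Hv.
- by rewrite linearZ /= !ext_actZ linearZ /= Hu.
rewrite ctr_gen ext_actM ext_actX ctr_lin -scaleN1r ext_actD !ext_actZ ext_actM Hu ext_actX.
by rewrite eX rmorphN1 scaleN1r.
Qed.

(** The action of g and the identity are two ring morphisms into P modulo a that agree on
    generators. *)
Lemma poly_act_congr g (a : P) p :
  (forall j, mdvd a (poly_act g 'X_j - 'X_j)) -> mdvd a (poly_act g p - p).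
Proof.
move=> da; elim/mpoly_gen: p => [b|i|p q Hp Hq|p q Hp Hq] //.
- by rewrite poly_actC subrr; apply: mdvd0.
- by rewrite rmorphD opprD addrACA; apply: mdvdD.
rewrite rmorphM; set p' := poly_act g p in Hp *; set q' := poly_act g q in Hq *.
have -> : p' * q' - p * q = p' * (q' - q) + (p' - p) * q by ring.
by apply: mdvdD; [apply: mdvd_mull | apply: mdvd_mulr].
Qed.

(** A normal form up to scalars, with last nonzero coordinate 1 in position j: distinct monic
    vectors are not proportional. *)
Definition monic_at c j := (c 0 j == 1) && [forall i : 'I_n, (j < i)%N ==> (c 0 i == 0)].

(** When [c 0 j = 1] this singular substitution is the projection of P onto the quotient by [lin c],
    eliminating x_j. *)
Definition elim_mx c j : 'M[F]_n := 1%:M - \matrix_(i, k) ((k == j)%:R * c 0 i).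

Lemma elim_mxX c j k : poly_act (elim_mx c j) 'X_k = 'X_k - (k == j)%:R *: lin c.
Proof.
rewrite poly_actX_lin -lin_delta -linearZ -linearB /=; congr lin.
by apply/rowP=> i; rewrite !mxE eqxx.
Qed.

Lemma elim_mx_lin c j d : poly_act (elim_mx c j) (lin d) = lin d - d 0 j *: lin c.
Proof.
rewrite /lin rmorph_sum /=; under eq_bigr do rewrite poly_actZ elim_mxX scalerBr.
rewrite sumrB; congr (_ - _); rewrite (bigD1 j) //= eqxx scale1r big1 ?addr0 // => i /negPf->.
by rewrite scale0r scaler0.
Qed.

(** The substitution kills [lin c] and is the identity modulo it, so its kernel is the ideal of
    [lin c]. As P is a domain, this ideal is prime, which is how [lin_cop] uses it. *)
Lemma elim_mxP c j p : c 0 j = 1 -> mdvd (lin c) p <-> poly_act (elim_mx c j) p = 0.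
Proof.
move=> cj; split=> [[h ->]|p0]; first by rewrite rmorphM /= elim_mx_lin cj scale1r subrr mulr0.
rewrite -[p]opprK; apply: mdvdN; rewrite -[- p]add0r -p0; apply: poly_act_congr => k.
rewrite elim_mxX addrC addKr -scaleNr -mul_mpolyC; exact/mdvd_mull/mdvdd.
Qed.

Lemma lin_cop c j p : c 0 j = 1 -> ~ mdvd (lin c) p -> cop (lin c) p.
Proof.
move=> cj ndvd h /(elim_mxP _ cj)/eqP; rewrite rmorphM mulf_eq0.
by case/orP=> /eqP/(elim_mxP _ cj).
Qed.

Lemma monic_lin_cop c d i j : monic_at c i -> monic_at d j -> c != d -> cop (lin c) (lin d).
Proof.
case/andP=> /eqP ci /forallP c0 /andP[/eqP dj /forallP d0] necd.
apply: (lin_cop ci) => /(elim_mxP _ ci)/eqP.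
rewrite elim_mx_lin -linearZ -linearB /= lin_eq0 subr_eq0 => /eqP ed.
have dE k : d 0 k = d 0 i * c 0 k by rewrite {1}ed mxE.
have di : d 0 i != 0 by apply/eqP=> d_i; move: (oner_neq0 F); rewrite -dj dE d_i mul0r eqxx.
have cj : c 0 j != 0 by apply/eqP=> c_j; move: (oner_neq0 F); rewrite -dj dE c_j mulr0 eqxx.
have le_ji : (j <= i)%N.
  by rewrite leqNgt; apply: contra cj => /(implyP (c0 j)).
have le_ij : (i <= j)%N.
  by rewrite leqNgt; apply: contra di => /(implyP (d0 i)).
have eij : i = j by apply/val_inj/eqP; rewrite eqn_leq le_ij.
case/negP: necd; apply/eqP/rowP=> k; rewrite dE eij dj mul1r.
by [].
Qed.

Definition diag1 j (w : F) : 'M[F]_n := diag_mx (\row_k (if k == j then w else 1)).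

Lemma diag1X j w k : poly_act (diag1 j w) 'X_k = (if k == j then w else 1) *: 'X_k.
Proof.
rewrite poly_actX (bigD1 k) //= !mxE eqxx mulr1n big1 ?addr0 // => i /negPf ne.
by rewrite !mxE ne scale0r.
Qed.

Lemma diag1_coef j w p (m : 'X_{1..n}) : (poly_act (diag1 j w) p)@_m = w ^+ m j * p@_m.
Proof.
have mon m' : poly_act (diag1 j w) 'X_[m'] = w ^+ m' j *: 'X_[m'].
  rewrite !mpolyXE_id rmorph_prod (bigD1 j) //= [in RHS](bigD1 j) //= scalerAl.
  rewrite rmorphXn /= diag1X eqxx exprZn; congr (_ * _); apply: eq_bigr => k /negPf ne.
  by rewrite rmorphXn /= diag1X ne scale1r.
rewrite {1}[p]mpolyE rmorph_sum /= raddf_sum /=.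
rewrite [in RHS](mpolyE p) raddf_sum /= mulr_sumr; apply: eq_bigr => m' _.
rewrite poly_actZ mon !mcoeffZ mcoeffX; case: eqP => [->|]; rewrite ?mulr0 //.
by rewrite !mulr1 mulrC.
Qed.

(** Every monomial of p has x_j-exponent congruent to s modulo r, hence at least s because s < r. *)
Lemma diag1_adic j w (r s : nat) p : r.-primitive_root w -> (s < r)%N ->
  poly_act (diag1 j w) p = w ^+ s *: p -> mdvd ('X_j ^+ s) p.
Proof.
move=> prw lt_sr e; rewrite [p]mpolyE big_seq_cond; apply: mdvd_sum => m.
rewrite andbT mcoeff_msupp => pm; rewrite -mul_mpolyC; apply: mdvd_mull.
have /mulIf : p@_m != 0 by [].
move/(_ (w ^+ m j) (w ^+ s)); rewrite -diag1_coef e mcoeffZ => /(_ erefl)/eqP.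
rewrite (eq_prim_root_expr prw) => /eqP em.
have le_sm : (s <= m j)%N by rewrite -(modn_small lt_sr) -em leq_mod.
rewrite [in X in mdvd _ X]mpolyXE_id (bigD1 j) //=; apply: mdvd_mulr.
by exists ('X_j ^+ (m j - s)); rewrite -exprD subnK.
Qed.

Lemma mdvd_act g (a : P) p : mdvd a p -> mdvd (poly_act g a) (poly_act g p).
Proof. by move=> [h ->]; exists (poly_act g h); rewrite rmorphM. Qed.

End Polynomials.

(** * Additive polynomials and the Moore determinant *)

Section Moore.
Variables (n : nat) (F : finFieldType).
Local Notation P := {mpoly F[n]}.
Local Notation A := (extalg n P).
Local Notation q := #|F|.
Implicit Types (g h : 'M[F]_n) (p : P) (u v : A) (c d : 'rV[F]_n).

Section Homogenize.
Local Notation frac := (@tofrac P).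
Local Notation fracC := (frac \o @mpolyC n F).

(** Evaluates a split one-variable polynomial at T/S in the fraction field and clears denominators;
    it homogenizes the factorizations of X^q - X and X^r - 1. *)
Lemma hom_split (I : Type) (s : seq I) (f : I -> F) (T S : P) : S != 0 ->
  frac (\prod_(a <- s) (T - f a *: S)) =
  frac S ^+ size s * (map_poly fracC (\prod_(a <- s) ('X - (f a)%:P))).[frac T / frac S].
Proof.
move=> S0; have fS0 : frac S != 0 by rewrite tofrac_eq0.
elim: s => [|a s IH]; first by rewrite !big_nil expr0 mul1r !rmorph1 -polyC1 hornerC.
rewrite !big_cons tofracM IH tofracB rmorphM hornerM /= rmorphB /= map_polyX map_polyC hornerXsubC /=.
rewrite -mul_mpolyC tofracM exprS.
set x := horner _ _; set t := frac T; set b := frac S; set e := frac _.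
have -> : t - e * b = b * (t / b - e) by rewrite mulrBr [b * (t / b)]mulrC divfK // [b * e]mulrC.
by ring.
Qed.

Lemma prod_field_lin (T S : P) : \prod_(a : F) (T + a *: S) = T ^+ q - S ^+ q.-1 * T.
Proof.
have q1 : (1 < q)%N := finRing_gt1 _.
have [->|S0] := eqVneq S 0.
  under eq_bigr do rewrite scaler0 addr0.
  rewrite prodr_const cardT -cardE expr0n.
  by case: (q) q1 => // -[//|k] _ /=; rewrite mul0r subr0.
have fS0 : frac S != 0 by rewrite tofrac_eq0.
apply/eqP; rewrite -tofrac_eq; apply/eqP; rewrite (reindex_inj (@oppr_inj F)) /=.
under eq_bigr do rewrite scaleNr.
rewrite hom_split // -finField_genPoly rmorphB rmorphXn /= map_polyX hornerD hornerN hornerXn hornerX.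
have -> : size (index_enum F) = q by rewrite cardT enumT.
rewrite tofracB tofracM !tofracXn mulrBr expr_div_n mulrCA divff ?expf_neq0 // mulr1.
rewrite -{2}(prednK (ltnW q1)) exprSr -mulrA [_ * (_ / _)]mulrC divfK //.
Qed.

Lemma prod_root_lin (r : nat) (w : F) (T S : P) : (0 < r)%N -> r.-primitive_root w ->
  \prod_(i < r) (T - w ^+ i *: S) = T ^+ r - S ^+ r.
Proof.
move=> r0 prw; have [->|S0] := eqVneq S 0.
  under eq_bigr do rewrite scaler0 subr0.
  by rewrite prodr_const cardT size_enum_ord expr0n; case: r r0 {prw}=> //= r _; rewrite subr0.
have fS0 : frac S != 0 by rewrite tofrac_eq0.
apply/eqP; rewrite -tofrac_eq; apply/eqP; rewrite -(big_mkord predT (fun i => T - w ^+ i *: S)).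
rewrite hom_split // factor_Xn_sub_1 // rmorphB rmorphXn /= map_polyX rmorph1.
rewrite hornerD hornerN hornerXn hornerC size_iota subn0.
by rewrite tofracB !tofracXn mulrBr expr_div_n mulrCA divff ?expf_neq0 // !mulr1.
Qed.
End Homogenize.

Variables (ch k : nat).
Hypotheses (ch_prime : prime ch) (cardF : q = (ch ^ k)%N).

Lemma frobD (a b : P) (e : nat) : (a + b) ^+ (q ^ e) = a ^+ (q ^ e) + b ^+ (q ^ e).
Proof.
apply: GRing.exprDn_pchar; rewrite (eq_pnat _ (pchar_lalg _)).
rewrite (eq_pnat _ (pcharf_eq (card_finPcharP cardF ch_prime))).
by rewrite cardF -expnM pnatX pnat_id.
Qed.

Lemma frobC (c : F) (e : nat) : c ^+ (q ^ e) = c.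
Proof. by elim: e => // e IH; rewrite expnSr exprM IH expf_card. Qed.

Lemma frobZ (c : F) (a : P) (e : nat) : (c *: a) ^+ (q ^ e) = c *: a ^+ (q ^ e).
Proof. by rewrite exprZn frobC. Qed.

Definition low m c := [forall i : 'I_n, (m <= i)%N ==> (c 0 i == 0)].

Lemma lowP m c : reflect (forall i : 'I_n, (m <= i)%N -> c 0 i = 0) (low m c).
Proof.
apply: (iffP forallP) => [lc i mi|lc i]; first by have /implyP/(_ mi)/eqP := lc i.
by apply/implyP=> mi; apply/eqP/lc.
Qed.

Lemma low0 m : low m 0. Proof. by apply/lowP=> i _; rewrite mxE. Qed.

Lemma lowD m c d : low m c -> low m d -> low m (c + d).
Proof. by move=> /lowP c0 /lowP d0; apply/lowP=> i mi; rewrite mxE c0 // d0 // addr0. Qed.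

Lemma lowZ m a c : low m c -> low m (a *: c).
Proof. by move=> /lowP c0; apply/lowP=> i mi; rewrite mxE c0 // mulr0. Qed.

Lemma lowN m c : low m (- c) = low m c.
Proof. by apply: eq_forallb => i; rewrite mxE oppr_eq0. Qed.

Lemma lowW m m' c : (m <= m')%N -> low m c -> low m' c.
Proof. by move=> mm /lowP c0; apply/lowP=> i mi; apply/c0/leq_trans/mi. Qed.

Lemma low_delta m i : low m (delta_mx 0 i) = (i < m)%N.
Proof.
apply/lowP/idP => [d0|im j mj].
  by rewrite ltnNge; apply: contraTN isT => /d0/eqP; rewrite mxE !eqxx oner_eq0.
rewrite mxE; have [eji|] := eqVneq j i; last by rewrite andbF.
by move: im; rewrite -eji ltnNge mj.
Qed.

(* The additive polynomial whose roots are the linear forms in x_0, ..., x_(m-1). *)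
Definition FM m (X : P) : P := \prod_(c | low m c) (X + lin c).

Lemma FM0 X : FM 0 X = X.
Proof.
rewrite /FM (bigD1 0) ?low0 //= linear0 addr0 big1 ?mulr1 // => c /andP[/lowP c0 /eqP[]].
by apply/rowP=> i; rewrite c0 // mxE.
Qed.

Lemma FM_low m c : low m c -> FM m (lin c) = 0.
Proof.
by move=> lc; rewrite /FM (bigD1 (- c)) ?lowN //= linearN subrr mul0r.
Qed.

Lemma FM_rec (j : 'I_n) X : FM j.+1 X = \prod_(a : F) FM j (X + a *: 'X_j).
Proof.
rewrite pair_big_dep /= /FM.
pose f (ac : F * 'rV[F]_n) := ac.1 *: delta_mx 0 j + ac.2 : 'rV[F]_n.
pose f' (c : 'rV[F]_n) : F * 'rV[F]_n := (c 0 j, c - c 0 j *: delta_mx 0 j).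
have f'K : cancel f' f by move=> c; rewrite /f addrC subrK.
rewrite (reindex_onto f f') /= => [|c _]; last exact: f'K.
apply: eq_big => [[a c]|[a c] _] /=; last first.
  by rewrite linearD linearZ /= lin_delta addrA.
apply/andP/idP => [[/lowP lc /eqP[e1 e2]]|lc].
  move: (f _) lc e1 e2 => d lc _ <-; apply/lowP=> i ji.
  rewrite !mxE; have [->|ne] := eqVneq i j; first by rewrite mulr1 subrr.
  by rewrite mulr0 subr0 lc // ltn_neqAle ji andbT eq_sym.
have cj : c 0 j = 0 by have /lowP := lc; apply.
split; first by rewrite lowD ?lowZ ?low_delta // (lowW _ lc).
apply/eqP; rewrite /f' /f /= !mxE !eqxx mulr1 cj addr0; congr (_, _).
by rewrite addrC addKr.
Qed.

(** By induction: linearity of [FM m] turns [FM_rec] into the homogenized X^q - X evaluated at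
    [FM m X] and [FM m x_m], and that expression is again additive and F-linear by Frobenius. *)
Lemma FM_linear m : (m <= n)%N ->
  (forall X Y, FM m (X + Y) = FM m X + FM m Y) /\ (forall a X, FM m (a *: X) = a *: FM m X).
Proof.
elim: m => [|m IH] mn; first by split=> *; rewrite !FM0.
have [FD FZ] := IH (ltnW mn); pose j := Ordinal mn.
have E X : FM m.+1 X = FM m X ^+ q - FM m 'X_j ^+ q.-1 * FM m X.
  rewrite (FM_rec j) -prod_field_lin; apply: eq_bigr => a _.
  by rewrite FD FZ.
split=> [X Y|a X]; rewrite !E ?FD ?FZ.
  by have := frobD (FM m X) (FM m Y) 1; rewrite expn1 => ->; ring.
have := frobZ a (FM m X) 1; rewrite expn1 => ->.
by rewrite scalerBr scalerAr.
Qed.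

End Moore.

(** * Equivariant contractions by Frobenius powers, and the Moore determinant *)

Section MooreContraction.
Section ContractionChains.
Variables (n : nat) (R : comNzRingType).
Local Notation E := (extalg n R).
Implicit Types (u v w : E) (X : 'I_n -> R).
Variables (I : eqType) (Z : I -> 'I_n -> R).
Local Notation qo := (qout (fun j => ctr (Z j))).
Local Notation qi := (qin (fun j => ctr (Z j))).

Lemma qout_ctrZ js a u : qo js (a *: u) = a *: qo js u.
Proof. exact: (@qoutZ _ _ _ (fun j => ctr (Z j) : {linear E -> E})). Qed.

Lemma qout_ctrD js u v : qo js (u + v) = qo js u + qo js v.
Proof. exact: (@qoutD _ _ _ (fun j => ctr (Z j) : {linear E -> E})). Qed.

Lemma qin_ctrZ js a u : qi js (a *: u) = a *: qi js u.
Proof. exact: (@qinZ _ _ _ (fun j => ctr (Z j) : {linear E -> E})). Qed.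

Lemma gcomm_ctrP (W : E -> Prop) a js u : uniq js ->
  (forall u v, W u -> W v -> W (u + v)) -> (forall u, W u -> W (- u)) ->
  einv a = (-1) ^+ size js *: a ->
  (forall K : pred I, W (qo (filter K js) (a * qi (filter (predC K) js) u))) ->
  W (qo js a * u).
Proof.
move=> Ujs WD WN ea WK.
rewrite -(@gcomm_lmul _ _ _ Z (size js) js a (lmul a) u) //.
exact: (@gcommP _ _ _ (fun j => ctr (Z j) : {linear E -> E})).
Qed.

Lemma ctr_qout X js w : ctr X (qo js w) = (-1) ^+ size js *: qo js (ctr X w).
Proof.
elim: js w => [|j js IH] w /=; first by rewrite scale1r.
rewrite IH ctr_anti exprS mulN1r scaleNr -scalerN; congr (_ *: _).
by have := qout_ctrZ js (-1) (ctr (Z j) (ctr X w)); rewrite !scaleN1r.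
Qed.

Lemma ctr_qin X js w : ctr X (qi js w) = (-1) ^+ size js *: qi js (ctr X w).
Proof.
elim: js => [|j js IH] /=; first by rewrite scale1r.
by rewrite ctr_anti IH linearZ /= exprS mulN1r scaleNr.
Qed.

Lemma qout_ctr0 js j w : j \in js -> qo js (ctr (Z j) w) = 0.
Proof.
have q0 js' : qo js' 0 = 0 by elim: js' => //= i js' IH; rewrite linear0 IH.
elim: js w => //= i js IH w; rewrite inE => /orP[/eqP->|/IH js0]; first by rewrite ctr_sqr q0.
by rewrite ctr_anti -scaleN1r qout_ctrZ js0 scaler0.
Qed.

Lemma ctr_qout0 js j w : j \in js -> ctr (Z j) (qo js w) = 0.
Proof. by move=> js0; rewrite ctr_qout qout_ctr0 ?scaler0. Qed.

Lemma ctr_mon0 X (S : {set 'I_n}) : (forall i, i \in S -> X i = 0) -> ctr X (ext_mon R S) = 0.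
Proof.
move=> X0; apply/ffunP=> T; rewrite ctrE [RHS]ffunE; apply: big1 => i niT.
rewrite ffunE; case: (S =P i |: T) => [eS|]; last by rewrite mulr0.
by rewrite X0 ?mulr0 ?mul0r // eS setU11.
Qed.
Lemma sign_closed (W : E -> Prop) (b : bool) (a : R) u : (forall v, W v -> W (- v)) ->
  W (((-1) ^+ b * a) *: u) -> W (a *: u).
Proof.
move=> WN; case: b; rewrite ?mul1r // mulN1r scaleNr => /WN.
by rewrite opprK.
Qed.

Lemma ctr_monic_comb (d : nat) (a : nat -> R) (Y : nat -> 'I_n -> R) X v :
  (forall i, X i = \sum_(e < d.+1) a e * Y e i) -> a d = 1 ->
  (forall e, (e < d)%N -> ctr (Y e) v = 0) -> ctr X v = ctr (Y d) v.
Proof.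
move=> eX ad v0; rewrite (@ctr_comb n R _ _ predT (fun e : 'I_d.+1 => a e) (fun e : 'I_d.+1 => Y e) X v eX).
rewrite big_ord_recr /= big1 ?add0r ?ad ?scale1r // => e _.
by rewrite v0 // scaler0.
Qed.

Lemma ctr_monU1 X (j : 'I_n) (S : {set 'I_n}) : j \notin S -> (forall i, i \in S -> X i = 0) ->
  ctr X (ext_mon R (j |: S)) = ((-1) ^+ nbelow j S * X j) *: ext_mon R S.
Proof.
by move=> nj X0; rewrite ext_monU1 // linearZ /= ctr_gen ctr_mon0 // mulr0 subr0 scalerA.
Qed.
End ContractionChains.

Variables (n : nat) (F : finFieldType).
Local Notation P := {mpoly F[n]}.
Local Notation A := (extalg n P).
Local Notation q := #|F|.
Implicit Types (g h : 'M[F]_n) (p : P) (u v : A) (c d : 'rV[F]_n) (X Y : P).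

(** Such a g permutes the linear forms in the first m variables, which index the factors of
    [FM m]. *)
Lemma FM_act g m X : g \in unitmx -> (forall c, low m c -> low m (c *m g^T)) ->
  poly_act g (FM m X) = FM m (poly_act g X).
Proof.
move=> gU lg; rewrite /FM rmorph_prod /=.
have gI : injective (fun c : 'rV[F]_n => c *m g^T).
  by apply: (can_inj (g := fun c => c *m invmx g^T)) => c; rewrite mulmxK // unitmx_tr.
rewrite [RHS](reindex_inj gI) /=; apply: eq_big => [c|c _]; last first.
  by rewrite rmorphD /= poly_act_lin.
have /setP/(_ c) : [set c | low m c] = (fun c : 'rV[F]_n => c *m g^T) @^-1: [set c | low m c].
  apply/eqP; rewrite eqEcard; apply/andP; split.
    by apply/subsetP=> d; rewrite !inE; apply: lg.
  by rewrite on_card_preimset //; apply/onW_bij/injF_bij.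
by rewrite !inE.
Qed.

Variables (ch k : nat).
Hypotheses (ch_prime : prime ch) (cardF : q = (ch ^ k)%N).

Lemma FMS (j : 'I_n) X : FM j.+1 X = FM j X ^+ q - FM j 'X_j ^+ q.-1 * FM j X.
Proof.
have [FD FZ] := FM_linear ch_prime cardF (ltnW (ltn_ord j)).
by rewrite FM_rec -prod_field_lin; apply: eq_bigr => a _; rewrite FD FZ.
Qed.

Lemma FMD m X Y : (m <= n)%N -> FM m (X + Y) = FM m X + FM m Y.
Proof. by case/(FM_linear ch_prime cardF). Qed.

Lemma FMZ m (a : F) X : (m <= n)%N -> FM m (a *: X) = a *: FM m X.
Proof. by case/(FM_linear ch_prime cardF). Qed.

Lemma FM_sum m (I : Type) (r : seq I) (f : I -> P) : (m <= n)%N ->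
  FM m (\sum_(i <- r) f i) = \sum_(i <- r) FM m (f i).
Proof.
move=> mn; apply: (big_morph (FM m)) => [X Y|]; first exact: FMD.
by rewrite -(scale0r 0) FMZ // !scale0r.
Qed.

Definition Lam (j : 'I_n) : P := FM j 'X_j.

Lemma Lam_neq0 j : Lam j != 0.
Proof.
apply/prodf_neq0 => c /lowP lc; rewrite -lin_delta -linearD lin_eq0.
apply/eqP=> /rowP/(_ j)/eqP; rewrite !mxE !eqxx lc // addr0.
by rewrite (oner_eq0 F).
Qed.

(* Contraction by this vector commutes with every g preserving the first m      *)
(* coordinates: it replaces y_j by FM m x_j ^ (q ^ e).                          *)
Definition Zvec (m e : nat) (i : 'I_n) : P := FM m 'X_i ^+ (q ^ e).

Lemma Zvec_lin m e c : (m <= n)%N ->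
  \sum_i c 0 i *: Zvec m e i = FM m (lin c) ^+ (q ^ e).
Proof.
move=> mn; rewrite /lin FM_sum //.
rewrite (big_morph (fun x : P => x ^+ (q ^ e)) (fun a b => frobD ch_prime cardF a b e) (id1 := 0)).
  by apply: eq_bigr => i _; rewrite FMZ // frobZ.
by rewrite expr0n expn_eq0 -leqn0 leqNgt (ltnW (finRing_gt1 _)).
Qed.

Lemma Zvec_low m e (i : 'I_n) : (i < m)%N -> Zvec m e i = 0.
Proof.
move=> im; rewrite /Zvec -lin_delta FM_low ?low_delta //.
by rewrite expr0n expn_eq0 -leqn0 leqNgt (ltnW (finRing_gt1 _)).
Qed.

Lemma Zvec_act g m e j : (m <= n)%N -> g \in unitmx ->
  (forall c, low m c -> low m (c *m g^T)) ->
  poly_act g (Zvec m e j) = \sum_i (g i j)%:MP * Zvec m e i.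
Proof.
move=> mn gU lg; rewrite /Zvec rmorphXn /= FM_act // poly_actX_lin -Zvec_lin //.
by apply: eq_bigr => i _; rewrite mxE mul_mpolyC.
Qed.

(** [FM (m + d)] is a monic q-polynomial of degree q^d in [FM m]; monicity is what makes the
    triangulation in [moore_top] work. *)
Lemma FM_expand m (d : nat) : (m + d <= n)%N -> exists a : nat -> P, a d = 1 /\
  forall X, FM (m + d) X = \sum_(e < d.+1) a e * FM m X ^+ (q ^ e).
Proof.
elim: d => [|d IH] mn.
  exists (fun _ => 1); split=> // X.
  by rewrite addn0 big_ord_recl big_ord0 addr0 mul1r expr1.
have [|a [ad aE]] := IH; first by apply: leq_trans mn; rewrite addnS.
rewrite addnS in mn; pose j := Ordinal mn.
(* Coefficients of the recursion [FMS]: the q-th power shifts the exponent by one, and the second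
   term stops at exponent d, so the new leading coefficient is again 1. *)
pose b e := (if e is e'.+1 then a e' ^+ q else 0) -
            FM j 'X_j ^+ q.-1 * (if (e <= d)%N then a e else 0).
exists b; split=> [|X]; first by rewrite /b ltnn mulr0 subr0 ad expr1n.
rewrite addnS (FMS j) [FM j X]aE.
have sumq (f : 'I_d.+1 -> P) : (\sum_e f e) ^+ q = \sum_e f e ^+ q.
  apply: (big_morph (fun x : P => x ^+ q)) => [x y|].
    by have := frobD ch_prime cardF x y 1; rewrite expn1.
  by rewrite expr0n -leqn0 leqNgt (ltnW (finRing_gt1 _)).
rewrite sumq; rewrite /b; under [RHS]eq_bigr do rewrite mulrBl.
rewrite sumrB; congr (_ - _).
  rewrite [RHS]big_ord_recl /= mul0r add0r; apply: eq_bigr => e _.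
  by rewrite /bump /= exprMn -exprM -expnSr.
rewrite [RHS]big_ord_recr /= ltnn mulr0 mul0r addr0 mulr_sumr; apply: eq_bigr => e _.
by rewrite -ltnS ltn_ord mulrA.
Qed.

(** The position of j in the slice starting at m serves as Frobenius exponent, so the slice indexes
    the rows of a Moore matrix. *)
Definition Zv m (j : 'I_n) : 'I_n -> P := Zvec m (j - m).
Definition slice m m' : {set 'I_n} := [set j : 'I_n | (m <= j < m')%N].
Definition sliceq m m' : seq 'I_n := [seq j : 'I_n <- enum 'I_n | (m <= j < m')%N].

Lemma mem_sliceq m m' j : (j \in sliceq m m') = (m <= j < m')%N.
Proof. by rewrite mem_filter mem_enum andbT. Qed.

Lemma sliceq_uniq m m' : uniq (sliceq m m').
Proof. exact/filter_uniq/enum_uniq. Qed.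

Lemma slicenn m : slice m m = set0.
Proof. by apply/setP=> j; rewrite !inE ltnNge andbN. Qed.

Lemma sliceqnn m : sliceq m m = [::].
Proof.
by rewrite /sliceq (eq_filter (a2 := pred0)) ?filter_pred0 // => j /=; rewrite ltnNge andbN.
Qed.

Lemma sliceS m (j : 'I_n) : (m <= j)%N -> slice m j.+1 = j |: slice m j.
Proof.
move=> mj; apply/setP=> i; rewrite !inE ltnS -val_eqE /=; lia.
Qed.

Lemma val_sliceq m m' : (m' <= n)%N -> (m <= m')%N -> map val (sliceq m m') = iota m (m' - m).
Proof.
move=> m'n mm'; clear F ch k ch_prime cardF; rewrite /sliceq -(filter_map val (fun i => m <= i < m')%N) val_enum_ord.
rewrite (_ : iota 0 n = iota 0 (m + ((m' - m) + (n - m')))); last by congr iota; lia.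
rewrite !iotaD !filter_cat add0n.
rewrite (eq_in_filter (a2 := pred0)) ?filter_pred0 => [|i]; last by rewrite mem_iota /=; lia.
rewrite (eq_in_filter (a2 := predT)) ?filter_predT => [|i]; last by rewrite mem_iota /=; lia.
rewrite (eq_in_filter (a2 := pred0)) ?filter_pred0 => [|i]; last by rewrite mem_iota /=; lia.
by rewrite cats0.
Qed.

Lemma sliceqS m (j : 'I_n) : (m <= j)%N -> sliceq m j.+1 = rcons (sliceq m j) j.
Proof.
move=> mj; apply: (inj_map val_inj); rewrite map_rcons.
have [jn mj1] := (ltnW (ltn_ord j), leqW mj); rewrite !val_sliceq //.
by rewrite subSn // -addn1 iotaD /= subnKC // cats1.
Qed.

(** The left side is the Moore determinant of the [FM m x_i] for i in the slice. Row operations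
    replace the row of j by [FM j x_i], which vanishes for i < j; the diagonal entries are the
    [Lam j]. *)
Lemma moore_top m m' : (m <= m')%N -> (m' <= n)%N -> exists b : bool,
  qout (fun j => ctr (Zv m j)) (sliceq m m') (ext_mon P (slice m m')) =
  ((-1) ^+ b * \prod_(j in slice m m') Lam j)%:A.
Proof.
move/subnKC=> <-; elim: (m' - m)%N => [|d IH] mn.
  by exists false; rewrite addn0 sliceqnn slicenn big_set0 mul1r scale1r.
rewrite addnS in mn *; have [b eb] := IH (ltnW mn); pose j := Ordinal mn.
have mj : (m <= j)%N by rewrite leq_addr.
have nj : j \notin slice m j by rewrite inE ltnn andbF.
have [a [ad aE]] := FM_expand (ltnW mn).
pose X i : P := FM j 'X_i.
set js := sliceq m j; set S := slice m j.
have eZ e (lt_e : (m + e < n)%N) : Zv m (Ordinal lt_e) = Zvec m e by rewrite /Zv /= addKn.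
(* Once the contractions of smaller index annihilate v, [Zv m j] can be replaced by the whole
   q-polynomial [FM j], of which it is the leading term. *)
have eX v : (forall i, i \in js -> ctr (Zv m i) v = 0) -> ctr (Zv m j) v = ctr X v.
  move=> v0; rewrite [RHS](ctr_monic_comb (a := a) (Y := Zvec m) _ ad) => [|i|e lt_ed].
  - by rewrite -(eZ _ mn).
  - exact: aE.
  have lt_e : (m + e < n)%N by apply: leq_trans (ltnW mn); rewrite ltn_add2l.
  by rewrite -(eZ _ lt_e) v0 // mem_sliceq /= leq_addr ltn_add2l.
have ctrS : ctr X (ext_mon P (j |: S)) = ((-1) ^+ nbelow j S * Lam j) *: ext_mon P S.
  apply: (ctr_monU1 nj) => i; rewrite inE => /andP[_ ij].
  by rewrite /X -lin_delta FM_low ?low_delta.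
exists (odd (size js + nbelow j S) (+) b).
rewrite (sliceqS mj) (sliceS mj) (big_setU1 _ nj) /= /qout foldl_rcons -/(qout _ _ _) -/js -/S.
rewrite eX => [|i ijs]; last exact: (ctr_qout0 _ _ ijs).
rewrite ctr_qout ctrS qout_ctrZ [qout _ _ _]eb !scalerA; congr (_ *: _).
rewrite signr_addb signr_odd exprD; ring.
Qed.

Lemma moore_engine m m' (W : A -> Prop) u : (m <= m')%N -> (m' <= n)%N ->
  (forall u v, W u -> W v -> W (u + v)) -> (forall u, W u -> W (- u)) ->
  (forall K : pred 'I_n, W (qout (fun j => ctr (Zv m j)) (filter K (sliceq m m'))
     (ext_mon P (slice m m') * qin (fun j => ctr (Zv m j)) (filter (predC K) (sliceq m m')) u))) ->
  W ((\prod_(j in slice m m') Lam j) *: u).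
Proof.
move=> mm' m'n WD WN WK; have [b eb] := moore_top mm' m'n.
have size_js : size (sliceq m m') = #|slice m m'|.
  rewrite -(card_uniqP (sliceq_uniq m m')); apply: eq_card => i.
  by rewrite mem_sliceq inE.
have := @gcomm_ctrP _ _ _ (Zv m) W _ _ u (sliceq_uniq m m') WD WN _ WK.
rewrite size_js [qout _ _ _]eb -scalerAl mul1r => /(_ (einv_mon _ _)).
exact: sign_closed.
Qed.

End MooreContraction.

(** * Transvections and divisibility *)

Section ExteriorDivides.
Variables (n : nat) (R : idomainType).
Local Notation E := (extalg n R).
Local Notation y := (ext_gen R).
Implicit Types (a b : R) (S T U J : {set 'I_n}) (u v w : E) (X Y al : 'I_n -> R).

Definition edvd a u := exists w, u = a *: w.

Lemma edvd0 a : edvd a 0. Proof. by exists 0; rewrite scaler0. Qed.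
Lemma edvdD a u v : edvd a u -> edvd a v -> edvd a (u + v).
Proof. by move=> [u' ->] [v' ->]; exists (u' + v'); rewrite scalerDr. Qed.
Lemma edvdZ a b u : edvd a u -> edvd a (b *: u).
Proof. by move=> [u' ->]; exists (b *: u'); rewrite !scalerA mulrC. Qed.
Lemma edvdZl a b u : mdvd a b -> edvd a (b *: u).
Proof. by move=> [b' ->]; exists (b' *: u); rewrite scalerA mulrC. Qed.
Lemma edvdN a u : edvd a u -> edvd a (- u).
Proof. by rewrite -scaleN1r; apply: edvdZ. Qed.
Lemma edvdB a u v : edvd a u -> edvd a v -> edvd a (u - v).
Proof. by move=> au av; apply/edvdD/edvdN. Qed.
Lemma edvd_sum a (I : Type) (r : seq I) (Q : pred I) (f : I -> E) :
  (forall i, Q i -> edvd a (f i)) -> edvd a (\sum_(i <- r | Q i) f i).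
Proof. by move=> df; apply: big_ind => //; [apply: edvd0 | apply: edvdD]. Qed.
Lemma edvdMl a u v : edvd a u -> edvd a (v * u).
Proof. by move=> [u' ->]; exists (v * u'); rewrite scalerAr. Qed.
Lemma edvd_ctr a X u : edvd a u -> edvd a (ctr X u).
Proof. by move=> [u' ->]; exists (ctr X u'); rewrite linearZ. Qed.
Lemma edvd_coef a u T : edvd a u -> mdvd a (u T).
Proof. by move=> [u' ->]; exists (u' T); rewrite extZE mulrC. Qed.

Lemma coef_edvd a u : (forall T, mdvd a (u T)) -> edvd a u.
Proof.
by move=> du; rewrite [u]ext_sum_mon; apply: edvd_sum => T _; apply/edvdZl/du.
Qed.

Lemma scaler_injE a u v : a != 0 -> a *: u = a *: v -> u = v.
Proof.
move=> a0 e; apply/ffunP=> T; apply: (mulfI a0).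
by rewrite -!extZE e.
Qed.

(** Modulo a, phi is the algebra map sending y_j to y_j + X_j al. Since al squares to zero, its
    expansion stops after the linear term. *)
Lemma transvection_congr a al X (f : R -> R) (phi : E -> E) :
  (forall u v, phi (u + v) = phi u + phi v) ->
  (forall b u, phi (b *: u) = f b *: phi u) -> (forall b, mdvd a (f b - b)) ->
  (forall j u, phi (y j * u) = (y j + X j *: lform al) * phi u) -> phi 1 = 1 ->
  forall u, edvd a (phi u - (u + lform al * ctr X u)).
Proof.
move=> phiD phiZ fa phiM phi1; elim/ext_ind => [|u v Hu Hv|b u Hu|j u [w Hw]].
- by rewrite phi1 ctr1 mulr0 addr0 subrr; apply: edvd0.
- rewrite phiD (linearD (ctr X)) /= mulrDr [u + v + _]addrACA opprD addrACA; exact: edvdD.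
- rewrite phiZ linearZ /= -scalerAr -scalerDr.
  have -> : f b *: phi u - b *: (u + lform al * ctr X u) =
     (f b - b) *: phi u + b *: (phi u - (u + lform al * ctr X u)).
    by rewrite scalerBl scalerBr addrA subrK.
  by apply: edvdD; [apply: edvdZl | apply: edvdZ].
have {Hw} Hw : phi u = a *: w + (u + lform al * ctr X u) by rewrite -Hw subrK.
have aa : lform al * lform al = 0 by apply: ext_lin_sqr.
have ay : y j * lform al = - (lform al * y j).
  have := ext_lin_anti (fun i => (i == j)%:R) al; rewrite -/(lform al).
  suff -> : \sum_i (i == j)%:R *: y i = y j by [].
  by rewrite (bigD1 j) //= eqxx scale1r big1 ?addr0 // => i /negPf->; rewrite scale0r.
rewrite phiM {}Hw mulrDr -scalerAr -addrA; apply: edvdD; first by exists ((y j + X j *: lform al) * w).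
rewrite ctr_gen.
have -> : (y j + X j *: lform al) * (u + lform al * ctr X u) =
    y j * u + lform al * (X j *: u - y j * ctr X u).
  rewrite mulrDl mulrDr -[(X j *: lform al) * _]scalerAl mulrDr.
  rewrite [lform al * (lform al * _)]mulrA aa mul0r addr0 mulrBr -scalerAr.
  by rewrite [y j * (lform al * _)]mulrA ay mulNr -mulrA -addrA [- _ + _]addrC.
rewrite subrr; exact: edvd0.
Qed.

Definition dot al X : R := \sum_i al i * X i.

(** Contracting [lform al * w] by Y gives the pairing of al and Y times w, minus the element in
    question. *)
Lemma edvd_lform_ctr a al Y w : mdvd a (dot al Y) ->
  edvd a (lform al * w) -> edvd a (lform al * ctr Y w).
Proof.
move=> aY aw; have e : ctr Y (lform al * w) = dot al Y *: w - lform al * ctr Y w := ctr_lin Y al w.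
have -> : lform al * ctr Y w = dot al Y *: w - ctr Y (lform al * w).
  by rewrite e opprB addrC subrK.
by apply: edvdB; [apply: edvdZl | apply: edvd_ctr].
Qed.

Lemma edvd_lform_qin a al (I : eqType) (Z : I -> 'I_n -> R) js w :
  (forall j, j \in js -> mdvd a (dot al (Z j))) ->
  edvd a (lform al * w) -> edvd a (lform al * qin (fun j => ctr (Z j)) js w).
Proof.
elim: js => //= j js IH aZ aw; apply: edvd_lform_ctr; first by apply: aZ; rewrite mem_head.
by apply: IH => // i ijs; apply: aZ; rewrite inE ijs orbT.
Qed.

Definition evec (j : 'I_n) : 'I_n -> R := fun i => (i == j)%:R.

Lemma dot_evec al j : dot al (evec j) = al j.
Proof.
rewrite /dot (bigD1 j) //= /evec eqxx mulr1 big1 ?addr0 // => i /negPf->.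
by rewrite mulr0.
Qed.

(** Expansion of Z in the basis made of e_i and the vectors e_j - a_j e_i for j other than i. The
    latter pair to zero with a, so the coefficient of e_i is the pairing of a and Z. *)
Lemma pivot_comb (a Z : 'I_n -> R) (i m : 'I_n) : a i = 1 ->
  Z m = \sum_j (if j == i then dot a Z else Z j) *
    (if j == i then evec i m else evec j m - a j * evec i m).
Proof.
move=> ai; have evC c d : evec c d = evec d c by rewrite /evec eq_sym.
rewrite (bigD1 i) //= eqxx (eq_bigr (fun j => Z j * evec j m - a j * Z j * evec i m)) => [|j /negPf->]; last by ring.
rewrite sumrB -mulr_suml -{1}(dot_evec Z m) /dot (bigD1 i) //= [X in _ = X * _ + _](bigD1 i) //=.
rewrite ai mul1r evC; under eq_bigr do rewrite evC.
ring.
Qed.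

Lemma ctr_evecE j u T : ctr (evec j) u T =
  if j \in T then 0 else (-1) ^+ nbelow j T * u (j |: T).
Proof.
rewrite ctrE; case: ifP => jT.
  apply: big1 => i niT; rewrite /evec; case: eqP => [eij|]; last by rewrite mulr0 mul0r.
  by rewrite eij jT in niT.
rewrite (bigD1 j) ?jT //= /evec eqxx mulr1 big1 ?addr0 // => i /andP[_ /negPf->].
by rewrite mulr0 mul0r.
Qed.

(** As y_J kills al and al_i = 1, contracting by e_i removes the factor al after multiplication by
    y_J. Contraction by e_j then passes y_J, since j is not in J, and reads off the coefficient at
    T. *)
Lemma edvd_mon_coef a al i j J v T :
  al i = 1 -> ext_mon R J * lform al = 0 -> j \notin J -> j \in T ->
  edvd a (lform al * ctr (evec j) v) -> mdvd a ((ext_mon R J * v) T).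
Proof.
move=> ali Jal njJ jT; set w := ctr _ v => aw.
have ew : w = ctr (evec i) (lform al * w) + lform al * ctr (evec i) w.
  have := ctr_lin (evec i) al w; rewrite -/(lform al) -/(dot al _) dot_evec ali scale1r.
  by move=> ->; rewrite subrK.
have Jw : edvd a (ext_mon R J * w).
  by rewrite ew mulrDr [_ * (lform al * _)]mulrA Jal mul0r addr0; apply/edvdMl/edvd_ctr.
have cJ : ctr (evec j) (ext_mon R J) = 0.
  by apply: ctr_mon0 => k kJ; rewrite /evec; case: eqP => // ekj; rewrite -ekj kJ in njJ.
have : edvd a (ctr (evec j) (ext_mon R J * v)).
  rewrite ctrM cJ mul0r add0r einv_mon -scalerAl; exact: edvdZ.
move/(edvd_coef (T :\ j)); rewrite ctr_evecE setD11 setD1K // => /(mdvd_mull ((-1) ^+ nbelow j (T :\ j))).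
by rewrite mulrA signr_sqr mul1r.
Qed.

Lemma lformME al u T : (lform al * u) T =
  \sum_i al i * (if i \in T then (-1) ^+ nbelow i T * u (T :\ i) else 0).
Proof.
by rewrite mulr_suml ext_sumE; apply: eq_bigr => i _; rewrite -scalerAl extZE ext_genM.
Qed.

(** Contraction by e_j turns al v into v minus a multiple of al. The correction has no coefficient
    at J, because it would come from a set in the support of v that misses an element of J. *)
Lemma edvd_super_coef a al j J v :
  al j = 1 -> j \notin J -> supp (fun T => J \subset T) v ->
  edvd a (lform al * v) -> mdvd a (v J).
Proof.
move=> alj njJ Jv /(edvd_ctr (evec j))/(edvd_coef J).
rewrite ctr_lin -/(lform al) -/(dot al _) dot_evec alj scale1r extDE extNE lformME.
rewrite big1 ?subr0 // => i _; case: ifP => iJ; last by rewrite mulr0.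
rewrite ctr_evecE; case: ifP => jJi; first by rewrite !mulr0.
suff -> : v (j |: J :\ i) = 0 by rewrite !mulr0.
apply/eqP; apply: contraNT njJ => /Jv /subsetP/(_ i iJ).
by rewrite !inE eqxx orbF => /eqP <-.
Qed.

Lemma lform_evec j : lform (evec j) = y j.
Proof.
rewrite /lform (bigD1 j) //= /evec eqxx scale1r big1 ?addr0 // => i /negPf->.
by rewrite scale0r.
Qed.

Lemma lformDZ al be b : lform (fun i => be i + al i * b) = lform be + b *: lform al.
Proof.
rewrite /lform scaler_sumr -big_split; apply: eq_bigr => i _ /=.
by rewrite scalerDl scalerA mulrC.
Qed.

Lemma eq_lform al be : al =1 be -> lform al = lform be.
Proof. by move=> e; apply: eq_bigr => i _; rewrite e. Qed.

Definition lspan (I : finType) (e : I -> E) (u : E) : Prop :=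
  exists c : I -> R, u = \sum_i c i *: e i.

Lemma lspanD (I : finType) (e : I -> E) u v : lspan e u -> lspan e v -> lspan e (u + v).
Proof.
move=> [c ->] [c' ->]; exists (fun i => c i + c' i); rewrite -big_split.
by apply: eq_bigr => i _; rewrite scalerDl.
Qed.

Lemma lspanZ (I : finType) (e : I -> E) a u : lspan e u -> lspan e (a *: u).
Proof.
move=> [c ->]; exists (fun i => a * c i); rewrite scaler_sumr.
by apply: eq_bigr => i _; rewrite scalerA.
Qed.

Lemma lspan0 (I : finType) (e : I -> E) : lspan e 0.
Proof. by exists (fun=> 0); rewrite big1 // => i _; rewrite scale0r. Qed.

Lemma lspan_mem (I : finType) (e : I -> E) i : lspan e (e i).
Proof.
exists (fun j => (j == i)%:R); rewrite (bigD1 i) //= eqxx scale1r big1 ?addr0 // => j /negPf->.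
by rewrite scale0r.
Qed.

Lemma lspanN (I : finType) (e : I -> E) u : lspan e u -> lspan e (- u).
Proof. by rewrite -scaleN1r; apply: lspanZ. Qed.

(** Membership in the span over the fraction field, with denominators cleared. *)
Definition rlspan (I : finType) (e : I -> E) (u : E) : Prop :=
  exists2 H : R, H != 0 & lspan e (H *: u).

Lemma rlspanD (I : finType) (e : I -> E) u v : rlspan e u -> rlspan e v -> rlspan e (u + v).
Proof.
move=> [H H0 Hu] [H' H0' Hv]; exists (H * H'); first by rewrite mulf_neq0.
rewrite scalerDr; apply: lspanD; last by rewrite -scalerA; apply: lspanZ.
by rewrite mulrC -scalerA; apply: lspanZ.
Qed.

Lemma rlspanZ (I : finType) (e : I -> E) a u : rlspan e u -> rlspan e (a *: u).
Proof. by move=> [H H0 Hu]; exists H => //; rewrite scalerA mulrC -scalerA; apply: lspanZ. Qed.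

Lemma rlspanN (I : finType) (e : I -> E) u : rlspan e u -> rlspan e (- u).
Proof. by rewrite -scaleN1r; apply: rlspanZ. Qed.

Lemma rlspan_scale (I : finType) (e : I -> E) a u : a != 0 -> rlspan e (a *: u) -> rlspan e u.
Proof.
move=> a0 [H H0 Hu]; exists (H * a); first by rewrite mulf_neq0.
by rewrite -scalerA.
Qed.

Lemma lspan_rlspan (I : finType) (e : I -> E) u : lspan e u -> rlspan e u.
Proof. by move=> eu; exists 1; rewrite ?oner_neq0 ?scale1r. Qed.

(* The matrix of [e] in the monomial basis has a nonzero determinant. *)
Lemma rlspan_free (e : {set 'I_n} -> E) (c : {set 'I_n} -> R) :
  (forall u, rlspan e u) -> \sum_T c T *: e T = 0 -> forall T, c T = 0.
Proof.
move=> espan ce0.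
have [H H0 Hspan] := fin_all_exists2 (fun S => espan (ext_mon R S)).
have [a aE] := fin_all_exists Hspan.
pose N := #|{set 'I_n}|; pose v (i : 'I_N) : {set 'I_n} := enum_val i.
have sumv (V : zmodType) (f : {set 'I_n} -> V) : \sum_T f T = \sum_i f (v i).
  by rewrite (reindex _ (onW_bij _ (@enum_val_bij {set 'I_n}))).
pose M : 'M[R]_N := \matrix_(i, j) e (v i) (v j).
pose D : 'rV[R]_N := \row_i H (v i).
have AM : (\matrix_(i, j) a (v i) (v j)) *m M = diag_mx D.
  apply/matrixP=> i j; rewrite !mxE; have /ffunP/(_ (v j)) := aE (v i).
  rewrite ext_sumE sumv extZE ffunE => e1.
  rewrite (eq_bigr (fun k => (a (v i) (v k) *: e (v k)) (v j))) => [|k _]; last by rewrite !mxE extZE.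
  rewrite -e1 (inj_eq enum_val_inj); case: (i == j); rewrite ?mulr1n ?mulr0n ?mulr1 ?mulr0 //.
have M0 : \det M != 0.
  apply: contraTneq (isT : true) => M0; have := congr1 determinant AM.
  rewrite det_mulmx M0 mulr0 det_diag => /esym/eqP; rewrite prodf_seq_eq0 => /hasP[i _].
  by rewrite mxE /= (negPf (H0 _)).
have cM : (\row_i c (v i)) *m M = 0.
  apply/rowP=> j; rewrite !mxE; have /ffunP/(_ (v j)) := ce0.
  rewrite ext_sumE sumv [RHS]ffunE => e1; rewrite -[RHS]e1; apply: eq_bigr => k _.
  by rewrite !mxE extZE.
move=> T; have := congr1 (fun A => (A *m \adj M) 0 (enum_rank T)) cM.
rewrite -mulmxA mul_mx_adj mul_mx_scalar mul0mx !mxE /v enum_rankK => /eqP.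
by rewrite mulf_eq0 (negPf M0) => /eqP.
Qed.

(** Comparing coefficients at J shows that the y_J terms on both sides cancel; what remains can be
    divided by D, whose own character d disappears with it. *)
Lemma strip_scalar J (f : R -> R) (phi : E -> E) (D d x c0 : R) u w :
  (forall u v, phi (u + v) = phi u + phi v) -> (forall b u, phi (b *: u) = f b *: phi u) ->
  u = D *: w + c0 *: ext_mon R J -> phi u = d *: (x *: u) ->
  phi (ext_mon R J) = d *: ext_mon R J -> f D = d * D -> w J = 0 -> phi w J = 0 ->
  D != 0 -> d != 0 -> phi w = x *: w.
Proof.
move=> phiD phiZ uE pu pJ fD wJ pwJ D0 d0.
have pu2 : phi u = (d * D) *: phi w + (f c0 * d) *: ext_mon R J.
  by rewrite uE phiD !phiZ pJ fD scalerA.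
have e1 : f c0 * d = d * x * c0.
  have := congr1 (fun v : E => v J) pu2; rewrite pu uE !extZE !extDE !extZE wJ pwJ.
  by rewrite ffunE eqxx !mulr0 !add0r !mulr1 => <-; rewrite mulrA.
apply: (scaler_injE (mulf_neq0 d0 D0)); move: pu2; rewrite pu e1 {1}uE.
have -> : d *: (x *: (D *: w + c0 *: ext_mon R J)) =
    (d * D) *: (x *: w) + (d * x * c0) *: ext_mon R J.
  by rewrite !scalerDr !scalerA; congr (_ *: _ + _ *: _); ring.
by move/addIr.
Qed.

Lemma edvd_split J u (D : R) : D != 0 -> (forall T, T != J -> mdvd D (u T)) ->
  exists2 w, u = D *: w + u J *: ext_mon R J &
    forall T, w T != 0 -> T != J /\ u T != 0.
Proof.
move=> D0 du; have eJ T : (u - u J *: ext_mon R J) T = if T == J then 0 else u T.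
  rewrite extDE extNE extZE ffunE eq_sym; case: eqP => [->|_].
    by rewrite mulr1 subrr.
  by rewrite mulr0 subr0.
have [|w ew] := @coef_edvd D (u - u J *: ext_mon R J).
  by move=> T; rewrite eJ; case: eqP => [_|/eqP/du //]; apply: mdvd0.
exists w => [|T wT]; first by rewrite -ew subrK.
have := eJ T; rewrite ew extZE; case: eqP => [_ /eqP|_ <-].
  by rewrite mulf_eq0 (negPf D0) (negPf wT).
by rewrite mulf_neq0.
Qed.

End ExteriorDivides.

Section Transvections.
Variables (n : nat) (F : finFieldType).
Local Notation P := {mpoly F[n]}.
Local Notation A := (extalg n P).
Implicit Types (g h : 'M[F]_n) (p : P) (u v : A) (c d : 'rV[F]_n).

Definition tvmx c d : 'M[F]_n := 1%:M + c^T *m d.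
Lemma ext_act0 g : ext_act g (0 : A) = 0.
Proof. by rewrite -(scale0r 1) ext_actZ rmorph0 !scale0r. Qed.

Definition cvec c : 'I_n -> P := fun i => (c 0 i)%:MP.

Lemma tvmxE c d i j : tvmx c d i j = (i == j)%:R + c 0 i * d 0 j.
Proof. by rewrite !mxE big_ord1 !mxE. Qed.

Lemma tvmxX c d j : poly_act (tvmx c d) 'X_j = 'X_j + d 0 j *: lin c.
Proof.
rewrite poly_actX_lin -lin_delta -linearZ -linearD /=; congr lin.
by apply/rowP=> i; rewrite [LHS]mxE tvmxE !mxE eqxx mulrC.
Qed.

Lemma tvmx_gen c d j :
  ext_act_gen (tvmx c d) j = ext_gen P j + (d 0 j)%:MP *: lform (cvec c).
Proof.
rewrite -lform_evec -lformDZ; apply: eq_lform => i.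
by rewrite tvmxE mpolyCD mpolyCM; congr (_ + _); rewrite /evec; case: eqP; rewrite ?mpolyC1 ?mpolyC0.
Qed.

Lemma tvmx_inv c d u : ext_act (tvmx c d) u = u ->
  edvd (lin c) (lform (cvec c) * ctr (cvec d) u).
Proof.
move=> eu; have := @transvection_congr n P (lin c) (cvec c) (cvec d)
  (poly_act (tvmx c d)) (ext_act (tvmx c d)) (ext_actD _) (ext_actZ _) _ _ (ext_act1 _) u.
rewrite eu opprD addNKr => /(_ _ _)/edvdN; rewrite opprK; apply.
  move=> b; apply: poly_act_congr => j.
  by rewrite tvmxX addrC addKr -mul_mpolyC; apply/mdvd_mull/mdvdd.
by move=> j v; rewrite ext_actM ext_actX tvmx_gen.
Qed.

End Transvections.

(** * Vandermonde products of 1-forms *)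

Section Vandermonde.
Variables (n : nat) (R : comNzRingType).
Local Notation E := (extalg n R).
Local Notation y := (ext_gen R).
Implicit Types (c t : 'I_n -> R) (js : seq 'I_n) (S T : {set 'I_n}) (u v : E).

Definition psi c t js m : E := \sum_(j <- js) (c j * t j ^+ m) *: y j.
Definition ymon js : E := foldr (fun j u => y j * u) 1 js.
Fixpoint vdm t js : R :=
  if js is j :: js' then \prod_(i <- js') (t i - t j) * vdm t js' else 1.

Lemma vdm_sorted t js : sorted (fun i j : 'I_n => (i < j)%N) js ->
  vdm t js = \prod_(i <- js) \prod_(j <- js | (j < i)%N) (t i - t j).
Proof.
elim: js => [|j js IH] sjs /=; first by rewrite big_nil.
have jmin : all (fun i : 'I_n => (j < i)%N) js.
  by apply: order_path_min sjs => a b c; apply: ltn_trans.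
rewrite (IH (path_sorted sjs)) big_cons big_cons ltnn /= [X in _ = X * _]big1_seq => [|i /andP[ij ijs]]; last first.
  by have /ltnW := allP jmin i ijs; rewrite leqNgt ij.
rewrite mul1r -big_split /= big_seq [RHS]big_seq; apply: eq_bigr => i ijs.
by rewrite big_cons (allP jmin i ijs).
Qed.

Lemma psi_lform c t js m : uniq js ->
  psi c t js m = lform (fun j => if j \in js then c j * t j ^+ m else 0).
Proof.
move=> Ujs; rewrite /psi /lform big_uniq //= big_mkcond; apply: eq_bigr => j _.
by case: ifP => // _; rewrite scale0r.
Qed.

Lemma psi_lform_mem c t js m (Q : pred 'I_n) : uniq js -> (forall j, (j \in js) = Q j) ->
  psi c t js m = lform (fun j => if Q j then c j * t j ^+ m else 0).
Proof. by move=> Ujs eQ; rewrite psi_lform //; apply: eq_bigr => j _; rewrite eQ. Qed.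

Lemma psi_sqr c t js m : uniq js -> psi c t js m * psi c t js m = 0.
Proof. by move=> Ujs; rewrite psi_lform // ext_lin_sqr. Qed.

(** Vandermonde elimination: subtracting t_j times a form from the next one removes y_j and
    multiplies the other weights by t_i - t_j. *)
Lemma psi_step c t j js m : j \notin js ->
  psi c t (j :: js) m.+1 = psi (fun i => c i * (t i - t j)) t js m + t j *: psi c t (j :: js) m.
Proof.
move=> nj; rewrite /psi !big_cons scalerDr addrCA scalerA; congr (_ *: _ + _).
  by rewrite exprSr; ring.
rewrite scaler_sumr -big_split; apply: eq_bigr => i _ /=.
by rewrite scalerA -scalerDl exprSr; congr (_ *: _); ring.
Qed.

Lemma psi_prodS c t j js m : uniq (j :: js) ->
  \prod_(0 <= e < m.+1) psi c t (j :: js) e =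
  psi c t (j :: js) 0 * \prod_(0 <= e < m) psi (fun i => c i * (t i - t j)) t js e.
Proof.
move=> Ujs; have /andP[nj _] := Ujs; elim: m => [|m IH].
  by rewrite big_nat1 big_geq // mulr1.
rewrite big_nat_recr //= [in RHS]big_nat_recr //= mulrA -IH psi_step // mulrDr.
rewrite [X in _ + X](_ : _ = 0) ?addr0 // -scalerAr big_nat_recr //= -mulrA psi_sqr //.
by rewrite mulr0 scaler0.
Qed.

Lemma psi_mul_ymon c t js i js' : uniq js -> (forall k, k \in js -> k != i -> k \in js') ->
  i \in js -> uniq js' -> psi c t js 0 * ymon js' = c i *: (y i * ymon js').
Proof.
move=> Ujs sub ijs Ujs'.
have ym0 k js2 : k \in js2 -> y k * ymon js2 = 0.
  elim: js2 => //= a js2 IH; rewrite inE mulrA => /orP[/eqP->|kj].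
    by rewrite ext_gen_sqr mul0r.
  by rewrite ext_gen_anti mulNr -mulrA IH // mulr0 oppr0.
rewrite /psi mulr_suml (bigD1_seq i) //= expr0 mulr1 scalerAl.
rewrite big_seq_cond big1 ?addr0 // => k /andP[kj nki].
by rewrite -scalerAl ym0 ?scaler0 //; apply: sub.
Qed.

Lemma psi_prod c t js : uniq js ->
  \prod_(0 <= e < size js) psi c t js e = (\prod_(j <- js) c j * vdm t js) *: ymon js.
Proof.
elim: js c => [|j js IH] c Ujs; first by rewrite big_geq // big_nil mul1r scale1r.
have /andP[nj Ujs'] := Ujs; rewrite psi_prodS // IH // -scalerAr.
rewrite (@psi_mul_ymon c t (j :: js) j js) ?mem_head // => [|k]; last first.
  by rewrite inE => /orP[/eqP->|//]; rewrite eqxx.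
rewrite scalerA big_cons /=; congr (_ *: _).
by rewrite big_split /=; ring.
Qed.

Lemma ymon_sign js : uniq js ->
  exists b : bool, ymon js = (-1) ^+ b *: ext_mon R [set j in js].
Proof.
elim: js => [|j js IH] /= => [_|/andP[nj Ujs]].
  exists false; rewrite scale1r; congr ext_mon; apply/setP=> i; by rewrite !inE.
have [b ->] := IH Ujs; have njs : j \notin [set j in js] by rewrite inE.
exists (odd (nbelow j [set j in js]) (+) b).
rewrite -scalerAr ext_gen_mon // scalerA signr_addb signr_odd mulrC.
by congr (_ *: ext_mon R _); apply/setP=> i; rewrite !inE.
Qed.

Lemma supp_prod (r : seq 'I_n) (Q : pred 'I_n) (f : 'I_n -> E) (QQ : pred {set 'I_n}) :
  QQ set0 -> (forall S T, [disjoint S & T] -> QQ S -> QQ T -> QQ (S :|: T)) ->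
  (forall j, Q j -> supp QQ (f j)) -> supp QQ (\prod_(j <- r | Q j) f j).
Proof.
move=> Q0 QU Qf; apply: big_ind => [|u v Qu Qv|//]; first exact: supp_mon.
exact: suppM Qu Qv QU.
Qed.

Lemma supp_lform (Q : pred {set 'I_n}) (a : 'I_n -> R) :
  (forall j, a j != 0 -> Q [set j]) -> supp Q (lform a).
Proof.
move=> Qa; apply: supp_sum => j _; have [->|aj] := eqVneq (a j) 0.
  by rewrite scale0r; apply: supp0.
by apply/suppZ/supp_mon/Qa.
Qed.

Definition exhom d : pred {set 'I_n} := fun S => #|S| == d.

Lemma exhomM d e u v : supp (exhom d) u -> supp (exhom e) v -> supp (exhom (d + e)) (u * v).
Proof.
move=> du dv; apply: suppM du dv _ => S T dST /eqP dS /eqP dT.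
by rewrite /exhom cardsU disjoint_setI0 // cards0 subn0 dS dT.
Qed.

Lemma exhom_lform (a : 'I_n -> R) : supp (exhom 1) (lform a).
Proof. by apply: supp_lform => j _; rewrite /exhom cards1. Qed.

Lemma exhom_prod_lform (r : seq 'I_n) (Q : pred 'I_n) (a : 'I_n -> 'I_n -> R) :
  supp (exhom (count Q r)) (\prod_(j <- r | Q j) lform (a j)).
Proof.
elim: r => [|j r IH]; first by rewrite big_nil; apply: supp_mon; rewrite /exhom cards0.
rewrite big_cons /=; case: (Q j); last by rewrite add0n.
apply: (@exhomM 1 (count Q r)); [exact: exhom_lform | exact: IH].
Qed.

Lemma sub_qin S (I : Type) (Z : I -> 'I_n -> R) (js : seq I) u : supp (fun T => T \subset S) u ->
  supp (fun T => T \subset S) (qin (fun j => ctr (Z j)) js u).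
Proof.
move=> su; elim: js => //= j js IH; apply: supp_ctr IH _ => i T _ iTJ _.
exact: subset_trans (subsetUr _ _) iTJ.
Qed.

Lemma sub_qout S (I : Type) (Z : I -> 'I_n -> R) (js : seq I) u : supp (fun T => T \subset S) u ->
  supp (fun T => T \subset S) (qout (fun j => ctr (Z j)) js u).
Proof.
move=> su; elim: js u su => //= j js IH u su; apply: IH; apply: supp_ctr su _ => i T _ iTJ _.
exact: subset_trans (subsetUr _ _) iTJ.
Qed.

Lemma supp_sub_exhom S u : supp (fun T => T \subset S) u -> supp (exhom #|S|) u ->
  u = u S *: ext_mon R S.
Proof.
move=> su hu; rewrite {1}[u]ext_sum_mon (bigD1 S) //= big1 ?addr0 // => T neT.
have [->|uT] := eqVneq (u T) 0; first by rewrite scale0r.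
have /eqP cT := hu T uT; case/negP: neT.
by rewrite eqEcard su // cT leqnn.
Qed.

End Vandermonde.

Section ConstantCoefficients.
Variables (n : nat) (F : finFieldType).
Local Notation P := {mpoly F[n]}.
Local Notation A := (extalg n P).
Implicit Types (g h : 'M[F]_n) (p : P) (u v : A) (S : {set 'I_n}).

Definition const u := forall S, exists a : F, u S = a%:MP.

Lemma constD u v : const u -> const v -> const (u + v).
Proof. by move=> cu cv S; have [[a ea] [b eb]] := (cu S, cv S); exists (a + b); rewrite extDE ea eb rmorphD. Qed.

Lemma const0 : const 0.
Proof. by move=> S; exists 0; rewrite ffunE rmorph0. Qed.

Lemma constZ a u : const u -> const (a%:MP *: u).
Proof. by move=> cu S; have [b eb] := cu S; exists (a * b); rewrite extZE eb rmorphM. Qed.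

Lemma const_mon S : const (ext_mon P S).
Proof. by move=> T; exists (S == T)%:R; rewrite ffunE rmorph_nat. Qed.

(** Ensures that g acts on top monomials through scalars of F, as the definition of [dd]
    presupposes. *)
Lemma const_act_mon g S : const (ext_act g (ext_mon P S)).
Proof.
rewrite /ext_act ext_lift_mon /= .
elim: (index_enum _) => [|j r IH]; first by rewrite big_nil; apply: const_mon.
rewrite big_cons; case: ifP => // _; rewrite /ext_act_gen mulr_suml.
apply: (big_ind const) => [||i _]; [exact: const0 | exact: constD |].
rewrite -scalerAl; apply: constZ => T; rewrite ext_genM; case: ifP => _; last first.
  by exists 0; rewrite rmorph0.
have [a ->] := IH (T :\ i); exists ((-1) ^+ nbelow i T * a).
by rewrite rmorphM rmorphXn rmorphN rmorph1.
Qed.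

Lemma act_monE g S : ext_act g (ext_mon P S) = \prod_(j in S) lform (fun i => (g i j)%:MP).
Proof. exact: ext_lift_mon. Qed.

Lemma exhom_act_mon g S : supp (@exhom n #|S|) (ext_act g (ext_mon P S)).
Proof.
rewrite act_monE.
have -> : #|S| = count (mem S) (index_enum 'I_n) by rewrite -sum1_card -sum1_count.
exact: exhom_prod_lform.
Qed.

Lemma card_act g m u : supp (fun T => (m < #|T|)%N) u -> supp (fun T => (m < #|T|)%N) (ext_act g u).
Proof.
move=> du; rewrite [u]ext_sum_mon ext_act_sum; apply: supp_sum => S _.
rewrite ext_actZ; have [->|uS] := eqVneq (u S) 0.
  by rewrite rmorph0 scale0r; apply: supp0.
apply: suppZ; have lt := du S uS.
by apply: (suppW _ (@exhom_act_mon g S)) => T /eqP->.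
Qed.

Lemma sub_act_mon g (J S : {set 'I_n}) : S \subset J ->
  (forall i j, j \in J -> g i j != 0 -> i \in J) ->
  supp (fun T => T \subset J) (ext_act g (ext_mon P S)).
Proof.
move=> sSJ gJ; rewrite act_monE; apply: supp_prod => [|T U _ TJ UJ|j jS].
- exact: sub0set.
- by rewrite subUset TJ.
apply: supp_lform => i; rewrite sub1set mpolyC_eq0; apply: gJ.
exact: subsetP jS.
Qed.

End ConstantCoefficients.

(** * The dual commutator: 1-forms against a full contraction *)

Section ThetaEngine.
Variables (n : nat) (R : idomainType).
Local Notation E := (extalg n R).
Implicit Types (S T : {set 'I_n}) (u v w : E) (js : seq 'I_n).
Local Notation ev := (@evec n R).
Local Notation Oev := (qin (fun j => ctr (ev j))).

Lemma alg_inj (a b : R) : a%:A = b%:A :> E -> a = b.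
Proof.
have one0 : (1 : E) set0 = 1 by rewrite ffunE eqxx.
by move/ffunP/(_ set0); rewrite !extZE one0 !mulr1.
Qed.

Lemma qin_evE js : uniq js -> exists sg : {set 'I_n} -> nat, forall u T,
  Oev js u T = if [disjoint T & [set j in js]] then (-1) ^+ sg T * u (T :|: [set j in js]) else 0.
Proof.
elim: js => [_|j js IH /andP[nj /IH[sg {}IH]]].
  exists (fun=> 0%N) => u T /=.
  have -> : [set j : 'I_n in [::]] = set0 by apply/setP=> i; rewrite !inE.
  by rewrite -setI_eq0 setI0 eqxx setU0 mul1r.
exists (fun T => (nbelow j T + sg (j |: T))%N) => u T /=; rewrite ctr_evecE IH.
have ej : [set i in j :: js] = j |: [set i in js] by apply/setP=> i; rewrite !inE.
have -> : [disjoint j |: T & [set i in js]] = [disjoint T & [set i in js]].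
  rewrite -!setI_eq0 setIUl setU_eq0 (_ : [set j] :&: _ = set0) ?eqxx //.
  by apply/eqP; rewrite setI_eq0 disjoints1 inE.
have -> : [disjoint T & [set i in j :: js]] = (j \notin T) && [disjoint T & [set i in js]].
  by rewrite ej disjoint_sym -!setI_eq0 setIUl setU_eq0 setI_eq0 disjoints1 setIC.
case: ifP => //= jT; case: ifP => _; last by rewrite mulr0.
by rewrite mulrA exprD ej; congr (_ * u _); rewrite setUCA setUA.
Qed.

Lemma qin_ev_ymon js : uniq js -> exists s : bool, Oev js (ymon R js) = (-1) ^+ s *: 1.
Proof.
move=> Ujs; have [s es] := ymon_sign R Ujs; have [sg Osg] := qin_evE Ujs.
have oneE T : (1 : E) T = (set0 == T)%:R by rewrite ffunE.
exists (odd (sg set0) (+) s); apply/ffunP=> T; rewrite Osg es !extZE oneE ffunE.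
have [->|T0] := eqVneq T set0.
  rewrite disjoint_sym -setI_eq0 setI0 !eqxx set0U eqxx !mulr1.
  by rewrite signr_addb signr_odd.
rewrite !mulr0; case: ifP => // dT.
rewrite (_ : _ == _ = false) ?mulr0 //; apply/negP=> /eqP e.
case/negP: T0; move: dT; rewrite -setI_eq0 => /eqP <-.
by rewrite eq_sym; apply/eqP/setIidPl; rewrite e subsetUl.
Qed.

Lemma qin_ev_deg js d u : uniq js -> (d < size js)%N -> supp (@exhom n d) u -> Oev js u = 0.
Proof.
move=> Ujs dj du; have [sg Osg] := qin_evE Ujs; apply/ffunP=> T; rewrite Osg [RHS]ffunE.
case: ifP => // _; have [->|/du /eqP eT] := eqVneq (u (T :|: [set j in js])) 0.
  by rewrite mulr0.
move: dj; rewrite -eT ltnNge; have -> : size js = #|[set j in js]|.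
  by rewrite cardsE; apply/esym/card_uniqP.
by rewrite subset_leq_card // subsetUr.
Qed.

Variable th : 'I_n -> 'I_n -> R.
Local Notation qT := (fun j => lmul (lform (th j))).

Lemma qin_lmul_deg js d u : supp (@exhom n d) u -> supp (@exhom n (size js + d)%N) (qin qT js u).
Proof. by move=> du; elim: js => //= j js IH; exact: exhomM (@exhom_lform n R (th j)) IH. Qed.

Lemma ctrop_ev js : ctrop (size js) (Oev js).
Proof.
elim: js => [|j js IH]; first by apply: (Ctrop0 (s := 1)) => u; rewrite scale1r.
exact: (CtropS IH (X := ev j)).
Qed.

(** The commutator of the full contraction with the 1-forms is a scalar. Its value is found at 1,
    where every word that keeps some form outside vanishes because too few forms are left to
    contract. *)
Lemma theta_engine (W : E -> Prop) (C : R) js u : uniq js ->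
  qin qT js 1 = C *: ymon R js ->
  (forall u v, W u -> W v -> W (u + v)) -> (forall u, W u -> W (- u)) ->
  (forall K : pred 'I_n, W (qout qT (filter K js) (Oev js (qin qT (filter (predC K) js) u)))) ->
  W (C *: u).
Proof.
move=> Ujs eC WD WN WK.
pose lT j : {linear E -> E} := lmul (lform (th j)).
have [s es] := gcomm_ctrop th (ctrop_ev js) (erefl (odd (size js))).
have O0 js' : qout (fun j => lT j) js' 0 = 0.
  by have := qoutZ lT js' 0 0; rewrite !scale0r.
have [|||K hK|b eb] := @gcomm_tail n R _ lT (fun x => x = 0) (size js) js (Oev js) 1 Ujs.
- by [].
- by move=> ? ? -> ->; rewrite addr0.
- by move=> a ? ->; rewrite scaler0.
- rewrite (@qin_ev_deg js (size (filter (predC K) js) + 0)%N) //.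
    by rewrite addn0 size_filter -(count_predC K js) -[ltnLHS]add0n ltn_add2r -has_count.
  by apply: qin_lmul_deg; apply: supp_mon; rewrite /exhom cards0.
have [b' eb'] := qin_ev_ymon Ujs.
have eqi js' : qin (fun j => lT j) js' 1 = qin qT js' 1 by [].
have {eb} es1 : s = (-1) ^+ (b (+) b') * C.
  apply: alg_inj; rewrite -es; apply/eqP; rewrite signr_addb -subr_eq0; apply/eqP.
  rewrite -[RHS]eb eqi eC; congr (_ - _).
  by rewrite (@qinZ _ _ _ (fun j => ctr (ev j) : {linear E -> E})) eb' !scalerA mulrAC.
apply: (sign_closed (b := b (+) b') WN); rewrite -es1 -es.
exact: (@gcommP n R _ lT W (size js) js (Oev js) u Ujs WD WN WK).
Qed.

(** On [js], C c_j = rho_j t_j says that C times the e-th form of weights c is the (e+1)-st form of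
    weights rho. After multiplication by C^m this is therefore [psi_prod] for rho. *)
Lemma psi_prod_polar (c rho t : 'I_n -> R) (C : R) js m : uniq js -> size js = m.+1 -> C != 0 ->
  (forall j, j \in js -> C * c j = rho j * t j) -> \prod_(j <- js) rho j = C ^+ m ->
  psi rho t js 0 * \prod_(0 <= e < m) psi c t js e = vdm t js *: ymon R js.
Proof.
move=> Ujs szjs C0 Cc rhoC; apply: (@scaler_injE n R (C ^+ m)); first by rewrite expf_neq0.
have := psi_prod rho t Ujs; rewrite szjs rhoC -scalerA => <-.
rewrite [RHS]big_nat_recl // scalerAr; congr (_ * _).
rewrite [RHS](eq_bigr (fun e => C *: psi c t js e)) => [|e _].
  by rewrite scaler_prod prodr_const_nat subn0.
rewrite /psi scaler_sumr big_seq [RHS]big_seq; apply: eq_bigr => j jjs.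
by rewrite scalerA exprS !mulrA Cc.
Qed.
End ThetaEngine.

(** * Semi-invariants of the block triangular group *)

Section MonomialIdeal.
Variables (n : nat) (R : comNzRingType).
Local Notation E := (extalg n R).
Implicit Types (S T : {set 'I_n}) (u v w : E).

Lemma mon_gen_comm S i : ext_mon R S * ext_gen R i = (-1) ^+ #|S| *: (ext_gen R i * ext_mon R S).
Proof.
have [m] := ubnP #|S|; elim: m S => // m IHm S leS.
have [->|[j Sj]] := set_0Vmem S.
  by rewrite cards0 scale1r -[ext_mon R set0]/(1 : E) mul1r mulr1.
have nj : j \notin S :\ j by rewrite setD11.
rewrite -(setD1K Sj) ext_monU1 // cardsU1 nj -scalerAl -scalerAr -mulrA IHm; last first.
  by rewrite (cardsD1 j S) Sj in leS.
rewrite -scalerAr !mulrA ext_gen_anti mulNr scalerN scalerN exprS mulN1r scaleNr.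
by rewrite !scalerA mulrC.
Qed.

Lemma mon_ideal S u v : ext_mon R S * u = 0 -> ext_mon R S * (v * u) = 0.
Proof.
move=> Su; elim/ext_ind: v => [|v w Hv Hw|a v Hv|i v Hv].
- by rewrite mul1r.
- by rewrite mulrDl mulrDr Hv Hw addr0.
- by rewrite -scalerAl -scalerAr Hv scaler0.
by rewrite -mulrA mulrA mon_gen_comm -scalerAl -mulrA Hv mulr0 scaler0.
Qed.

(** Congruence modulo the ideal generated by the y_i with i in S, tested by multiplying with y_S. *)
Definition meq S u v := ext_mon R S * u = ext_mon R S * v.

Lemma meqM S u u' v v' : meq S u u' -> meq S v v' -> meq S (u * v) (u' * v').
Proof.
move=> eu ev; rewrite /meq mulrA eu -mulrA; apply/eqP; rewrite -subr_eq0 -mulrBr -mulrBr.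
by apply/eqP/mon_ideal; rewrite mulrBr ev subrr.
Qed.

Lemma meq_prod S (I : Type) (r : seq I) (Q : pred I) (f f' : I -> E) :
  (forall i, Q i -> meq S (f i) (f' i)) -> meq S (\prod_(i <- r | Q i) f i) (\prod_(i <- r | Q i) f' i).
Proof.
by move=> ff; apply: big_ind2 => // u u' v v'; apply: meqM.
Qed.

Lemma meq_lform S al be : (forall i, i \notin S -> al i = be i) -> meq S (lform al) (lform be).
Proof.
move=> e; rewrite /meq !mulr_sumr; apply: eq_bigr => i _.
have [iS|/e -> //] := boolP (i \in S).
by rewrite -!scalerAr mon_gen_comm ext_gen_mon0 // !scaler0.
Qed.

(** Apply phi to the equation saying that y_S w is C y_T up to sign, and compare coefficients at T:
    a congruence for w becomes the transformation rule of the polynomial C. *)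
Lemma top_coef S T (m w : E) s (C mu d d' : R) (f : R -> R) (phi : E -> E) :
  (forall a u, phi (a *: u) = f a *: phi u) -> (forall u v, phi (u * v) = phi u * phi v) ->
  (forall a, f ((-1) ^+ s * a) = (-1) ^+ s * f a) ->
  phi (ext_mon R S) = d *: ext_mon R S -> phi (ext_mon R T) = d' *: ext_mon R T ->
  ext_mon R S * m = (-1) ^+ s *: ext_mon R T -> w = C *: m -> meq S (phi w) (mu *: w) ->
  d' * f C = mu * d * C.
Proof.
move=> phiZ phiM fs phiS phiT Sm wE pw.
have YC : ext_mon R S * w = ((-1) ^+ s * C) *: ext_mon R T.
  by rewrite wE -scalerAr Sm scalerA mulrC.
have := congr1 phi YC; rewrite phiM phiS phiZ phiT -scalerAl pw -scalerAr YC !scalerA.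
move/ffunP/(_ T); rewrite !extZE [ext_mon R T T]ffunE eqxx !mulr1 fs => e.
transitivity ((-1) ^+ s * (-1) ^+ s * (d' * f C)); first by rewrite signr_sqr mul1r.
transitivity ((-1) ^+ s * ((-1) ^+ s * f C * d')); first by ring.
rewrite -e; transitivity ((-1) ^+ s * (-1) ^+ s * (mu * d * C)); first by ring.
by rewrite signr_sqr mul1r.
Qed.

Lemma swap_mon S i j (w w' : R) (f : R -> R) (phi : E -> E) :
  (forall a u, phi (a *: u) = f a *: phi u) -> (forall u v, phi (u * v) = phi u * phi v) ->
  (forall s s', f ((-1) ^+ s * (-1) ^+ s') = (-1) ^+ s * (-1) ^+ s') ->
  phi (ext_gen R i) = w' *: ext_gen R j -> phi (ext_gen R j) = w *: ext_gen R i -> w' * w = 1 ->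
  phi (ext_mon R S) = ext_mon R S -> i \notin j |: S -> j \notin S ->
  phi (ext_mon R (i |: (j |: S))) = -1 *: ext_mon R (i |: (j |: S)).
Proof.
move=> phiZ phiM fs phii phij ww phiS ni nj.
have -> : ext_mon R (i |: (j |: S)) = ((-1) ^+ nbelow i (j |: S) * (-1) ^+ nbelow j S) *:
    (ext_gen R i * (ext_gen R j * ext_mon R S)).
  by rewrite ext_monU1 // ext_monU1 // -scalerAr scalerA.
move: (_ * _) (fs (nbelow i (j |: S)) (nbelow j S)) => s {}fs.
rewrite phiZ fs scalerA [-1 * s]mulrC -scalerA; congr (s *: _).
rewrite 2!phiM phiS phii phij scaleN1r.
by rewrite -!scalerAl -!scalerAr scalerA ww scale1r !mulrA (ext_gen_anti R j i) mulNr.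
Qed.

Lemma ext_mon_self S : ext_mon R S S = 1.
Proof. by rewrite ffunE eqxx. Qed.

Lemma ext_mon_neq0 S : ext_mon R S != 0.
Proof. by apply/eqP=> /ffunP/(_ S)/eqP; rewrite ext_mon_self ffunE oner_eq0. Qed.

Lemma lform_mon S al : lform al * ext_mon R S = (-1) ^+ #|S| *: (ext_mon R S * lform al).
Proof.
rewrite mulr_suml mulr_sumr scaler_sumr; apply: eq_bigr => i _.
rewrite -scalerAl -scalerAr mon_gen_comm !scalerA; congr (_ *: _).
by rewrite mulrAC signr_sqr mul1r.
Qed.

Definition inmon S u := exists v, u = ext_mon R S * v.

Lemma inmon_lform S al u : inmon S u -> inmon S (lform al * u).
Proof.
move=> [v ->]; exists ((-1) ^+ #|S| *: (lform al * v)).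
by rewrite mulrA lform_mon -scalerAl -scalerAr mulrA.
Qed.

Lemma meq_lmul S al be (m : R) u : meq S (lform al) (m *: lform be) -> inmon S u ->
  lform al * u = m *: (lform be * u).
Proof.
move=> e [v ->]; rewrite !mulrA !lform_mon -!scalerAl e -scalerAr -scalerAl.
by rewrite !scalerA mulrC.
Qed.

Section Covariant.
Variables (I : eqType) (S : {set 'I_n}) (phi : E -> E) (d : R).
Variables (th th' : I -> 'I_n -> R) (mu : I -> R).
Hypothesis phiM : forall u v, phi (u * v) = phi u * phi v.
Hypothesis phiS : phi (ext_mon R S) = d *: ext_mon R S.
Hypothesis phith : forall j, phi (lform (th j)) = lform (th' j).
Hypothesis meqth : forall j, meq S (lform (th' j)) (mu j *: lform (th j)).
Local Notation qT := (fun j => lmul (lform (th j))).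

Lemma inmon_phi u : inmon S u -> inmon S (phi u).
Proof. by move=> [v ->]; exists (d *: phi v); rewrite phiM phiS -scalerAl scalerAr. Qed.

Lemma inmon_qin js u : inmon S u -> inmon S (qin qT js u).
Proof. by move=> Su; elim: js => //= j js; apply: inmon_lform. Qed.

Lemma phi_qout js u : inmon S u ->
  phi (qout qT js u) = (\prod_(j <- js) mu j) *: qout qT js (phi u).
Proof.
elim: js u => [|j js IH] u Su; first by rewrite big_nil scale1r.
rewrite big_cons /= IH; last exact: inmon_lform.
rewrite {1}/lmul phiM phith (meq_lmul (meqth j) (inmon_phi Su)).
have qZ := @qoutZ n R I (fun j => lmul (lform (th j)) : {linear E -> E}).
by rewrite qZ scalerA mulrC.
Qed.

Lemma phi_qin js u : inmon S u ->
  phi (qin qT js u) = (\prod_(j <- js) mu j) *: qin qT js (phi u).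
Proof.
move=> Su; elim: js => [|j js IH]; first by rewrite big_nil scale1r.
rewrite big_cons /= {1}/lmul phiM phith (meq_lmul (meqth j)); last exact/inmon_phi/inmon_qin.
by rewrite IH -scalerAr scalerA.
Qed.
End Covariant.

Lemma qin_lmul_prod (I : Type) (th : I -> 'I_n -> R) js u :
  qin (fun j => lmul (lform (th j))) js u = (\prod_(j <- js) lform (th j)) * u.
Proof.
elim: js => [|j js IH]; first by rewrite big_nil mul1r.
by rewrite big_cons /= IH /lmul mulrA.
Qed.

Lemma scale_sub (a b c : R) u : a *: ((b - c) *: u) = b *: (a *: u) - a *: (c *: u).
Proof. by rewrite scalerBl scalerBr !scalerA [b * a]mulrC. Qed.

Lemma supp_sub_scaleD (Q : pred {set 'I_n}) (a : R) u v e f :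
  supp Q (u - a *: e) -> supp Q (v - a *: f) -> supp Q (u + v - a *: (e + f)).
Proof. by rewrite scalerDr opprD addrACA; apply: suppD. Qed.

Lemma supp_sub_scaleN (Q : pred {set 'I_n}) (a : R) u e :
  supp Q (u - a *: e) -> supp Q (- u - a *: (- e)).
Proof. by rewrite scalerN -opprD; apply: suppN. Qed.

End MonomialIdeal.

(** * Characters of the block triangular group and the polynomials that carry them *)

Section Group.
Variables (n : nat) (F : finFieldType).
Local Notation P := {mpoly F[n]}.
Local Notation A := (extalg n P).
Local Notation q := #|F|.
Implicit Types (g h : 'M[F]_n) (p : P) (u v : A) (c d : 'rV[F]_n).
Variables (ch k : nat).
Hypotheses (ch_prime : prime ch) (cardF : q = (ch ^ k)%N).

Variables (l : nat) (bl : 'I_n -> 'I_l) (gl : pred 'I_l) (r : 'I_l -> nat).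
Hypothesis bl_mono : forall i j : 'I_n, (i <= j)%N -> (bl i <= bl j)%N.
Hypothesis r_dvd : forall b, (r b %| q.-1)%N.
(** With this convention the r_b-th roots of unity are all admissible diagonal entries in either
    type of block, so both are tested with the same torus elements. *)
Hypothesis r_gl : forall b, gl b -> r b = q.-1.
Hypothesis two_neq0 : forall i j, i != j -> bl i = bl j -> ~~ gl (bl i) -> 2%:R != 0 :> F.

Definition monomial_block b g := exists t : 'I_n -> 'I_n, exists w : 'I_n -> F,
  [/\ {in [set j | bl j == b] &, injective t},
      forall j, bl j = b -> bl (t j) = b /\ w j ^+ r b = 1
    & forall i j, bl i = b -> bl j = b -> g i j = if i == t j then w j else 0].

Definition in_parabolic g :=
  [/\ g \in unitmx, forall i j, (bl j < bl i)%N -> g i j = 0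
    & forall b, ~~ gl b -> monomial_block b g].

Variable G : {set 'M[F]_n}.
Hypothesis GP : forall g, g \in G <-> in_parabolic g.

Definition cut (b : nat) : nat := #|[set j | (bl j < b)%N]|.

Lemma card_down (D : {set 'I_n}) (j : 'I_n) :
  (forall i i' : 'I_n, (i <= i')%N -> i' \in D -> i \in D) -> (j < #|D|)%N = (j \in D).
Proof.
move=> dD.
have cardlt m : (m <= n)%N -> #|[set i : 'I_n | (i < m)%N]| = m.
  move=> mn; rewrite -sum1dep_card (big_ord_narrow mn) sum1_card card_ord.
  by [].
apply/idP/idP => [|jD].
  apply: contraTT => njD; rewrite -leqNgt -(cardlt j (ltnW (ltn_ord j))).
  apply/subset_leq_card/subsetP => i iD; rewrite inE ltnNge.
  by apply: contra njD => /dD/(_ iD).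
rewrite -(cardlt j.+1 (ltn_ord j)); apply/subset_leq_card/subsetP => i.
by rewrite inE ltnS => /dD; apply.
Qed.

Lemma ltn_cut b (j : 'I_n) : (j < cut b)%N = (bl j < b)%N.
Proof.
rewrite card_down ?inE // => i i' ii'; rewrite !inE; apply: leq_ltn_trans.
exact: bl_mono.
Qed.

Lemma cut_leq b : (cut b <= n)%N.
Proof. by rewrite -[leqRHS](card_ord n) max_card. Qed.

Lemma cut0 : cut 0 = 0%N.
Proof. by apply: eq_card0 => j; rewrite inE. Qed.

Lemma cutS b : (cut b <= cut b.+1)%N.
Proof. by apply/subset_leq_card/subsetP => j; rewrite !inE; apply: leqW. Qed.

(* Indices of the blocks before [b], resp. of the block [b]. *)
Definition J b : {set 'I_n} := slice n 0 (cut b).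
Definition B (b : nat) : {set 'I_n} := slice n (cut b) (cut b.+1).
Local Notation Bq b := (sliceq n (cut b) (cut b.+1)).

Lemma in_J b j : (j \in J b) = (bl j < b)%N.
Proof. by rewrite inE /= ltn_cut. Qed.

Lemma in_B (b : nat) j : (j \in B b) = (bl j == b :> nat).
Proof. by rewrite inE leqNgt !ltn_cut -leqNgt ltnS eqn_leq andbC. Qed.

Lemma in_Bq (b : nat) j : (j \in Bq b) = (bl j == b :> nat).
Proof. by rewrite mem_sliceq -in_B inE. Qed.

Lemma J_B b : J b.+1 = B b :|: J b.
Proof. by apply/setP=> j; rewrite in_setU !in_J in_B ltnS leq_eqVlt. Qed.

Lemma disjoint_BJ b : [disjoint B b & J b].
Proof.
rewrite -setI_eq0; apply/eqP/setP=> j; rewrite in_setI in_B in_J in_set0.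
by case: eqP => // ->; rewrite ltnn.
Qed.

Lemma low_G g b c : g \in G -> low (cut b) c -> low (cut b) (c *m g^T).
Proof.
case/GP=> _ gT _ /lowP lc; apply/lowP=> i; rewrite leqNgt ltn_cut -leqNgt => bi.
rewrite mxE big1 // => j _; rewrite mxE.
have [bj|bj] := ltnP (bl j) b; first by rewrite gT ?mulr0 // (leq_trans bj).
by rewrite lc ?mul0r // leqNgt ltn_cut -leqNgt.
Qed.

Lemma unit_G g : g \in G -> g \in unitmx. Proof. by case/GP. Qed.

Lemma tri_G g i j : g \in G -> (bl j < bl i)%N -> g i j = 0.
Proof. by case/GP=> _ + _; apply. Qed.

Lemma J_G g b i j : g \in G -> j \in J b -> g i j != 0 -> i \in J b.
Proof.
rewrite !in_J => gG jb; apply: contraR; rewrite -leqNgt => bi.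
by rewrite tri_G // (leq_trans jb).
Qed.

Definition Y b : A := ext_mon P (J b).
(* The determinant of the first [b] diagonal blocks of [g]. *)
Definition dd b g : F := (ext_act g (Y b) (J b))@_0.

Lemma act_Y b g : g \in G -> ext_act g (Y b) = (dd b g)%:MP *: Y b.
Proof.
move=> gG; rewrite (supp_sub_exhom (u := ext_act g (Y b)) (S := J b)).
- rewrite /dd /Y; have [a ->] := const_act_mon g (J b) (J b).
  by rewrite mcoeffC eqxx mulr1.
- apply: sub_act_mon => // i j; exact: J_G.
exact: exhom_act_mon.
Qed.

Lemma Y_neq0 b : Y b != 0.
Proof. exact: ext_mon_neq0. Qed.

Lemma dd_neq0 b g : g \in G -> dd b g != 0.
Proof.
move=> gG; apply: contraNneq (Y_neq0 b) => d0.
have := act_Y b gG; rewrite d0 mpolyC0 scale0r => e.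
rewrite -(ext_act_id (Y b)) -(mulVmx (unit_G gG)) ext_actMM e.
by rewrite -(scale0r 1) ext_actZ rmorph0 !scale0r.
Qed.

Lemma dd0 g : dd 0 g = 1.
Proof.
rewrite /dd /Y /J cut0 slicenn -[ext_mon P set0]/(1 : A) ext_act1 ffunE eqxx.
by rewrite mcoeff1 eqxx.
Qed.

Lemma act_qout g (I : Type) (Z : I -> 'I_n -> P) js u :
  (forall j i, poly_act g (Z j i) = \sum_i' (g i' i)%:MP * Z j i') ->
  ext_act g (qout (fun j => ctr (Z j)) js u) = qout (fun j => ctr (Z j)) js (ext_act g u).
Proof.
move=> eZ; elim: js u => //= j js IH u; rewrite IH ext_act_ctr //.
Qed.

Lemma act_qin g (I : Type) (Z : I -> 'I_n -> P) js u :
  (forall j i, poly_act g (Z j i) = \sum_i' (g i' i)%:MP * Z j i') ->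
  ext_act g (qin (fun j => ctr (Z j)) js u) = qin (fun j => ctr (Z j)) js (ext_act g u).
Proof.
by move=> eZ; elim: js => //= j js IH; rewrite ext_act_ctr // IH.
Qed.

Lemma Zv_act g b j i : g \in G ->
  poly_act g (Zv F (cut b) j i) = \sum_i' (g i' i)%:MP * Zv F (cut b) j i'.
Proof.
move=> gG; apply: (Zvec_act ch_prime cardF) => //; [exact: cut_leq | exact: unit_G |].
by move=> c; apply: low_G.
Qed.

Definition Del b : P := \prod_(j in J b) Lam F j.
Definition DL (b : nat) : P := \prod_(j in B b) Lam F j.

Lemma ext_actA g p : ext_act g p%:A = (poly_act g p)%:A.
Proof. by rewrite ext_actZ ext_act1. Qed.

(** [Del b] is, up to sign, the full contraction of [Y b] by equivariant contractions, so it
    inherits the character of [Y b]. *)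
Lemma act_Del b g : g \in G -> poly_act g (Del b) = dd b g *: Del b.
Proof.
move=> gG; have [s es] := moore_top ch_prime cardF (leq0n _) (cut_leq b).
rewrite -/(J b) -/(Y b) -/(Del b) in es.
have := congr1 (ext_act g) es; rewrite act_qout; last first.
  by move=> j i; have := Zv_act 0 j i gG; rewrite cut0.
rewrite act_Y // qout_ctrZ es ext_actA scalerA => /alg_inj.
rewrite rmorphM rmorphXn rmorphN1 mulrCA => /(congr1 (fun x => (-1) ^+ s * x)).
by rewrite !mulrA signr_sqr !mul1r mul_mpolyC => ->.
Qed.

Lemma Del_DL b : Del b.+1 = DL b * Del b.
Proof.
rewrite /Del /DL J_B -bigU ?disjoint_BJ //; apply: eq_bigl => j.
by rewrite in_setU.
Qed.

Lemma Del_neq0 b : Del b != 0.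
Proof. by apply/prodf_neq0 => j _; apply: Lam_neq0. Qed.

Lemma act_DL b g : g \in G -> poly_act g (DL b) = (dd b.+1 g / dd b g) *: DL b.
Proof.
move=> gG; have := act_Del b.+1 gG; rewrite Del_DL rmorphM /= act_Del //.
rewrite -scalerAr => e; apply: (mulIf (Del_neq0 b)).
apply: (scalerI (dd_neq0 b gG)); rewrite e -scalerAl scalerA.
by rewrite [dd b g * _]mulrC divfK ?dd_neq0.
Qed.

(** The orbit product of x_j under U_I. In a monomial block, G permutes these up to roots of
    unity. *)
Definition z (j : 'I_n) : P := FM (cut (bl j)) 'X_j.
(* For a monomial block, the product of its nonzero entries. *)
Definition delta (b : nat) g : F := \prod_(j in B b) \sum_(i in B b) g i j.

Lemma block_image (b : nat) (t : 'I_n -> 'I_n) : {in B b &, injective t} ->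
  (forall j, j \in B b -> t j \in B b) -> t @: B b = B b.
Proof.
move=> tI tB; apply/eqP; rewrite eqEcard (card_in_imset tI) leqnn andbT.
by apply/subsetP=> _ /imsetP[j jB ->]; apply: tB.
Qed.

Lemma mono_G (b : 'I_l) g : g \in G -> ~~ gl b ->
  exists t : 'I_n -> 'I_n, exists w : 'I_n -> F,
  [/\ {in B b &, injective t}, t @: B b = B b,
      forall j, j \in B b -> w j ^+ r b = 1
    & forall i j, i \in B b -> j \in B b -> g i j = if i == t j then w j else 0].
Proof.
case/GP=> _ _ /(_ b) + nb => /(_ nb)[t [w [tI tB gE]]]; exists t, w.
have inB j : (j \in B b) = (bl j == b) by rewrite in_B.
have {}tI : {in B b &, injective t}.
  by move=> i j; rewrite !inB => ib jb; apply: tI; rewrite inE.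
split=> //.
- by apply: block_image => // j; rewrite !inB => /eqP/tB[-> _].
- by move=> j; rewrite inB => /eqP/tB[].
by move=> i j; rewrite !inB => /eqP ib /eqP jb; apply: gE.
Qed.

Lemma z_low (b : nat) j : (bl j < b)%N -> FM (cut b) 'X_j = 0 :> P.
Proof. by move=> jb; rewrite -lin_delta FM_low // low_delta ltn_cut. Qed.

Lemma act_FM (b : nat) g j : g \in G -> j \in B b ->
  poly_act g (FM (cut b) 'X_j) = \sum_(i in B b) g i j *: FM (cut b) 'X_i.
Proof.
move=> gG; rewrite in_B => /eqP jb.
rewrite FM_act ?unit_G // => [|c]; last exact: low_G.
rewrite poly_actX (FM_sum ch_prime cardF) ?cut_leq // [RHS]big_mkcond /=.
apply: eq_bigr => i _; rewrite (FMZ ch_prime cardF) ?cut_leq // in_B.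
have [ib|ib|//] := ltngtP (bl i) b; first by rewrite z_low // scaler0.
by rewrite tri_G ?scale0r // jb.
Qed.

Lemma zE (b : nat) j : j \in B b -> z j = FM (cut b) 'X_j.
Proof. by rewrite in_B /z => /eqP->. Qed.

Lemma act_z (b : nat) g t w j : g \in G -> j \in B b -> t @: B b = B b ->
  (forall i j, i \in B b -> j \in B b -> g i j = if i == t j then w j else 0) ->
  poly_act g (z j) = w j *: z (t j).
Proof.
move=> gG jB tB gE; have tjB : t j \in B b by rewrite -tB imset_f.
rewrite !(zE (b := b)) // act_FM // (bigD1 (t j)) //= gE // eqxx big1 ?addr0 //.
by move=> i /andP[iB /negPf ne]; rewrite gE // ne scale0r.
Qed.

Lemma z_neq0 j : z j != 0.
Proof.
apply/prodf_neq0 => c /lowP lc; rewrite -lin_delta -linearD lin_eq0.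
apply/eqP=> /rowP/(_ j)/eqP; rewrite !mxE !eqxx lc ?addr0 ?oner_eq0 //.
by rewrite leqNgt ltn_cut ltnn.
Qed.

Lemma deltaE (b : nat) g t w : t @: B b = B b ->
  (forall i j, i \in B b -> j \in B b -> g i j = if i == t j then w j else 0) ->
  delta b g = \prod_(j in B b) w j.
Proof.
move=> tB gE; apply: eq_bigr => j jB; have tjB : t j \in B b by rewrite -tB imset_f.
rewrite (bigD1 (t j)) //= gE // eqxx big1 ?addr0 //.
by move=> i /andP[iB /negPf ne]; rewrite gE // ne.
Qed.

Lemma deltaX (b : 'I_l) g : g \in G -> ~~ gl b -> delta b g ^+ r b = 1.
Proof.
move=> gG nb; have [t [w [tI tB wr gE]]] := mono_G gG nb.
by rewrite (deltaE tB gE) -prodrXl big1.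
Qed.

Lemma r_gt0 b : (0 < r b)%N.
Proof.
apply: dvdn_gt0 (r_dvd b); rewrite -subn1 subn_gt0; exact: finRing_gt1.
Qed.

Lemma delta_neq0 (b : 'I_l) g : g \in G -> ~~ gl b -> delta b g != 0.
Proof.
move=> gG nb; apply/eqP=> d0; have /eqP := deltaX gG nb.
by rewrite d0 expr0n gtn_eqF ?r_gt0 // eq_sym oner_eq0.
Qed.

Definition PiZ (b : nat) : P := \prod_(j in B b) z j.

Lemma act_PiZ (b : 'I_l) g : g \in G -> ~~ gl b -> poly_act g (PiZ b) = delta b g *: PiZ b.
Proof.
move=> gG nb; have [t [w [tI tB wr gE]]] := mono_G gG nb.
rewrite (deltaE tB gE) rmorph_prod /=.
under eq_bigr => j jB do rewrite (act_z gG jB tB gE).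
rewrite scaler_prod; congr (_ *: _); rewrite /PiZ -{2}tB big_imset //.
Qed.

Lemma PiZ_neq0 b : PiZ b != 0.
Proof. by apply/prodf_neq0 => j _; apply: z_neq0. Qed.

Definition tz (j : 'I_n) : P := z j ^+ r (bl j).
Definition Van (b : nat) : P := vdm tz (Bq b).
Definition cz (j : 'I_n) : P := z j ^+ (r (bl j)).-1.
(** The formal differential of the power sum of the z_j^(r(e+1)), without its integer factor and
    with y_j in place of dz_j. *)
Definition PS (b : nat) e : A := psi cz tz (Bq b) e.

Lemma act_lform g (a : 'I_n -> P) :
  ext_act g (lform a) = lform (fun i => \sum_j poly_act g (a j) * (g i j)%:MP).
Proof.
rewrite /lform ext_act_sum; under eq_bigr => j _ do rewrite ext_actZ ext_actX /ext_act_gen scaler_sumr.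
rewrite exchange_big; apply: eq_bigr => i _ /=; rewrite scaler_suml; apply: eq_bigr => j _.
by rewrite scalerA.
Qed.

Lemma ext_act_prod g (I : Type) (s : seq I) (Q : pred I) (f : I -> A) :
  ext_act g (\prod_(i <- s | Q i) f i) = \prod_(i <- s | Q i) ext_act g (f i).
Proof. exact: (big_morph _ (ext_actM g) (ext_act1 g)). Qed.

Lemma mono_lform (b : nat) g t w (a : 'I_n -> P) (mu : F) : g \in G ->
  {in B b &, injective t} -> t @: B b = B b ->
  (forall i j, i \in B b -> j \in B b -> g i j = if i == t j then w j else 0) ->
  (forall j, j \notin B b -> a j = 0) ->
  (forall j, j \in B b -> w j *: poly_act g (a j) = mu *: a (t j)) ->
  meq (J b) (ext_act g (lform a)) (mu%:MP *: lform a).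
Proof.
move=> gG tI tB gE a0 aE; rewrite act_lform.
have -> : mu%:MP *: lform a = lform (fun i => mu%:MP * a i).
  by rewrite /lform scaler_sumr; apply: eq_bigr => i _; rewrite scalerA.
apply: meq_lform => i; rewrite in_J -leqNgt => bi.
rewrite (bigID (mem (B b))) /= [X in _ + X]big1 ?addr0 => [|j njB]; last first.
  by rewrite a0 // rmorph0 mul0r.
have [iB|niB] := boolP (i \in B b); last first.
  rewrite a0 // mulr0 big1 // => j; rewrite in_B => /eqP jb.
  rewrite tri_G ?mpolyC0 ?mulr0 // jb ltn_neqAle bi andbT.
  by move: niB; rewrite in_B eq_sym.
rewrite (eq_bigr (fun j => if i == t j then mu *: a (t j) else 0)) => [|j jB]; last first.
  rewrite gE //; case: eqP => _; last by rewrite mpolyC0 mulr0.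
  by rewrite mulrC mul_mpolyC aE.
rewrite -(big_imset (fun k => if i == k then mu *: a k else 0)) //= tB.
rewrite (bigD1 i) //= eqxx big1 ?addr0 ?mul_mpolyC // => i' /andP[_ /negPf].
by rewrite eq_sym => ->.
Qed.

Lemma PS_lform b e : PS b e = lform (fun j => if j \in B b then cz j * tz j ^+ e else 0).
Proof.
apply: (psi_lform_mem (Q := mem (B b)) _ _ _ (sliceq_uniq n (cut b) (cut b.+1))) => j.
by rewrite in_Bq -in_B.
Qed.

Lemma act_PS (b : 'I_l) g e : g \in G -> ~~ gl b -> meq (J b) (ext_act g (PS b e)) (PS b e).
Proof.
move=> gG nb; have [t [w [tI tB wr gE]]] := mono_G gG nb.
rewrite PS_lform -[X in meq _ _ X]scale1r -mpolyC1.
apply: (mono_lform gG tI tB gE) => [j /negPf-> //|j jB].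
have tjB : t j \in B b by rewrite -tB imset_f.
rewrite jB tjB scale1r rmorphM !rmorphXn /= (act_z gG jB tB gE).
have [/eqP/val_inj bj /eqP/val_inj btj] : bl j == b :> nat /\ bl (t j) == b :> nat by rewrite -!in_B.
rewrite /cz /tz bj btj !exprZn wr // expr1n scale1r -scalerAl scalerA -exprS.
by rewrite prednK ?r_gt0 // wr // scale1r.
Qed.

Lemma sign_Y (b : nat) : exists s : bool, Y b * ymon P (Bq b) = (-1) ^+ s *: Y b.+1.
Proof.
have [s ->] := ymon_sign P (sliceq_uniq n (cut b) (cut b.+1)).
have -> : [set j in Bq b] = B b by apply/setP=> j; rewrite inE in_Bq in_B.
exists (odd (ninv (J b) (B b)) (+) s); rewrite -scalerAr ext_monM.
rewrite disjoint_sym disjoint_BJ scalerA signr_addb signr_odd mulrC; congr (_ *: _).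
by rewrite /Y J_B setUC.
Qed.

Lemma size_Bq b : size (Bq b) = #|B b|.
Proof.
rewrite -(card_uniqP (sliceq_uniq _ _ _)); apply: eq_card => j.
by rewrite in_Bq in_B.
Qed.

Lemma act_top_coef (b : nat) g (C : P) (mu : F) (w : A) : g \in G ->
  w = C *: ymon P (Bq b) -> meq (J b) (ext_act g w) (mu%:MP *: w) ->
  dd b.+1 g *: poly_act g C = (mu * dd b g) *: C.
Proof.
move=> gG wE gw; have [s es] := sign_Y b.
have := top_coef (ext_actZ g) (ext_actM g) _ (act_Y b gG) (act_Y b.+1 gG) es wE gw.
rewrite -mpolyCM !mul_mpolyC; apply=> a.
by rewrite rmorphM rmorphXn rmorphN1.
Qed.

(** The product of all [PS b e] is invariant modulo earlier blocks and equals [PiZ^(r-1) * Van]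
    times the top monomial of the block. [top_coef] then gives the character of this polynomial, and
    that of [PiZ] is known. *)
Lemma act_Van (b : 'I_l) g : g \in G -> ~~ gl b ->
  poly_act g (Van b) = (delta b g * (dd b g / dd b.+1 g)) *: Van b.
Proof.
move=> gG nb; pose w : A := \prod_(0 <= e < size (Bq b)) PS b e.
have wE : w = (PiZ b ^+ (r b).-1 * Van b) *: ymon P (Bq b).
  have <- : \prod_(j <- Bq b) cz j = PiZ b ^+ (r b).-1.
    rewrite -prodrXl (big_uniq _ (sliceq_uniq n (cut b) (cut b.+1))) /=.
    apply: eq_big => [j|j]; first by rewrite in_Bq in_B.
    by rewrite in_Bq /cz => /eqP/val_inj->.
  exact: (psi_prod cz tz (sliceq_uniq n (cut b) (cut b.+1))).
have gw : meq (J b) (ext_act g w) (1%:MP *: w).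
  rewrite mpolyC1 scale1r /w ext_act_prod; apply: meq_prod => e _; exact: act_PS.
have := act_top_coef gG wE gw; rewrite mul1r rmorphM rmorphXn /= act_PiZ // exprZn.
set D := dd b.+1 g; set d := dd b g; set V := poly_act g _ => e.
have D0 : D != 0 := dd_neq0 _ gG.
have PZ0 : PiZ b ^+ (r b).-1 != 0 by rewrite expf_neq0 // PiZ_neq0.
have e2 : D *: (delta b g ^+ (r b).-1 *: V) = d *: Van b.
  apply: (mulfI PZ0); move: e; rewrite -!mul_mpolyC.
  set x := PiZ b ^+ _; set a := (delta b g ^+ _)%:MP => e.
  transitivity (D%:MP * (a * x * V)); first by ring.
  by rewrite e; ring.
have dr : delta b g * delta b g ^+ (r b).-1 = 1.
  by rewrite -exprS prednK ?r_gt0 // deltaX.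
have e4 : delta b g ^+ (r b).-1 *: V = (d / D) *: Van b.
  by apply: (scalerI D0); rewrite e2 scalerA mulrCA divff // mulr1.
by rewrite -scalerA -e4 scalerA dr scale1r.
Qed.

(* The character of [Fac b t e]; the products of the [Fac b t e] over [b] divide *)
(* every polynomial with the same character, see [generator_dvd].             *)
Definition kappa (b : 'I_l) (t : nat) (e : bool) g : F :=
  if gl b then (dd b.+1 g / dd b g) ^+ (q.-2 * e)
  else delta b g ^+ t * (delta b g * (dd b g / dd b.+1 g)) ^+ e.

(** On a GL block the exponent q - 2 realizes the inverse determinant by a polynomial. *)
Definition Fac (b : 'I_l) (t : nat) (e : bool) : P :=
  if gl b then DL b ^+ (q.-2 * e) else PiZ b ^+ t * Van b ^+ e.

Lemma act_Fac b t e g : g \in G -> poly_act g (Fac b t e) = kappa b t e g *: Fac b t e.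
Proof.
move=> gG; rewrite /Fac /kappa; case: ifP => [_|/negbT nb].
  by rewrite rmorphXn /= act_DL // exprZn.
by rewrite rmorphM !rmorphXn /= act_PiZ // act_Van // !exprZn -scalerAl -scalerAr scalerA.
Qed.

Lemma kappa_neq0 b t e g : g \in G -> kappa b t e g != 0.
Proof.
move=> gG; rewrite /kappa; case: ifP => [_|/negbT nb].
  by rewrite expf_neq0 // mulf_neq0 ?invr_neq0 // dd_neq0.
by rewrite mulf_neq0 ?expf_neq0 ?mulf_neq0 ?invr_neq0 ?dd_neq0 ?delta_neq0.
Qed.

Lemma in_parabolic_id t w g : g \in unitmx ->
  (forall i j, (bl j < bl i)%N -> g i j = 0) -> injective t -> (forall j, bl (t j) = bl j) ->
  (forall j, ~~ gl (bl j) -> w j ^+ r (bl j) = 1) ->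
  (forall i j, ~~ gl (bl j) -> bl i = bl j -> g i j = if i == t j then w j else 0) -> g \in G.
Proof.
move=> gU gT tI tB wr gE; apply/GP; split=> // b nb; exists t, w; split=> [i j _ _|j jb|i j ib jb].
- exact: tI.
- by rewrite tB jb; split=> //; rewrite -jb wr // jb.
by apply: gE; rewrite ?jb ?ib.
Qed.

Lemma diag1E (j : 'I_n) (w : F) (i i' : 'I_n) : diag1 j w i i' = if i == i' then (if i == j then w else 1) else 0 :> F.
Proof. by rewrite !mxE; have [->|] := eqVneq i i'; rewrite ?mulr1n ?mulr0n. Qed.

Lemma root_neq0 (w : F) m : (0 < m)%N -> w ^+ m = 1 -> w != 0.
Proof.
move=> m0 wm; apply/eqP=> w0; move/eqP: wm.
by rewrite w0 expr0n gtn_eqF // eq_sym oner_eq0.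
Qed.

Lemma diag1_G j w : w ^+ r (bl j) = 1 -> diag1 j w \in G.
Proof.
move=> wr; have w0 := root_neq0 (r_gt0 _) wr.
have U : diag1 j w \in unitmx.
  suff e : diag1 j w *m diag1 j w^-1 = 1%:M by case: (mulmx1_unit e).
  apply/matrixP=> i i'; rewrite mxE (bigD1 i) //= big1 => [|i2 /negPf ne].
    rewrite !diag1E !mxE eqxx addr0; case: (i == i'); rewrite ?mulr0 //.
    by case: (i == j); rewrite ?mulfV ?mulr1.
  by rewrite diag1E eq_sym ne mul0r.
apply: (in_parabolic_id (t := id) (w := fun i => if i == j then w else 1)) => //.
- by move=> i i' lt; rewrite diag1E; case: eqP lt => // ->; rewrite ltnn.
- by move=> i _; case: eqP => [->//|]; rewrite expr1n.
by move=> i i' _ _; rewrite diag1E; case: eqP => [->|].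
Qed.

(** Since d annihilates c, the matrix is unipotent with inverse [tvmx (- c) d]; the second condition
    places its nonidentity entries above the diagonal blocks or inside GL blocks. *)
Lemma tvmx_G c d : \sum_i d 0 i * c 0 i = 0 ->
  (forall i j, c 0 i != 0 -> d 0 j != 0 -> (bl i < bl j)%N || (bl i == bl j) && gl (bl j)) ->
  tvmx c d \in G.
Proof.
move=> dc0 cd.
have cd0 i j : ~~ ((bl i < bl j)%N || (bl i == bl j) && gl (bl j)) -> c 0 i * d 0 j = 0.
  have [->|ci] := eqVneq (c 0 i) 0; first by rewrite mul0r.
  by have [->|dj] := eqVneq (d 0 j) 0; rewrite ?mulr0 // cd.
have U : tvmx c d \in unitmx.
  suff e : tvmx c d *m tvmx (- c) d = 1%:M by case: (mulmx1_unit e).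
  rewrite /tvmx mulmxDl mul1mx mulmxDr mulmx1 linearN /= mulNmx mulmxN -mulmxA.
  have -> : d *m (c^T *m d) = 0.
    rewrite mulmxA (_ : d *m c^T = 0) ?mul0mx //.
    by apply/matrixP=> i i'; rewrite !ord1 !mxE -[RHS]dc0; apply: eq_bigr => a _; rewrite mxE.
  by rewrite mulmx0 oppr0 addr0 addrNK.
apply: (in_parabolic_id (t := id) (w := fun=> 1)) => //.
- move=> i j ji; rewrite tvmxE cd0 ?addr0.
    by case: eqP ji => // ->; rewrite ltnn.
  by rewrite negb_or -leqNgt (ltnW ji) /=; case: eqP ji => // ->; rewrite ltnn.
- by move=> i _; rewrite expr1n.
move=> i j nj ij; rewrite tvmxE cd0 ?addr0; first by case: eqP.
by rewrite ij ltnn eqxx (negPf nj).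
Qed.

Lemma delta_tvmx (b : 'I_l) c d : ~~ gl b ->
  (forall i j, c 0 i != 0 -> d 0 j != 0 -> (bl i < bl j)%N || (bl i == bl j) && gl (bl j)) ->
  delta b (tvmx c d) = 1.
Proof.
move=> nb cd; apply: big1 => j jB; rewrite (bigD1 j) //= big1 => [|i /andP[iB /negPf ne]].
  rewrite tvmxE eqxx addr0 (_ : _ * _ = 0) ?addr0 //.
  have [->|cj] := eqVneq (c 0 j) 0; first by rewrite mul0r.
  have [->|dj] := eqVneq (d 0 j) 0; first by rewrite mulr0.
  have := cd _ _ cj dj; rewrite ltnn eqxx /=.
  by move: jB; rewrite in_B => /eqP/val_inj->; rewrite (negPf nb).
rewrite tvmxE ne add0r.
have [->|ci] := eqVneq (c 0 i) 0; first by rewrite mul0r.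
have [->|dj] := eqVneq (d 0 j) 0; first by rewrite mulr0.
have := cd _ _ ci dj.
by move: iB jB; rewrite !in_B => /eqP/val_inj-> /eqP/val_inj->; rewrite ltnn eqxx (negPf nb).
Qed.

(** The reflection exchanging x_j with w x_i; modulo x_j - w x_i it is the identity. *)
Definition swapmx i j (w : F) : 'M[F]_n := \matrix_(a, b)
  (if b == j then w * (a == i)%:R else if b == i then w^-1 * (a == j)%:R else (a == b)%:R).

Lemma swapmxX i j (w : F) a : i != j -> poly_act (swapmx i j w) 'X_a =
  if a == j then w *: 'X_i else if a == i then w^-1 *: 'X_j else 'X_a.
Proof.
move=> ne; rewrite poly_actX_lin.
have -> : \row_b swapmx i j w b a = if a == j then w *: delta_mx 0 i
    else if a == i then w^-1 *: delta_mx 0 j else delta_mx 0 a.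
  apply/rowP=> b; rewrite !mxE; case: ifP => _; first by rewrite !mxE eqxx.
  by case: ifP => _; rewrite !mxE eqxx.
by case: ifP => _; [|case: ifP => _]; rewrite ?linearZ /= lin_delta.
Qed.

Lemma swapmx_G i j w : i != j -> bl i = bl j -> w ^+ r (bl j) = 1 -> swapmx i j w \in G.
Proof.
move=> ne eb wr; have w0 := root_neq0 (r_gt0 _) wr.
have neji : (j == i) = false by rewrite eq_sym (negPf ne).
have U : swapmx i j w \in unitmx.
  suff e : swapmx i j w *m swapmx i j w = 1%:M by case: (mulmx1_unit e).
  apply/matrixP=> a b; rewrite !mxE; case: (b =P j) => [->|/eqP nbj].
    rewrite (bigD1 i) //= big1 ?addr0 => [|a' /negPf na]; last by rewrite !mxE eqxx na !mulr0.
    by rewrite !mxE !eqxx (negPf ne) mulr1 mulrAC mulVf // mul1r.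
  case: (b =P i) => [->|/eqP nbi].
    rewrite (bigD1 j) //= big1 ?addr0 => [|a' /negPf na]; last by rewrite !mxE (negPf ne) eqxx na !mulr0.
    by rewrite !mxE !eqxx (negPf ne) mulr1 mulrAC mulfV // mul1r.
  rewrite (bigD1 b) //= big1 ?addr0 => [|a' /negPf na].
    by rewrite !mxE (negPf nbj) (negPf nbi) eqxx mulr1.
  by rewrite !mxE (negPf nbj) (negPf nbi) na mulr0.
pose t a := if a == j then i else if a == i then j else a.
apply: (in_parabolic_id (t := t)
  (w := fun a => if a == j then w else if a == i then w^-1 else 1)) => //.
- move=> a b ba; rewrite mxE; case: eqP ba => [->|_]; [|case: eqP => [->|_]].
  + by case: eqP => [->|]; rewrite ?mulr0 // eb ltnn.
  + by case: eqP => [->|]; rewrite ?mulr0 // eb ltnn.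
  by case: eqP => [->|]; rewrite // ltnn.
- apply: inv_inj => a; rewrite /t; case: (a =P j) => [->|/eqP naj]; first by rewrite (negPf ne) eqxx.
  case: (a =P i) => [->|/eqP nai]; first by rewrite eqxx.
  by rewrite (negPf naj) (negPf nai).
- by move=> a; rewrite /t; case: eqP => [->//|_]; case: eqP => [->|].
- move=> a _; case: eqP => [->//|_]; case: eqP => [->|_]; last by rewrite expr1n.
  by rewrite exprVn eb wr invr1.
move=> a b _ _; rewrite mxE /t; case: (b =P j) => _.
  by case: eqP; rewrite ?mulr1 ?mulr0.
case: (b =P i) => _; first by case: eqP; rewrite ?mulr1 ?mulr0.
by case: eqP.
Qed.

Lemma delta_swap (b : nat) i j w : i != j -> bl i = bl j -> w != 0 -> delta b (swapmx i j w) = 1.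
Proof.
move=> ne eb w0; have neji : (j == i) = false by rewrite eq_sym (negPf ne).
have col a : a \in B b -> \sum_(i0 in B b) swapmx i j w i0 a =
    if a == j then w else if a == i then w^-1 else 1.
  move=> aB; case: (a =P j) => [eaj|/eqP naj].
    rewrite (bigD1 i) /=; last by rewrite in_B eb -eaj -in_B.
    rewrite big1 ?addr0 => [|a' /andP[_ /negPf na]]; first by rewrite mxE eaj !eqxx mulr1.
    by rewrite mxE eaj eqxx na mulr0.
  case: (a =P i) => [eai|/eqP nai].
    rewrite (bigD1 j) /=; last by rewrite in_B -eb -eai -in_B.
    rewrite big1 ?addr0 => [|a' /andP[_ /negPf na]].
      by rewrite mxE eai (negPf ne) !eqxx mulr1.
    by rewrite mxE eai (negPf ne) eqxx na mulr0.
  rewrite (bigD1 a) //= big1 ?addr0 => [|a' /andP[_ /negPf na]].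
    by rewrite mxE (negPf naj) (negPf nai) eqxx.
  by rewrite mxE (negPf naj) (negPf nai) na.
rewrite /delta (eq_bigr _ col).
have [iB|niB] := boolP (i \in B b).
  have jB : j \in B b by rewrite in_B -eb -in_B.
  rewrite (bigD1 i) //= (bigD1 j) /= ?jB ?neji //= (negPf ne) !eqxx.
  rewrite big1 ?mulr1 ?mulVf // => a /andP[/andP[_ /negPf ->] /negPf ->] //.
apply: big1 => a aB; rewrite ifN; last first.
  by apply: contraNneq niB => eaj; rewrite in_B eb -eaj -in_B.
by rewrite ifN //; apply: contraNneq niB => <-.
Qed.

Lemma act_mon_diag g (S : {set 'I_n}) (a : 'I_n -> F) :
  (forall j, j \in S -> ext_act g (ext_gen P j) = (a j)%:MP *: ext_gen P j) ->
  ext_act g (ext_mon P S) = (\prod_(j in S) a j)%:MP *: ext_mon P S.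
Proof.
move=> gS; have monE : ext_mon P S = \prod_(j in S) ext_gen P j.
  rewrite -[LHS]ext_act_id; rewrite /ext_act ext_lift_mon.
  by apply: eq_bigr => j _; rewrite -[RHS]ext_act_id ext_actX.
rewrite {1}monE ext_act_prod (eq_bigr _ gS) scaler_prod -monE.
by rewrite rmorph_prod.
Qed.

Lemma dd_E b g (x : F) : ext_act g (Y b) = x%:MP *: Y b -> dd b g = x.
Proof. by move=> e; rewrite /dd e extZE ext_mon_self mulr1 mcoeffC eqxx mulr1. Qed.

Lemma dd_diag1 (b : nat) j w : dd b (diag1 j w) = if (bl j < b)%N then w else 1.
Proof.
apply: dd_E; rewrite (act_mon_diag (a := fun i => if i == j then w else 1)) => [|i _]; last first.
  rewrite ext_actX /ext_act_gen (bigD1 i) //= diag1E eqxx big1 ?addr0 //.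
  by move=> i' /negPf ne; rewrite diag1E ne mpolyC0 scale0r.
congr (_%:MP *: _); rewrite -in_J; case: ifP => jJ.
  by rewrite (bigD1 j) //= eqxx big1 ?mulr1 // => i /andP[_ /negPf->].
by apply: big1 => i iJ; case: eqP => // eij; rewrite -eij iJ in jJ.
Qed.

Lemma delta_diag1 (b : nat) j w : delta b (diag1 j w) = if bl j == b :> nat then w else 1.
Proof.
have col a : a \in B b -> \sum_(i in B b) diag1 j w i a = if a == j then w else 1.
  move=> aB; rewrite (bigD1 a) //= diag1E eqxx big1 ?addr0 // => i /andP[_ /negPf ne].
  by rewrite diag1E ne.
rewrite /delta (eq_bigr _ col) -in_B; case: ifP => jB.
  by rewrite (bigD1 j) //= eqxx big1 ?mulr1 // => i /andP[_ /negPf->].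
by apply: big1 => i iB; case: eqP => // eij; rewrite -eij iB in jB.
Qed.

Lemma dd_swap (b : nat) i j w : i != j -> bl i = bl j -> w != 0 ->
  dd b (swapmx i j w) = if (bl i < b)%N then -1 else 1.
Proof.
move=> ne eb w0; have neji : (j == i) = false by rewrite eq_sym (negPf ne).
set g := swapmx i j w.
have gy a : ext_act g (ext_gen P a) = if a == j then w%:MP *: ext_gen P i
    else if a == i then (w^-1)%:MP *: ext_gen P j else ext_gen P a.
  rewrite ext_actX ext_act_genE -!lform_evec.
  have e (x : F) a' : x%:MP *: lform (evec P a') = lform (fun i0 => (x * (i0 == a')%:R)%:MP).
    rewrite /lform scaler_sumr; apply: eq_bigr => a'' _; rewrite scalerA mpolyCM; congr (_ * _ *: _).
    by rewrite /evec; case: eqP.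
  rewrite !e; case: (a =P j) => [->|/eqP naj]; last case: (a =P i) => [->|/eqP nai].
  - by apply: eq_lform => a'; rewrite mxE eqxx.
  - by apply: eq_lform => a'; rewrite mxE (negPf ne) eqxx.
  by apply: eq_lform => a'; rewrite mxE (negPf naj) (negPf nai) /evec; case: eqP; rewrite ?mpolyC1 ?mpolyC0.
have gS (S : {set 'I_n}) : i \notin S -> j \notin S -> ext_act g (ext_mon P S) = ext_mon P S.
  move=> niS njS; rewrite (act_mon_diag (a := fun=> 1)) ?big1 ?mpolyC1 ?scale1r // => a aS.
  rewrite gy ifN; last by apply: contraNneq njS => <-.
  by rewrite ifN ?mpolyC1 ?scale1r //; apply: contraNneq niS => <-.
apply: dd_E; rewrite -in_J; case: ifP => iJ; last first.
  by rewrite gS ?mpolyC1 ?scale1r // ?iJ // in_J -eb -in_J iJ.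
have jJ : j \in J b by rewrite in_J -eb -in_J.
pose S := J b :\ i :\ j.
have niS : i \notin S by rewrite !inE eqxx andbF.
have njS : j \notin S by rewrite !inE eqxx.
have eJ : J b = i |: (j |: S) by rewrite /S setD1K ?setD1K // in_setD1 neji.
have ni : i \notin j |: S by rewrite in_setU1 (negPf ne).
rewrite mpolyCN mpolyC1 /Y eJ.
apply: (swap_mon (w := w%:MP) (w' := (w^-1)%:MP) (ext_actZ g) (ext_actM g) _ _ _ _ (gS _ niS njS) ni njS).
- by move=> s s'; rewrite rmorphM !rmorphXn rmorphN1.
- by rewrite gy (negPf ne) eqxx.
- by rewrite gy eqxx.
by rewrite -mpolyCM mulVf.
Qed.

(** * Divisibility of polynomial semi-invariants by an explicit product of linear forms *)

Section Generator.
Variables (tt : 'I_l -> nat) (ee : 'I_l -> bool).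
Hypothesis tt_lt : forall b, ~~ gl b -> (tt b < r b)%N.

Let N (i : 'I_n) : nat := if gl (bl i) then (q.-2 * ee (bl i))%N else tt (bl i).
Let FG : P := \prod_b Fac b (tt b) (ee b).
Let KG g : F := \prod_b kappa b (tt b) (ee b) g.

Lemma act_FG g : g \in G -> poly_act g FG = KG g *: FG.
Proof.
move=> gG; rewrite rmorph_prod /= (eq_bigr _ (fun b _ => act_Fac b (tt b) (ee b) gG)).
by rewrite scaler_prod.
Qed.

Lemma KG_neq0 g : g \in G -> KG g != 0.
Proof. by move=> gG; apply/prodf_neq0 => b _; apply: kappa_neq0. Qed.

Variable w_ : 'I_l -> F.
Hypothesis w_prim : forall b, (r b).-primitive_root (w_ b).

Lemma q_gt1 : (1 < q)%N. Proof. exact: finRing_gt1. Qed.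

Lemma KG_diag1 j : KG (diag1 j (w_ (bl j))) = w_ (bl j) ^+ N j.
Proof.
set b := bl j; set w := w_ b.
have w0 : w != 0 := root_neq0 (r_gt0 _) (prim_expr_order (w_prim b)).
rewrite /KG (bigD1 b) //= big1 ?mulr1 => [|b' /negPf ne].
  rewrite /kappa /N -/b !dd_diag1 delta_diag1 -/b eqxx ltnn leqnn divr1 div1r.
  by case: ifP => // _; rewrite mulfV // expr1n mulr1.
have neb : (b == b' :> nat) = false by rewrite val_eqE eq_sym.
rewrite /kappa !dd_diag1 delta_diag1 -/b neb ltnS leq_eqVlt neb /=.
have e1 : (if (b < b')%N then w else 1) / (if (b < b')%N then w else 1) = 1 :> F.
  by rewrite divff //; case: ifP; rewrite ?oner_eq0.
by rewrite e1 mulr1 !expr1n mulr1 if_same.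
Qed.

Lemma KG_swap i j w : i != j -> bl i = bl j -> ~~ gl (bl j) -> w ^+ r (bl j) = 1 ->
  ee (bl j) -> KG (swapmx i j w) = -1.
Proof.
move=> ne eb nb wr eeb; set b := bl j.
have w0 : w != 0 := root_neq0 (r_gt0 _) wr.
rewrite /KG (bigD1 b) //= big1 ?mulr1 => [|b' /negPf nb'].
  rewrite /kappa (negPf nb) !dd_swap // delta_swap // eb ltnn leqnn eeb expr1n !mul1r.
  by rewrite invrN1.
have neb : (b == b' :> nat) = false by rewrite val_eqE eq_sym.
rewrite /kappa !dd_swap // delta_swap // eb -/b ltnS leq_eqVlt neb /=.
have e1 : (if (b < b')%N then -1 else 1) / (if (b < b')%N then -1 else 1) = 1 :> F.
  by rewrite divff //; case: ifP; rewrite ?oppr_eq0 oner_eq0.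
by rewrite e1 mulr1 !expr1n mulr1 if_same.
Qed.

Variable h : P.
Hypothesis act_h : forall g, g \in G -> poly_act g h = KG g *: h.

Lemma mdvd_h_act g (a : P) : g \in G -> mdvd a h -> mdvd (poly_act g a) h.
Proof.
move=> gG /(mdvd_act g); rewrite act_h // => /(mdvd_mull ((KG g)^-1)%:MP).
by rewrite mul_mpolyC scalerA mulVf ?KG_neq0 // scale1r.
Qed.

(* The substitution x_j |-> x_j + lin c belongs to G. *)
Definition shift_ok j c := low (cut (bl j)) c \/ gl (bl j) /\ low j c.

Lemma shift_okP j c : shift_ok j c -> low j c.
Proof. by case=> [lc|[] //]; apply: lowW lc; rewrite leqNgt ltn_cut ltnn. Qed.

Lemma shift_cond j c : shift_ok j c ->
  forall i i', c 0 i != 0 -> (delta_mx 0 j : 'rV[F]_n) 0 i' != 0 ->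
  (bl i < bl i')%N || (bl i == bl i') && gl (bl i').
Proof.
move=> ok i i' ci; rewrite mxE eqxx /=; case: (i' =P j) => [-> _|_]; last by rewrite eqxx.
case: ok => [/lowP lc|[gj /lowP lc]].
  by rewrite -ltn_cut ltnNge; apply/orP; left; apply: contra ci => /lc->.
have : (i < j)%N by rewrite ltnNge; apply: contra ci => /lc->.
by move/ltnW/bl_mono; rewrite leq_eqVlt gj andbT val_eqE orbC.
Qed.

Lemma shift_G j c : shift_ok j c -> tvmx c (delta_mx 0 j) \in G.
Proof.
move=> ok; apply: tvmx_G (shift_cond ok); rewrite (bigD1 j) //= big1 ?addr0 => [|i /negPf ne].
  by have /lowP -> := shift_okP ok; rewrite ?mulr0.
by rewrite mxE ne andbF mul0r.
Qed.

(** The torus element at j forces the power of x_j ([diag1_adic]); a transvection of G moves x_j to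
    the other forms of its orbit. *)
Lemma h_dvd_lin j c : shift_ok j c -> mdvd (lin (delta_mx 0 j + c) ^+ N j) h.
Proof.
move=> ok; have Xh : mdvd ('X_j ^+ N j) h.
  have wp := w_prim (bl j).
  have dG : diag1 j (w_ (bl j)) \in G by apply/diag1_G/prim_expr_order.
  apply: (diag1_adic wp); last by rewrite act_h // KG_diag1.
  rewrite /N; case: ifP => [gb|/negbT/tt_lt //].
  rewrite (r_gl gb); have := q_gt1; case: (ee _); lia.
have := mdvd_h_act (shift_G ok) Xh; rewrite rmorphXn /= tvmxX mxE !eqxx scale1r.
by rewrite linearD /= lin_delta.
Qed.

(** The reflection multiplies h by -1 and is trivial modulo its root form, so that form divides 2h.
    Here 2 is invertible because the block has two distinct indices. *)
Lemma h_dvd_swap (i j : 'I_n) w c : (j < i)%N -> bl j = bl i -> ~~ gl (bl i) -> w ^+ r (bl i) = 1 ->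
  ee (bl i) -> low (cut (bl i)) c -> mdvd (lin (delta_mx 0 i + (c - w *: delta_mx 0 j))) h.
Proof.
move=> ji eb nb wr eeb lc; have ne : j != i by rewrite neq_ltn ji.
have gG := swapmx_G ne eb wr; set g := swapmx j i w in gG.
have w0 : w != 0 := root_neq0 (r_gt0 _) wr.
have two : 2%:R != 0 :> F by apply: (two_neq0 (i := i) (j := j)); rewrite // eq_sym.
have dh : mdvd (lin (delta_mx 0 i - w *: delta_mx 0 j)) h.
  have : mdvd (lin (delta_mx 0 i - w *: delta_mx 0 j)) (poly_act g h - h).
    apply: poly_act_congr => a; rewrite swapmxX // linearB linearZ /= !lin_delta.
    case: (a =P i) => [->|_]; first by exists (-1); rewrite mulN1r opprB.
    case: (a =P j) => [->|_]; last by rewrite subrr; apply: mdvd0.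
    exists (w^-1)%:MP; rewrite mul_mpolyC scalerBr scalerA mulVf // scale1r //.
  rewrite act_h // (KG_swap ne eb nb wr eeb) scaleN1r -opprD => /mdvdN; rewrite opprK.
  have e : (2%:R^-1)%:MP * (h + h) = h.
    by rewrite mul_mpolyC scalerDr -scalerDl -mulr2n -(mulr_natr (2%:R^-1)) mulVf // scale1r.
  by move/(mdvd_mull (2%:R^-1)%:MP); rewrite e.
have ok : shift_ok i c by left.
have := mdvd_h_act (shift_G ok) dh.
have -> : poly_act (tvmx c (delta_mx 0 i)) (lin (delta_mx 0 i - w *: delta_mx 0 j)) =
    'X_i + lin c - w *: 'X_j.
  rewrite linearB linearZ /= !lin_delta rmorphB /= poly_actZ !tvmxX !mxE !eqxx (negPf ne).
  by rewrite scale1r scale0r addr0.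
suff -> : lin (delta_mx 0 i + (c - w *: delta_mx 0 j)) = 'X_i + lin c - w *: 'X_j by [].
by rewrite linearD linearB linearZ /= !lin_delta addrA.
Qed.

(** Remembers by labels (i, c) which forms x_i + [lin c] occur. With c low these forms are monic at
    i, so two products with disjoint label sets are coprime ([ipl_cop]). *)
Inductive is_prod_lin (Q : 'I_n -> 'rV[F]_n -> Prop) : P -> Prop :=
| IPL1 : is_prod_lin Q 1
| IPLM (i : 'I_n) c p : low i c -> Q i c -> is_prod_lin Q p -> is_prod_lin Q (lin (delta_mx 0 i + c) * p).

Lemma ipl_mul Q p p' : is_prod_lin Q p -> is_prod_lin Q p' -> is_prod_lin Q (p * p').
Proof.
move=> + ip'; elim=> [|i c p2 lc Qc _ IH]; first by rewrite mul1r.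
by rewrite -mulrA; apply: IPLM.
Qed.

Lemma ipl_exp Q p m : is_prod_lin Q p -> is_prod_lin Q (p ^+ m).
Proof. by move=> ip; elim: m => [|m IH]; [apply: IPL1 | rewrite exprS; apply: ipl_mul]. Qed.

Lemma ipl_prod Q (I : Type) (s : seq I) (R : pred I) (f : I -> P) :
  (forall i, R i -> is_prod_lin Q (f i)) -> is_prod_lin Q (\prod_(i <- s | R i) f i).
Proof. by move=> If; apply: big_ind => //; [apply: IPL1 | apply: ipl_mul]. Qed.

Lemma ipl_lin (Q : 'I_n -> 'rV[F]_n -> Prop) (i : 'I_n) c : low i c -> Q i c ->
  is_prod_lin Q (lin (delta_mx 0 i + c)).
Proof. by move=> lc Qc; rewrite -[lin _]mulr1; apply: IPLM => //; apply: IPL1. Qed.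

Lemma low_monic (i : 'I_n) c : low i c -> monic_at (delta_mx 0 i + c) i.
Proof.
move=> /lowP lc; rewrite /monic_at !mxE !eqxx lc // addr0 eqxx /=; apply/forallP=> j.
apply/implyP=> ij; rewrite !mxE lc ?(ltnW ij) // addr0 eqxx /=.
by rewrite -val_eqE /= gtn_eqF ?eqxx.
Qed.

Lemma shift_lin_cop (i : 'I_n) c (i' : 'I_n) c' : low i c -> low i' c' -> ~ (i = i' /\ c = c') ->
  cop (lin (delta_mx 0 i + c)) (lin (delta_mx 0 i' + c')).
Proof.
move=> lc lc' ne; apply: monic_lin_cop (low_monic lc) (low_monic lc') _.
apply/eqP=> /rowP e; apply: ne.
have ii' : i = i'.
  have [ii|ii|/val_inj //] := ltngtP i i'.
    have /eqP := e i'; rewrite !mxE !eqxx /= (lowP _ _ lc) ?(ltnW ii) // (lowP _ _ lc') //.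
    by rewrite -val_eqE /= gtn_eqF // !addr0 eq_sym oner_eq0.
  have /eqP := e i; rewrite !mxE !eqxx /= (lowP _ _ lc) // (lowP _ _ lc') ?(ltnW ii) //.
  by rewrite -val_eqE /= gtn_eqF // !addr0 oner_eq0.
split=> //; apply/rowP=> a; have := e a.
by rewrite !mxE ii' => /addrI.
Qed.

Lemma ipl_cop (Q Q' : 'I_n -> 'rV[F]_n -> Prop) p p' : is_prod_lin Q p -> is_prod_lin Q' p' ->
  (forall i c, Q i c -> Q' i c -> False) -> cop p p'.
Proof.
move=> + + QQ'; elim=> [|i c p1 lc Qc _ IH] ip'; first exact: cop1l.
apply: copMl; last exact: IH.
elim: ip' => [|i' c' p2 lc' Qc' _ IH']; first exact: cop1.
apply: copM IH'; apply: shift_lin_cop => // -[ei ec]; apply: (QQ' i c) => //.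
by rewrite ei ec.
Qed.

(** Labels of the factors of [FG]: diagonal pairs for the powers of orbit products, pairs j < i in
    one block for the Vandermonde factors. *)
Let Pp (ij : 'I_n * 'I_n) : bool :=
  (ij.1 == ij.2) || [&& (ij.2 < ij.1)%N, bl ij.2 == bl ij.1, ~~ gl (bl ij.1) & ee (bl ij.1)].
Let H1 (i : 'I_n) : P := if gl (bl i) then Lam F i else z i.
Let H (ij : 'I_n * 'I_n) : P :=
  if ij.1 == ij.2 then H1 ij.1 ^+ N ij.1 else tz ij.1 - tz ij.2.
Let QH (ij : 'I_n * 'I_n) (i : 'I_n) (c : 'rV[F]_n) : Prop := i = ij.1 /\
  if ij.1 == ij.2 then shift_ok i c
  else c 0 ij.2 <> 0 /\ forall a, a != ij.2 -> bl a = bl ij.1 -> c 0 a = 0.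

Let okb (i : 'I_n) : pred 'rV[F]_n := fun c => if gl (bl i) then low i c else low (cut (bl i)) c.

Lemma okbP i c : okb i c -> shift_ok i c.
Proof. by rewrite /okb /shift_ok; case: ifP => gi lc; [right | left]. Qed.

Lemma H1E i : H1 i = \prod_(c | okb i c) lin (delta_mx 0 i + c).
Proof.
rewrite /H1 /okb; case: ifP => _; rewrite /Lam /z /FM;
  by apply: eq_bigr => c _; rewrite linearD /= lin_delta.
Qed.

Lemma H2E (i j : 'I_n) : (j < i)%N -> bl j = bl i -> ~~ gl (bl i) ->
  tz i - tz j = \prod_(ac : 'I_(r (bl i)) * 'rV[F]_n | low (cut (bl i)) ac.2)
    lin (delta_mx 0 i + (ac.2 - w_ (bl i) ^+ ac.1 *: delta_mx 0 j)).
Proof.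
move=> ji eb nb; rewrite /tz eb -(prod_root_lin _ _ (r_gt0 _) (w_prim (bl i))).
rewrite -(pair_big_dep xpredT (fun _ c => low (cut (bl i)) c) (fun (a : 'I_(r (bl i))) c =>
  lin (delta_mx 0 i + (c - w_ (bl i) ^+ a *: delta_mx 0 j)))) /=.
apply: eq_bigr => a _; set x := w_ (bl i) ^+ a.
have -> : z i - x *: z j = FM (cut (bl i)) ('X_i - x *: 'X_j).
  rewrite -!scaleNr (FMD ch_prime cardF) ?cut_leq // (FMZ ch_prime cardF) ?cut_leq //.
  by rewrite /z eb.
apply: eq_bigr => c _.
have linZ : lin (x *: delta_mx 0 j) = x *: 'X_j by rewrite linearZ /= lin_delta.
have -> : lin (delta_mx 0 i + (c - x *: delta_mx 0 j)) =
    lin (delta_mx 0 i) + (lin c - lin (x *: delta_mx 0 j)) by rewrite -linearB -linearD.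
by rewrite linZ lin_delta [RHS]addrA [LHS]addrAC.
Qed.

Lemma low_swap (i j : 'I_n) c (w : F) : (j < i)%N -> low (cut (bl i)) c -> low i (c - w *: delta_mx 0 j).
Proof.
move=> ji lc; apply: lowD.
  by apply: lowW lc; rewrite leqNgt ltn_cut ltnn.
by rewrite lowN; apply: lowZ; rewrite low_delta.
Qed.

Lemma H_ipl ij : Pp ij -> is_prod_lin (QH ij) (H ij).
Proof.
case: ij => i j; rewrite /Pp /H /QH /=; case: (i =P j) => [_ _|/eqP ne /= /and4P[ji /eqP eb nb _]].
  apply: ipl_exp; rewrite H1E; apply: ipl_prod => c /okbP ok.
  by apply: ipl_lin => //; apply: shift_okP.
rewrite H2E //; apply: ipl_prod => -[a c] /= lc; apply: ipl_lin; first exact: low_swap.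
have /lowP lc' := lc.
have c0 a' : bl a' = bl i -> c 0 a' = 0 by move=> ea; rewrite lc' // leqNgt ltn_cut ea ltnn.
split=> //; rewrite !mxE c0 // !eqxx mulr1 sub0r; split.
  apply/eqP; rewrite oppr_eq0 expf_neq0 //.
  exact: root_neq0 (r_gt0 _) (prim_expr_order (w_prim _)).
by move=> a' na ea; rewrite !mxE c0 // (negPf na) andbF mulr0 subr0.
Qed.

Lemma QH_disjoint ij ij' i c : Pp ij -> Pp ij' -> ij != ij' -> QH ij i c -> QH ij' i c -> False.
Proof.
have mix (i1 j1 : 'I_n) c1 : [&& (j1 < i1)%N, bl j1 == bl i1, ~~ gl (bl i1) & ee (bl i1)] ->
    shift_ok i1 c1 -> c1 0 j1 <> 0 -> False.
  case/and4P=> _ /eqP eb nb _ [/lowP lc|[gi _]]; last by rewrite gi in nb.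
  by apply; rewrite lc // leqNgt ltn_cut eb ltnn.
case: ij => i1 j1; case: ij' => i2 j2; rewrite /Pp /QH /= => P1 P2 ne [-> Q1] [e12 Q2].
rewrite -{}e12 in P2 ne Q2 *.
case: (i1 =P j1) P1 Q1 => [e1|_] /= P1 Q1; case: (i1 =P j2) P2 Q2 => [e2|_] /= P2 Q2.
- by rewrite -e1 -e2 eqxx in ne.
- by case: Q2 => c2 _; apply: mix P2 Q1 c2.
- by case: Q1 => c1 _; apply: mix P1 Q2 c1.
case: Q1 Q2 => c1 Q1 [c2 _]; have /and4P[_ /eqP eb2 _ _] := P2.
apply: c2; apply: Q1 => //; apply: contraNneq ne => ->; by rewrite eqxx.
Qed.

Lemma H_dvd ij : Pp ij -> mdvd (H ij) h.
Proof.
case: ij => i j; rewrite /Pp /H /=; case: (i =P j) => [_ _|/eqP ne /= /and4P[ji /eqP eb nb eei]].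
  rewrite H1E -prodrXl; apply: prod_mdvd => [|c c' _ _ ok ok' nec|c _ ok].
  - exact: index_enum_uniq.
  - apply/copX/copXl/shift_lin_cop; try exact/shift_okP/okbP.
    by case=> _ /eqP; rewrite (negPf nec).
  exact/h_dvd_lin/okbP.
rewrite H2E //; apply: prod_mdvd => [|[a c] [a' c'] _ _ /= lc lc' ne'|[a c] _ /= lc].
- exact: index_enum_uniq.
- apply: shift_lin_cop; try exact: low_swap.
  case=> _ /rowP e; case/negP: ne'.
  have c0 d a1 : low (cut (bl i)) d -> bl a1 = bl i -> d 0 a1 = 0.
    by move=> /lowP ld ea; rewrite ld // leqNgt ltn_cut ea ltnn.
  have ea : a = a'.
    have /eqP := e j; rewrite !mxE !eqxx !mulr1 !c0 // !sub0r eqr_opp.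
    rewrite (eq_prim_root_expr (w_prim _)) !modn_small ?ltn_ord //.
    by move/eqP/val_inj.
  apply/eqP; congr (_, _) => //; apply/rowP=> a1; have := e a1.
  by rewrite !mxE ea => /addIr.
have wr := prim_expr_order (w_prim (bl i)).
by apply: h_dvd_swap => //; rewrite -exprM mulnC exprM wr expr1n.
Qed.

Lemma Bq_sorted b : sorted (fun i j : 'I_n => (i < j)%N) (Bq b).
Proof.
apply: sorted_filter => [a b' c'|]; first exact: ltn_trans.
have := iota_ltn_sorted 0 n; rewrite -val_enum_ord sorted_map.
exact.
Qed.

Lemma FG_H : FG = \prod_(ij | Pp ij) H ij.
Proof.
rewrite /FG (eq_bigl (fun ij => xpredT ij.1 && Pp (ij.1, ij.2))) => [|[i j]] //.
rewrite -(pair_big_dep xpredT (fun i j => Pp (i, j)) (fun i j => H (i, j))) /=.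
rewrite (partition_big bl xpredT) //=; apply: eq_bigr => b _.
have B_bl i : (i \in B b) = (bl i == b) by rewrite in_B.
transitivity (\prod_(i in B b) (H1 i ^+ N i *
   \prod_(j : 'I_n | (j < i)%N && [&& bl j == bl i, ~~ gl (bl i) & ee (bl i)]) (tz i - tz j))).
  rewrite /Fac big_split /=; case: ifP => [gb|/negbT nb].
    rewrite -prodrXl [X in _ = _ * X]big1 ?mulr1 => [|i iB].
      apply: eq_bigr => i; rewrite B_bl /H1 /N => /eqP->; by rewrite gb.
    by apply: big_pred0 => j; move: iB; rewrite B_bl => /eqP->; rewrite gb !andbF.
  congr (_ * _).
    rewrite -prodrXl; apply: eq_bigr => i; rewrite B_bl /H1 /N => /eqP->.
    by rewrite (negPf nb).
  rewrite /Van vdm_sorted ?Bq_sorted // big_uniq ?sliceq_uniq //=.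
  case: (boolP (ee b)) => eb; rewrite ?expr1 ?expr0.
    apply: eq_big => [i|i]; first by rewrite in_Bq B_bl.
    rewrite in_Bq => /eqP/val_inj ib; rewrite -big_filter (big_uniq _ (filter_uniq _ (sliceq_uniq n (cut b) (cut b.+1)))) /=.
    by apply: eq_bigl => j; rewrite mem_filter in_Bq ib nb eb !andbT.
  rewrite big1 // => i; rewrite B_bl => /eqP->; apply: big_pred0 => j.
  by rewrite (negPf eb) !andbF.
apply: eq_big => [i|i _]; first by rewrite B_bl.
rewrite [RHS](bigD1 i) /=; last by rewrite /Pp /= eqxx.
have -> : H (i, i) = H1 i ^+ N i by rewrite /H /= eqxx.
congr (_ * _); apply: eq_big => [j|j /andP[ji _]].
  rewrite /Pp /=; case: (i =P j) => [<-|/eqP ne] /=; first by rewrite ltnn [i == i]eqxx.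
  by rewrite [j == i]eq_sym ne andbT.
by rewrite /H /= ifN // neq_ltn ji orbT.
Qed.

Lemma ipl_neq0 Q p : is_prod_lin Q p -> p != 0.
Proof.
elim=> [|i c p' lc _ _ IH]; first exact: oner_neq0.
apply: mulf_neq0 => //; rewrite lin_eq0; apply/eqP=> /rowP/(_ i)/eqP.
by rewrite !mxE !eqxx (lowP _ _ lc) // addr0 oner_eq0.
Qed.

Lemma FG_neq0 : FG != 0.
Proof. by rewrite FG_H; apply/prodf_neq0 => ij /H_ipl/ipl_neq0. Qed.

(** Each factor [H ij] splits into linear forms that the group forces to divide h, and distinct
    factors share none of them. *)
Lemma generator_dvd : mdvd FG h.
Proof.
rewrite FG_H; apply: prod_mdvd => [|ij ij' _ _ P1 P2 ne|ij _ P1].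
- exact: index_enum_uniq.
- apply: (ipl_cop (H_ipl P1) (H_ipl P2)) => i c; exact: QH_disjoint.
exact: H_dvd.
Qed.

End Generator.

Variable w_ : 'I_l -> F.
Hypothesis w_prim : forall b, (r b).-primitive_root (w_ b).
Variable s : 'I_l -> nat.
Hypothesis s_lt : forall b, ~~ gl b -> (s b < r b)%N.

Definition chi g : F := \prod_(b | ~~ gl b) delta b g ^+ s b.
Definition semi_inv (u : A) : Prop := forall g, g \in G -> ext_act g u = (chi g)%:MP *: u.

Lemma chi_neq0 g : g \in G -> chi g != 0.
Proof. by move=> gG; apply/prodf_neq0 => b nb; rewrite expf_neq0 ?delta_neq0. Qed.

Lemma semi_inv_D u v : semi_inv u -> semi_inv v -> semi_inv (u + v).
Proof. by move=> Xu Xv g gG; rewrite ext_actD Xu // Xv // scalerDr. Qed.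

Lemma semi_inv_0 : semi_inv 0.
Proof. by move=> g gG; rewrite -(scale0r 1) ext_actZ rmorph0 !scale0r scaler0. Qed.

Lemma semi_inv_N u : semi_inv u -> semi_inv (- u).
Proof.
move=> Xu g gG; have e : ext_act g (- u) = - ext_act g u.
  by apply/eqP; rewrite -addr_eq0 -ext_actD addNr; apply/eqP/ext_act0.
by rewrite e Xu // scalerN.
Qed.

Lemma semi_inv_qout b js u : semi_inv u -> semi_inv (qout (fun j => ctr (Zv F (cut b) j)) js u).
Proof.
move=> Xu g gG; rewrite act_qout => [|j i]; last exact: Zv_act.
by rewrite Xu // qout_ctrZ.
Qed.

(* The support of y_(J b) times the augmentation ideal of E[y_j, j in B b]. *)
Definition Nsupp (b : nat) : pred {set 'I_n} :=
  fun T => [&& J b \subset T, T \subset J b.+1 & T != J b].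

Definition Nfam (b : nat) (w : {set 'I_n} -> A) (K : {set 'I_n}) : A :=
  if (K \subset B b) && (K != set0) then w K else 0.

(** What one block contributes: members with the right character, spanning of the semi-invariants
    over P, and generic spanning of everything. The last clause feeds [rlspan_free]. *)
Definition level_data (b : nat) (w : {set 'I_n} -> A) : Prop :=
  [/\ forall K : {set 'I_n}, semi_inv (Nfam b w K),
      forall u, supp (Nsupp b) u -> semi_inv u -> lspan (Nfam b w) u
    & forall u, supp (Nsupp b) u -> rlspan (Nfam b w) u].

Lemma chi_tvmx c d :
  (forall i j, c 0 i != 0 -> d 0 j != 0 -> (bl i < bl j)%N || (bl i == bl j) && gl (bl j)) ->
  chi (tvmx c d) = 1.
Proof. by move=> cd; apply: big1 => b nb; rewrite delta_tvmx // expr1n. Qed.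

Lemma semi_inv_tvmx u c d : semi_inv u -> \sum_i d 0 i * c 0 i = 0 ->
  (forall i j, c 0 i != 0 -> d 0 j != 0 -> (bl i < bl j)%N || (bl i == bl j) && gl (bl j)) ->
  edvd (lin c) (lform (cvec c) * ctr (cvec d) u).
Proof.
move=> Xu dc cd; apply: tvmx_inv.
by rewrite Xu ?tvmx_G // chi_tvmx // mpolyC1 scale1r.
Qed.

Lemma cvec_delta j : cvec (delta_mx 0 j) =1 evec P j.
Proof. by move=> i; rewrite /cvec /evec mxE eqxx /=; case: eqP; rewrite ?mpolyC1 ?mpolyC0. Qed.

Lemma eq_ctr (X X' : 'I_n -> P) u : X =1 X' -> ctr X u = ctr X' u.
Proof.
by move=> e; apply/ffunP=> T; rewrite !ctrE; apply: eq_bigr => i _; rewrite e.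
Qed.

Lemma dot_cvec_Zv c (b : nat) j : dot (cvec c) (Zv F (cut b) j) = FM (cut b) (lin c) ^+ (q ^ (j - cut b)).
Proof.
rewrite -(Zvec_lin ch_prime cardF) ?cut_leq //; apply: eq_bigr => i _.
by rewrite mul_mpolyC.
Qed.

Lemma lin_dvd_Zv c (b : nat) j : mdvd (lin c) (dot (cvec c) (Zv F (cut b) j)).
Proof.
rewrite dot_cvec_Zv; have q0 : (0 < q ^ (j - cut b))%N by rewrite expn_gt0 (ltnW q_gt1).
rewrite -(prednK q0) exprS; apply: mdvd_mulr.
by rewrite /FM (bigD1 0) ?low0 //= linear0 addr0; apply/mdvd_mulr/mdvdd.
Qed.

Lemma Lam_prod_dvd (S : {set 'I_n}) p :
  (forall (i : 'I_n) c, i \in S -> low i c -> mdvd (lin (delta_mx 0 i + c)) p) ->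
  mdvd (\prod_(i in S) Lam F i) p.
Proof.
move=> dvd_a; apply: prod_mdvd => [|i i' _ _ iJ i'J ne|i _ iJ].
- exact: index_enum_uniq.
- rewrite /Lam /FM; apply: cop_prod => c lc; apply: cop_prodl => c' lc'.
  rewrite -!lin_delta -!linearD; apply: shift_lin_cop => //.
  by case=> /eqP; rewrite (negPf ne).
rewrite /Lam /FM; apply: prod_mdvd => [|c c' _ _ lc lc' ne|c _ lc].
- exact: index_enum_uniq.
- rewrite -!lin_delta -!linearD; apply: shift_lin_cop => //.
  by case=> _ /eqP; rewrite (negPf ne).
by rewrite -lin_delta -linearD; apply: dvd_a.
Qed.

Lemma Zv0_act j i g : g \in G ->
  poly_act g (Zv F 0 j i) = \sum_i' (g i' i)%:MP * Zv F 0 j i'.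
Proof. by move=> gG; have := Zv_act 0 j i gG; rewrite cut0. Qed.

Lemma J_sub (b : nat) : J b \subset J b.+1.
Proof. by rewrite J_B subsetUr. Qed.

Lemma supp_YM (b : nat) u : supp (fun T => T \subset J b.+1) u ->
  supp (fun T => (J b \subset T) && (T \subset J b.+1)) (Y b * u).
Proof.
move=> su; apply: suppW (supp_mulmon (S := J b) su) => T /andP[JT TJ]; rewrite JT /=.
by rewrite -(setID T (J b)) subUset TJ andbT (subset_trans _ (J_sub b)) // subsetIr.
Qed.

(** * Divisibility by the Moore determinant of the earlier blocks *)

Section StepOne.
Variable b : nat.
Variable u : A.
Hypothesis Xu : semi_inv u.
Variable js : seq 'I_n.

Let U : A := Y b * qin (fun j => ctr (Zv F 0 j)) js u.

(** For j in T and in block b, and any form [lin a] in the variables of earlier blocks, G contains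
    the transvection adding [lin a] to x_j. Its invariance relation makes [lin a] divide the
    coefficient, and such forms multiply up to [Del b]. *)
Lemma stepone_coef T : supp (fun T => T \subset J b.+1) u -> Nsupp b T -> mdvd (Del b) (U T).
Proof.
move=> su /and3P[JT TJ neT].
have [j jT jB] : exists2 j, j \in T & j \in B b.
  move: neT; rewrite eqEsubset JT andbT => /subsetPn[j jT njJ]; exists j => //.
  by have := subsetP TJ j jT; rewrite J_B in_setU (negPf njJ) orbF.
have njJ : j \notin J b by have /disjointFr -> := disjoint_BJ b.
have dvd_a (i : 'I_n) c : i \in J b -> low i c -> mdvd (lin (delta_mx 0 i + c)) (U T).
  move=> iJ lc; set a := delta_mx 0 i + c.
  have a_low (i' : 'I_n) : (cut b <= i')%N -> a 0 i' = 0.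
    move=> bi'; have ii' : (i < i')%N by apply: leq_trans bi'; move: iJ; rewrite inE.
    have nei : (i' == i) = false by rewrite -val_eqE /= gtn_eqF.
    by rewrite !mxE (lowP _ _ lc) ?(ltnW ii') // nei andbF addr0.
  have ai : cvec a i = 1 by rewrite /cvec !mxE !eqxx (lowP _ _ lc) // addr0 mpolyC1.
  have Ja : ext_mon P (J b) * lform (cvec a) = 0.
    have -> : 0 = ext_mon P (J b) * lform (fun=> 0 : P).
      by rewrite /lform big1 ?mulr0 // => i' _; rewrite scale0r.
    apply: meq_lform => i'; rewrite inE /= -leqNgt => /a_low e.
    by rewrite /cvec e mpolyC0.
  apply: (edvd_mon_coef ai Ja njJ jT).
  have := @semi_inv_tvmx u a (delta_mx 0 j) Xu.
  rewrite (eq_ctr _ (cvec_delta j)) => H.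
  rewrite ctr_qin -scalerAr; apply/edvdZ/edvd_lform_qin.
    by move=> j' _; have := lin_dvd_Zv a 0 j'; rewrite cut0.
  have aj : a 0 j = 0 by apply: a_low; move: jB; rewrite inE => /andP[].
  apply: H => [|i1 i2 ai1].
    rewrite (bigD1 j) //= aj mulr0 add0r big1 // => i1 /negPf ne.
    by rewrite mxE ne andbF mul0r.
  rewrite mxE eqxx /=; case: (i2 =P j) => [-> _|_]; last by rewrite eqxx.
  have : i1 \in J b by rewrite inE /= ltnNge; apply: contra ai1 => /a_low->.
  by rewrite in_J; move: jB; rewrite in_B => /eqP-> ->.
exact: Lam_prod_dvd.
Qed.

End StepOne.


Definition cF (b : 'I_l) g : F := if gl b then 1 else delta b g ^+ s b.
Definition chi' (b0 : 'I_l) g : F := \prod_(b | b != b0) cF b g.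
(* These exponents make the characters of the factors with b < b0 telescope to  *)
(* (dd b0)^-1, up to the part of [chi] they carry.                            *)
Definition tau (b0 b : 'I_l) : nat :=
  if (b < b0)%N then (if s b == 0%N then (r b).-1 else (s b).-1) else s b.
Definition rest (b0 : 'I_l) : P := \prod_(b | b != b0) Fac b (tau b0 b) (b < b0)%N.
(** Generates the polynomials with character [chi' * dX / dd b0.+1]: it cancels the determinant
    carried by [Y b0.+1] and supplies the part of chi from the other blocks. *)
Definition FF (b0 : 'I_l) (v : nat) : P := Fac b0 v true * rest b0.
(** The exponent is v + 1 because the Vandermonde factor contributes one more [delta]. *)
Definition dX (b0 : 'I_l) (v : nat) g : F := if gl b0 then 1 else delta b0 g ^+ v.+1.

Lemma chiE b0 g : chi g = cF b0 g * chi' b0 g.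
Proof.
rewrite /chi big_mkcond /= (bigD1 b0) //= /cF; congr (_ * _); first by case: (gl b0).
by apply: eq_bigr => b _; rewrite /cF; case: (gl b).
Qed.

Lemma dd_tele (m : nat) g : g \in G -> (m <= l)%N ->
  \prod_(b : 'I_l | (b < m)%N) (dd b g / dd b.+1 g) = (dd m g)^-1.
Proof.
move=> gG; elim: m => [|m IH] ml; first by rewrite big_pred0 // dd0 invr1.
rewrite (bigD1 (Ordinal ml)) //= (eq_bigl (fun b : 'I_l => (b < m)%N)) => [|b].
  by rewrite IH 1?ltnW // mulrAC mulfV ?mul1r ?dd_neq0.
by rewrite -val_eqE /= [in RHS]ltn_neqAle andbC ltnS.
Qed.

Lemma pow_q2 (x : F) : x != 0 -> x ^+ q.-2 = x^-1.
Proof.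
move=> x0; apply: (mulIf x0); rewrite mulVf //; apply: (mulIf x0).
have e : q = q.-2.+2 by have := q_gt1; case: q => [|[]].
by rewrite mul1r -!exprSr -e expf_card.
Qed.

Lemma kappa_true (b : 'I_l) (v : nat) g : g \in G -> kappa b v true g = dX b v g * (dd b g / dd b.+1 g).
Proof.
move=> gG; rewrite /kappa /dX muln1 expr1; case: ifP => gb; last by rewrite exprSr mulrA.
by rewrite mul1r pow_q2 ?mulf_neq0 ?invr_neq0 ?dd_neq0 // invf_div.
Qed.

Lemma kappa_false (b : 'I_l) (v : nat) g : kappa b v false g = if gl b then 1 else delta b g ^+ v.
Proof. by rewrite /kappa muln0 !expr0 mulr1. Qed.

Lemma dX_tau (b0 b : 'I_l) g : g \in G -> (b < b0)%N -> dX b (tau b0 b) g = cF b g.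
Proof.
move=> gG bb; rewrite /dX /cF /tau bb; case: ifP => // /negbT nb; case: eqP => [->|/eqP sb].
  by rewrite prednK ?r_gt0 // deltaX.
by rewrite prednK // lt0n.
Qed.

Lemma kappa_tau (b0 b : 'I_l) g : g \in G -> kappa b (tau b0 b) (b < b0)%N g =
  cF b g * (if (b < b0)%N then dd b g / dd b.+1 g else 1).
Proof.
move=> gG; case: ifP => bb; first by rewrite kappa_true // dX_tau.
by rewrite kappa_false mulr1 /cF /tau bb.
Qed.

Lemma prod_kappa_tau (b0 : 'I_l) g : g \in G ->
  \prod_(b | b != b0) kappa b (tau b0 b) (b < b0)%N g = chi' b0 g / dd b0 g.
Proof.
move=> gG; rewrite (eq_bigr _ (fun b _ => kappa_tau b0 b gG)) big_split /=; congr (_ * _).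
rewrite -big_mkcondr /= -(dd_tele gG (ltnW (ltn_ord b0))); apply: eq_bigl => b.
by rewrite ltn_neqAle -val_eqE andbA andbb.
Qed.

Lemma act_rest b0 g : g \in G -> poly_act g (rest b0) = (chi' b0 g / dd b0 g) *: rest b0.
Proof.
move=> gG; rewrite rmorph_prod /= (eq_bigr _ (fun b _ => act_Fac b (tau b0 b) (b < b0)%N gG)).
by rewrite scaler_prod prod_kappa_tau.
Qed.

Lemma act_FF b0 (v : nat) g : g \in G ->
  poly_act g (FF b0 v) = (chi' b0 g * dX b0 v g / dd b0.+1 g) *: FF b0 v.
Proof.
move=> gG; rewrite rmorphM /= act_Fac // act_rest // kappa_true //.
rewrite -!mul_mpolyC mulrACA -mpolyCM; congr (_%:MP * _).
by field; rewrite !dd_neq0.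
Qed.

Let tts b0 (v : nat) b := if b == b0 then v else tau b0 b.
Let ees (b0 b : 'I_l) := (b <= b0)%N.

Let tts_lt b0 (v : nat) : (~~ gl b0 -> (v < r b0)%N) -> forall b, ~~ gl b -> (tts b0 v b < r b)%N.
Proof.
move=> vr b nb; rewrite /tts; case: eqP => [eb|_]; first by rewrite eb vr // -eb.
rewrite /tau; case: ifP => _; last exact: s_lt.
case: ifP => _; first by rewrite ltn_predL r_gt0.
by apply: leq_ltn_trans (leq_pred _) (s_lt nb).
Qed.

Let FFE b0 (v : nat) : FF b0 v = \prod_b Fac b (tts b0 v b) (ees b0 b).
Proof.
rewrite (bigD1 b0) //= /tts /ees eqxx leqnn; congr (_ * _).
by apply: eq_bigr => b /negPf ne; rewrite ne [in RHS]leq_eqVlt val_eqE ne.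
Qed.

Lemma FF_dvd b0 (v : nat) p : (~~ gl b0 -> (v < r b0)%N) ->
  (forall g, g \in G -> poly_act g p = (chi' b0 g * dX b0 v g / dd b0.+1 g) *: p) -> mdvd (FF b0 v) p.
Proof.
move=> vr gh; rewrite FFE; apply: (generator_dvd (tts_lt vr) w_prim) => g gG; rewrite gh //.
congr (_ *: _); rewrite (bigD1 b0) //= {1}/tts {1}/ees eqxx leqnn kappa_true //.
rewrite (eq_bigr (fun b => kappa b (tau b0 b) (b < b0)%N g)) => [|b /negPf ne]; last first.
  by rewrite /tts /ees ne leq_eqVlt val_eqE ne.
by rewrite prod_kappa_tau //; field; rewrite !dd_neq0.
Qed.

Lemma FF_neq0 b0 (v : nat) : (~~ gl b0 -> (v < r b0)%N) -> FF b0 v != 0.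
Proof. by move=> vr; rewrite FFE; apply: (FG_neq0 (tts b0 v) (ees b0) w_prim). Qed.

Definition fbase : P := \prod_b Fac b (s b) false.

Let kappa_chi g : \prod_b kappa b (s b) false g = chi g.
Proof.
by rewrite /chi [RHS]big_mkcond; apply: eq_bigr => b _; rewrite kappa_false; case: (gl b).
Qed.

Lemma fbase_neq0 : fbase != 0.
Proof. exact: (FG_neq0 s (fun=> false) w_prim). Qed.

Lemma fbase_semi_inv : semi_inv fbase%:A.
Proof.
move=> g gG; rewrite ext_actA (act_FG s (fun=> false) gG) kappa_chi.
by rewrite scalerA mul_mpolyC.
Qed.

Lemma fbase_dvd p : semi_inv p%:A -> mdvd fbase p.
Proof.
move=> Xp; apply: (generator_dvd s_lt w_prim) => g gG; rewrite kappa_chi.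
by have := Xp g gG; rewrite ext_actA scalerA => /alg_inj; rewrite mul_mpolyC.
Qed.

Lemma card_neq_act g m u : supp (fun T => #|T| != m) u -> supp (fun T => #|T| != m) (ext_act g u).
Proof.
move=> du; rewrite [u]ext_sum_mon ext_act_sum; apply: supp_sum => S _.
rewrite ext_actZ; have [->|uS] := eqVneq (u S) 0.
  by rewrite rmorph0 scale0r; apply: supp0.
apply: suppZ; have lt := du S uS.
by apply: (suppW _ (@exhom_act_mon n F g S)) => T /eqP->.
Qed.

(** The action preserves exterior degree, and y_S is the only monomial of its degree in u, so no
    other term reaches the coefficient at S. *)
Lemma coef_act g (S : {set 'I_n}) u (d x : F) :
  ext_act g (ext_mon P S) = d%:MP *: ext_mon P S ->
  supp (fun T => (T == S) || (#|T| != #|S|)) u -> ext_act g u = x%:MP *: u ->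
  d *: poly_act g (u S) = x *: u S.
Proof.
move=> gS su gu; have [|v eU vT] := @edvd_split n P S u 1 (oner_neq0 _).
  by move=> T _; exists (u T); rewrite mulr1.
have sv : supp (fun T => #|T| != #|S|) v.
  by move=> T /vT[neT /su]; rewrite (negPf neT).
have nS (w : A) : supp (fun T => #|T| != #|S|) w -> w S = 0.
  by move=> sw; apply/eqP; apply: contraT => /sw; rewrite eqxx.
have := congr1 (fun w : A => w S) gu.
rewrite [in ext_act g u]eU scale1r ext_actD ext_actZ gS extDE (nS _ (card_neq_act sv)) add0r.
by rewrite !extZE ext_mon_self mulr1 mulrC !mul_mpolyC.
Qed.

Lemma supp_JT (b : nat) u : supp (fun T => J b \subset T) u ->
  supp (fun T => (T == J b) || (#|T| != #|J b|)) u.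
Proof.
move=> su T /su JT; case: eqP => //= neT; rewrite gtn_eqF //; apply: proper_card.
by rewrite properEneq JT andbT; apply/eqP => e; apply: neT.
Qed.

Lemma supp_TJ (b : nat) u : supp (fun T => T \subset J b) u ->
  supp (fun T => (T == J b) || (#|T| != #|J b|)) u.
Proof.
move=> su T /su JT; case: eqP => //= neT; rewrite ltn_eqF //; apply: proper_card.
by rewrite properEneq JT andbT; apply/eqP.
Qed.

Lemma semi_inv_qin b (js : seq 'I_n) u : semi_inv u -> semi_inv (qin (fun j => ctr (Zv F (cut b) j)) js u).
Proof.
move=> Xu g gG; rewrite act_qin => [|j i]; last exact: Zv_act.
by rewrite Xu // qin_ctrZ.
Qed.

Definition Jsupp (b : nat) : pred {set 'I_n} := fun T => (J b \subset T) && (T \subset J b.+1).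

Lemma Nsupp_J (b : nat) u : supp (Nsupp b) u -> supp (Jsupp b) u.
Proof. by apply: suppW => T /and3P[JT TJ _]; rewrite /Jsupp JT TJ. Qed.

Lemma Nsupp_coef (b : nat) u : supp (Nsupp b) u -> u (J b) = 0.
Proof. by move=> su; apply/eqP; apply: contraT => /su /and3P[_ _]; rewrite eqxx. Qed.

Lemma Jsupp_qin (b : nat) (js : seq 'I_n) u : supp (Jsupp b) u ->
  supp (Jsupp b) (qin (fun j => ctr (Zv F (cut b) j)) js u).
Proof.
move=> su; elim: js => //= j js IH; apply: supp_ctr IH _ => i T niT /andP[JT TJ] Zi.
rewrite /Jsupp (subset_trans _ TJ) ?subsetUr // andbT.
apply/subsetP=> i' i'J; have := subsetP JT i' i'J; rewrite in_setU1 => /orP[/eqP ei|//].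
move: Zi i'J; rewrite ei /Zv => Zi; rewrite inE /= => ib.
by rewrite Zvec_low ?eqxx in Zi.
Qed.

Lemma YB_mul (b : nat) u : supp (Jsupp b) u ->
  ext_mon P (B b) * u = ((-1) ^+ ninv (B b) (J b) * u (J b)) *: Y b.+1.
Proof.
move=> su; rewrite {1}[u]ext_sum_mon mulr_sumr (bigD1 (J b)) //= big1 ?addr0 => [|T neT].
  by rewrite -scalerAr ext_monM disjoint_BJ scalerA mulrC /Y J_B.
have [->|/su/andP[JT TJ]] := eqVneq (u T) 0; first by rewrite scale0r mulr0.
rewrite -scalerAr ext_monM ifN ?scaler0 //; apply: contra neT => dBT.
rewrite eqEsubset JT andbT; apply/subsetP=> i iT; have := subsetP TJ i iT.
by rewrite J_B in_setU => /orP[iB|//]; rewrite (disjointFr dBT iB) in iT.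
Qed.

(** * The basis members contributed by a GL block *)

Section LevelGL.
Variable b : 'I_l.
Hypothesis gb : gl b.
Local Notation Zb := (fun j => ctr (Zv F (cut b) j)).

Definition wGL (K : {set 'I_n}) : A :=
  FF b 0 *: qout Zb (filter (fun j => j \notin K) (Bq b)) (Y b.+1).

Lemma chi_GL (v : nat) g : chi' b g * dX b v g = chi g.
Proof. by rewrite (chiE b) /cF /dX gb mulr1 mul1r. Qed.

Lemma wGL_semi_inv K : semi_inv (wGL K).
Proof.
move=> g gG; rewrite ext_actZ act_FF // chi_GL act_qout => [|j i]; last exact: Zv_act.
rewrite act_Y // qout_ctrZ -mul_mpolyC !scalerA; congr (_ *: _).
rewrite mulrC mulrA -mpolyCM; congr (_%:MP * _).
by rewrite mulrC divfK ?dd_neq0.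
Qed.

(** At least one contraction is required: by anticommutation it is moved next to u and then resolved
    along vectors annihilating a, each of which gives a transvection in G. *)
Lemma coef_dvd_lin u js (i : 'I_n) c : semi_inv u -> supp (Jsupp b) u -> js != [::] ->
  i \in B b -> low i c -> mdvd (lin (delta_mx 0 i + c)) (qin Zb js u (J b)).
Proof.
case: js => // j0 js Xu su _ iB lc; set a := delta_mx 0 i + c.
have ai : a 0 i = 1 by rewrite !mxE !eqxx (lowP _ _ lc) // addr0.
have ali : cvec a i = 1 :> P by rewrite /cvec ai mpolyC1.
have a_low (i' : 'I_n) : a 0 i' != 0 -> (i' <= i)%N.
  apply: contraR; rewrite -ltnNge => ii'.
  have nei : (i' == i) = false by rewrite -val_eqE /= gtn_eqF.
  by rewrite !mxE (lowP _ _ lc) ?(ltnW ii') // nei andbF addr0.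
move: a ai ali a_low => a ai ali a_low {lc}.
have niJ : i \notin J b by have /disjointFr -> := disjoint_BJ b.
have suq : supp (fun T => J b \subset T) (qin Zb (j0 :: js) u).
  have H := @Jsupp_qin b (j0 :: js) u su.
  by move=> T /H /andP[].
apply: (edvd_super_coef ali niJ suq) => /=.
rewrite ctr_qin -scalerAr; apply/edvdZ/edvd_lform_qin => [j _|]; first exact: lin_dvd_Zv.
set Z := Zv F (cut b) j0.
(* The basis of [pivot_comb]. The coefficient along e_i is the pairing of a with Z, already
   divisible by [lin a]; the other directions give transvections, except those from earlier blocks,
   where Z vanishes. *)
pose D j : 'rV[F]_n := if j == i then delta_mx 0 i else delta_mx 0 j - a 0 j *: delta_mx 0 i.
pose co j := if j == i then dot (cvec a) Z else Z j.
have eD j m : cvec (D j) m = if j == i then evec P i m else evec P j m - cvec a j * evec P i m.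
  rewrite -!cvec_delta /D /cvec; case: (j == i) => //.
  by rewrite !mxE mpolyCB mpolyCM.
have eZ m : Z m = \sum_j co j * cvec (D j) m.
  rewrite {1}(pivot_comb Z m ali); apply: eq_bigr => j _; rewrite eD.
  by [].
rewrite (@ctr_comb n P _ _ predT co (fun j => cvec (D j)) Z u eZ) mulr_sumr.
apply: edvd_sum => j _; rewrite -scalerAr; rewrite /co /D; case: (j =P i) => [_|/eqP ji].
  by apply: edvdZl; apply: lin_dvd_Zv.
have [jb|jb] := ltnP j (cut b); first by rewrite /Z /Zv Zvec_low // scale0r; apply: edvd0.
apply: edvdZ; apply: semi_inv_tvmx => // [|i1 i2 a1].
  rewrite (bigD1 i) //= (bigD1 j) //= big1 ?addr0 => [|i' /andP[/negPf nei /negPf nej]].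
    by rewrite !mxE !eqxx (negPf ji) [i == j]eq_sym (negPf ji) ai /=; ring.
  by rewrite !mxE eqxx nei nej mulr0 subrr mul0r.
have i1b : (bl i1 <= b)%N.
  have := bl_mono (a_low _ a1); move: iB; rewrite in_B => /eqP ->.
  by [].
have [->|nei2] := eqVneq i2 i; last have [->|nej2] := eqVneq i2 j.
- move=> _; move: iB i1b; rewrite in_B leq_eqVlt => /eqP/val_inj -> .
  by rewrite gb andbT val_eqE orbC.
- rewrite !mxE !eqxx (negPf ji) mulr0 subr0 => _; move: jb; rewrite leqNgt ltn_cut -leqNgt => jb.
  have := leq_trans i1b jb; rewrite leq_eqVlt => /orP[e|->//].
  have e1 : bl i1 = b by apply/ord_inj/eqP; rewrite eqn_leq i1b (eqP e).
  by move: (e); rewrite val_eqE => /eqP <-; rewrite e1 gb eqxx orbT.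
by rewrite !mxE eqxx (negPf nei2) (negPf nej2) mulr0 subrr eqxx.
Qed.

Lemma DL_neq0 : DL b != 0.
Proof. by apply/prodf_neq0 => j _; apply: Lam_neq0. Qed.

(** The coefficient has character chi / [dd b] and is divisible by [DL b]; the quotient then has
    character chi / [dd b.+1], which is that of [FF b 0]. *)
Lemma coef_dvd_GL u js : semi_inv u -> supp (Jsupp b) u -> js != [::] ->
  exists e, qin Zb js u (J b) = DL b * (e * FF b 0).
Proof.
move=> Xu su js0; set v := qin Zb js u.
have [e ec] : mdvd (DL b) (v (J b)).
  by apply: Lam_prod_dvd => i c; apply: coef_dvd_lin.
have [||e' ee] := @FF_dvd b 0 e; last by exists e'; rewrite ec ee mulrC.
  by rewrite gb.
move=> g gG; rewrite chi_GL.
have sv : supp (fun T => J b \subset T) v.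
  have H := @Jsupp_qin b js u su.
  by move=> T /H /andP[].
have := coef_act (act_Y b gG) (supp_JT sv) (semi_inv_qin _ _ Xu gG).
rewrite -/v ec rmorphM /= act_DL // => E.
have [D0 D1] := (dd_neq0 b gG, dd_neq0 b.+1 gG).
apply: (mulIf DL_neq0); apply: (scalerI D1).
transitivity (dd b g *: (poly_act g e * ((dd b.+1 g / dd b g) *: DL b))).
  by rewrite -scalerAr scalerA mulrCA mulfV // mulr1.
by rewrite E -scalerAl scalerA mulrCA mulfV // mulr1.
Qed.

Lemma GL_engine (W : A -> Prop) u :
  (forall u v, W u -> W v -> W (u + v)) -> (forall u, W u -> W (- u)) ->
  (forall K : pred 'I_n, W (qout Zb (filter K (Bq b))
     (ext_mon P (B b) * qin Zb (filter (predC K) (Bq b)) u))) ->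
  W (DL b *: u).
Proof. exact: (moore_engine ch_prime cardF (cutS b) (cut_leq b.+1)). Qed.

Lemma GL_term u (K : pred 'I_n) : supp (Nsupp b) u ->
  let K' : {set 'I_n} := [set j in B b | ~~ K j] in
  let js := filter (predC K) (Bq b) in
  qout Zb (filter K (Bq b)) (ext_mon P (B b) * qin Zb js u) =
  ((-1) ^+ ninv (B b) (J b) * qin Zb js u (J b)) *:
     qout Zb (filter (fun j => j \notin K') (Bq b)) (Y b.+1)
  /\ (if K' == set0 then qin Zb js u (J b) = 0 else js != [::]).
Proof.
move=> su K' js; split.
  rewrite YB_mul; last by apply/Jsupp_qin/Nsupp_J.
  rewrite qout_ctrZ; congr (_ *: qout _ _ _); apply: eq_in_filter => j.
  by rewrite in_Bq -in_B => jB; rewrite [j \in K']in_set jB negbK.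
have jsK j : (j \in js) = (j \in K') by rewrite mem_filter [j \in K']in_set in_Bq -in_B andbC.
clearbody js; case: eqP => [K0|/eqP/set0Pn[j]]; last by rewrite -jsK; case: (js).
have -> : js = [::].
  by case: js jsK => // j js' /(_ j); rewrite K0 mem_head in_set0.
exact: Nsupp_coef.
Qed.

Lemma level_GL : level_data b wGL.
Proof.
split=> [K|u su Xu|u su].
- by rewrite /Nfam; case: ifP => _; [exact: wGL_semi_inv | exact: semi_inv_0].
(* Keeping the factor [DL b] explicit in each word allows it to be cancelled from their sum. *)
- pose W v := exists2 x, lspan (Nfam b wGL) x & v = DL b *: x.
  have [x Sx ex] : W (DL b *: u); last by rewrite (scaler_injE DL_neq0 ex).
  apply: GL_engine => [u1 u2 [x1 S1 ->] [x2 S2 ->]|u1 [x1 S1 ->]|K].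
  + by exists (x1 + x2); [exact: lspanD | rewrite scalerDr].
  + by exists (- x1); [exact: lspanN | rewrite scalerN].
  have [-> ] := GL_term K su; set K' := [set _ in _ | _]; set js := filter _ _.
  case: ifP => [_ ->|K0 js0].
    by exists 0; [exact: lspan0 | rewrite mulr0 scale0r scaler0].
  have [e ->] := coef_dvd_GL Xu (Nsupp_J su) js0.
  exists (((-1) ^+ ninv (B b) (J b) * e) *: Nfam b wGL K'); first exact/lspanZ/lspan_mem.
  rewrite /Nfam K0 andbT ifT; last by apply/subsetP=> j; rewrite in_set => /andP[].
  by rewrite /wGL !scalerA; congr (_ *: _); ring.
exists (FF b 0 * DL b); first by rewrite mulf_neq0 ?DL_neq0 ?FF_neq0 // gb.
rewrite mulrC -scalerA; pose W v := lspan (Nfam b wGL) (FF b 0 *: v).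
suff H : W (DL b *: u) by rewrite scalerA mulrC -scalerA.
apply: GL_engine => [u1 u2 W1 W2|u1 W1|K].
- by rewrite /W scalerDr; apply: lspanD.
- by rewrite /W scalerN; apply: lspanN.
have [-> ] := GL_term K su; set K' := [set _ in _ | _]; set js := filter _ _.
rewrite /W; case: ifP => [_ ->|K0 _].
  by rewrite mulr0 scale0r scaler0; exact: lspan0.
rewrite scalerA mulrC -scalerA; apply: lspanZ.
have := lspan_mem (Nfam b wGL) K'; rewrite /Nfam K0 andbT ifT //.
by apply/subsetP=> j; rewrite in_set => /andP[].
Qed.

End LevelGL.

(** * The basis members contributed by a monomial block *)

Section LevelMonomial.
Variable b : 'I_l.
Hypothesis nb : ~~ gl b.

Definition rho (j : 'I_n) : P := \prod_(i in B b | i != j) z i.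

Lemma z_rho j : j \in B b -> z j * rho j = PiZ b.
Proof. by move=> jB; rewrite /PiZ (bigD1 j). Qed.

Lemma prod_rho (m : nat) : #|B b| = m.+1 -> \prod_(j in B b) rho j = PiZ b ^+ m.
Proof.
move=> cB; apply: (mulfI (PiZ_neq0 b)); rewrite -exprS -cB -prodr_const {1}/PiZ -big_split /=.
by apply: eq_bigr => j; apply: z_rho.
Qed.

Lemma act_rho g : g \in G -> exists t w,
  [/\ {in B b &, injective t}, t @: B b = B b,
    (forall i j, i \in B b -> j \in B b -> g i j = if i == t j then w j else 0)
    & forall j, j \in B b -> w j *: poly_act g (rho j) = delta b g *: rho (t j)].
Proof.
move=> gG; have [t [w [tI tB wr gE]]] := mono_G gG nb; exists t, w; split=> // j jB.
have -> : rho (t j) = \prod_(i in B b | i != j) z (t i).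
  rewrite /rho -{1}tB big_imset_cond //=; apply: eq_bigl => i.
  have [iB|//] := boolP (i \in B b); congr (~~ _) => /=.
  by apply/eqP/eqP => [/tI->|->].
rewrite (deltaE tB gE) (bigD1 j) //= /rho rmorph_prod /=.
rewrite (eq_bigr (fun i => w i *: z (t i))) => [|i /andP[iB _]]; last exact: act_z gE.
by rewrite scaler_prod scalerA.
Qed.

(* For [s b > 0] the first 1-form is the polar form of [PiZ b]; it carries the *)
(* character [delta b], the other ones are invariant modulo y_(J b).          *)
Definition th (j : 'I_n) (i : 'I_n) : P :=
  if i \in B b then
    if s b == 0%N then cz i * tz i ^+ (j - cut b)
    else if (j - cut b)%N is e.+1 then cz i * tz i ^+ e else rho i
  else 0.
Local Notation qT := (fun j => lmul (lform (th j))).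
Definition polar (j : 'I_n) : bool := (s b != 0%N) && (j - cut b == 0)%N.
(** At most 1, since only the first index of the block is polar. It counts the factors [delta b]
    that the forms of K bring in. *)
Definition npolar (K : pred 'I_n) : nat := count polar (filter K (Bq b)).

Lemma act_th g j : g \in G -> exists th' : 'I_n -> P, ext_act g (lform (th j)) = lform th' /\
  meq (J b) (lform th') ((delta b g ^+ polar j)%:MP *: lform (th j)).
Proof.
move=> gG; rewrite act_lform; eexists; split; first by []; rewrite -act_lform /polar.
have PSE e : lform (th j) = PS b e -> meq (J b) (ext_act g (lform (th j))) (lform (th j)).
  by move=> ->; apply: act_PS.
have [s0|s0] := eqVneq (s b) 0%N.
  rewrite expr0 mpolyC1 scale1r; apply: (PSE (j - cut b)%N); rewrite PS_lform.
  by apply: eq_lform => i; rewrite /th s0 eqxx.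
case ej: (j - cut b)%N => [|e] /=.
  rewrite expr1; have [t [w [tI tB gE aE]]] := act_rho gG.
  apply: (mono_lform gG tI tB gE) => [i /negPf iB|i iB]; first by rewrite /th iB.
  have tiB : t i \in B b by rewrite -tB imset_f.
  by rewrite /th iB tiB (negPf s0) ej; apply: aE.
rewrite expr0 mpolyC1 scale1r; apply: (PSE e); rewrite PS_lform.
by apply: eq_lform => i; rewrite /th (negPf s0) ej.
Qed.

Lemma prod_polar g (js : seq 'I_n) :
  \prod_(j <- js) (delta b g ^+ polar j)%:MP = (delta b g ^+ count polar js)%:MP :> P.
Proof.
elim: js => [|j js IH]; first by rewrite big_nil mpolyC1.
by rewrite big_cons IH -mpolyCM -exprD.
Qed.

Lemma act_qout_th g (js : seq 'I_n) u : g \in G -> inmon (J b) u ->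
  ext_act g (qout qT js u) = (delta b g ^+ count polar js)%:MP *: qout qT js (ext_act g u).
Proof.
move=> gG Ju; rewrite -prod_polar.
have [th' /all_and2[gth meqth]] := fin_all_exists (fun j => act_th j gG).
exact: (phi_qout (ext_actM g) (act_Y b gG) gth meqth js Ju).
Qed.

Lemma act_qin_th g (js : seq 'I_n) u : g \in G -> inmon (J b) u ->
  ext_act g (qin qT js u) = (delta b g ^+ count polar js)%:MP *: qin qT js (ext_act g u).
Proof.
move=> gG Ju; rewrite -prod_polar.
have [th' /all_and2[gth meqth]] := fin_all_exists (fun j => act_th j gG).
exact: (phi_qin (ext_actM g) (act_Y b gG) gth meqth js Ju).
Qed.

Lemma map_Bq : [seq (j - cut b)%N | j : 'I_n <- Bq b] = iota 0 #|B b|.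
Proof.
rewrite (map_comp (fun i => i - cut b)%N val) val_sliceq ?cut_leq ?cutS //.
have e := congr1 size (val_sliceq (cut_leq b.+1) (cutS b)).
rewrite size_map size_iota size_Bq in e.
by rewrite -[X in iota X](addn0 (cut b)) iotaDl -map_comp -e map_id_in // => i _ /=; rewrite addKn.
Qed.

Lemma npolar_all : npolar xpredT = (s b != 0%N) && (0 < #|B b|)%N.
Proof.
rewrite /npolar filter_predT.
have -> : count polar (Bq b) = count (fun e => (s b != 0%N) && (e == 0%N)) (iota 0 #|B b|).
  by rewrite -map_Bq count_map; apply: eq_count.
case: #|B b| => [|m]; first by rewrite andbF.
rewrite /= eqxx !andbT (_ : count _ (iota 1 m) = 0%N) ?addn0 //.
apply/eqP; rewrite -leqn0 leqNgt -has_count; apply/hasPn => e; rewrite mem_iota.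
by case: e => //= e _; rewrite andbF.
Qed.

Lemma npolar_compl K : (npolar K + npolar (predC K) = (s b != 0%N) && (0 < #|B b|))%N.
Proof.
rewrite -npolar_all /npolar filter_predT -count_cat.
by have /seq.permP := permEl (perm_filterC K (Bq b)); apply.
Qed.

Lemma npolar_le K : (npolar K <= s b)%N.
Proof.
apply: leq_trans (leq_addr (npolar (predC K)) _) _; rewrite npolar_compl.
by case: (s b) => // m; case: (0 < _)%N.
Qed.

(** With only the forms [PS], the factor [PiZ^(r-1)] would appear even for s b > 0, where the
    coefficients are guaranteed only [PiZ^(s-1)]. The polar form removes this factor. *)
Definition Th : P := Van b * (if s b == 0%N then PiZ b ^+ (r b).-1 else 1).

Lemma qin_th : qin qT (Bq b) 1 = Th *: ymon P (Bq b).
Proof.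
rewrite qin_lmul_prod mulr1.
pose f (e : nat) : A := if s b == 0%N then PS b e
  else if e is e'.+1 then PS b e' else psi rho tz (Bq b) 0.
have -> : \prod_(j <- Bq b) lform (th j) = \prod_(0 <= e < #|B b|) f e.
  rewrite /index_iota subn0 -map_Bq big_map; apply: eq_bigr => j _.
  rewrite /f; case: ifP => s0; first by rewrite PS_lform; apply: eq_lform => i; rewrite /th s0.
  case ej: (j - cut b)%N => [|e].
    rewrite (psi_lform_mem (Q := mem (B b)) _ _ _ (sliceq_uniq n (cut b) (cut b.+1))) => [|i].
      by apply: eq_lform => i; rewrite /th s0 ej expr0 mulr1.
    by rewrite in_Bq -in_B.
  by rewrite PS_lform; apply: eq_lform => i; rewrite /th s0 ej.
have prodB (a : 'I_n -> P) : \prod_(j <- Bq b) a j = \prod_(j in B b) a j.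
  rewrite (big_uniq _ (sliceq_uniq n (cut b) (cut b.+1))) /=; apply: eq_bigl => j.
  by rewrite in_Bq -in_B.
have inBq j : j \in B b -> bl j = b by rewrite in_B => /eqP/val_inj.
rewrite /Th /f; case: ifP => s0.
  rewrite -size_Bq (psi_prod cz tz (sliceq_uniq n (cut b) (cut b.+1))) prodB mulrC.
  congr ((_ * _) *: _); rewrite -prodrXl; apply: eq_bigr => j /inBq jb.
  by rewrite /cz jb.
case cB: #|B b| => [|m].
  have -> : Bq b = [::] by apply: size0nil; rewrite size_Bq.
  by rewrite big_geq // /Van (_ : Bq b = [::]) ?mulr1 ?scale1r //; apply: size0nil; rewrite size_Bq.
rewrite mulr1 big_nat_recl //; apply: (psi_prod_polar (C := PiZ b)).
- exact: sliceq_uniq.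
- by rewrite size_Bq.
- exact: PiZ_neq0.
- move=> j; rewrite in_Bq -in_B => jB.
  by rewrite -(z_rho jB) mulrAC /tz /cz -exprS prednK ?r_gt0 // mulrC.
by rewrite prodB (prod_rho cB).
Qed.

Lemma Jsupp_lform_th j u : supp (Jsupp b) u -> supp (Jsupp b) (lform (th j) * u).
Proof.
move=> su; apply: (suppM (Q1 := fun T => T \subset B b) _ su) => [|S T _ SB /andP[JT TJ]].
  by apply: supp_lform => i; rewrite sub1set /th; case: ifP => //; rewrite eqxx.
rewrite /Jsupp (subset_trans JT) ?subsetUr //= subUset TJ andbT J_B.
exact: subset_trans SB (subsetUl _ _).
Qed.

Lemma Jsupp_qin_th (js : seq 'I_n) u : supp (Jsupp b) u -> supp (Jsupp b) (qin qT js u).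
Proof. by move=> su; elim: js => //= j js; apply: Jsupp_lform_th. Qed.

Lemma Jsupp_inmon u : supp (Jsupp b) u -> inmon (J b) u.
Proof.
move=> su; have sJ : supp (fun T => J b \subset T) u by move=> T /su/andP[].
by have [v -> _] := mulmon_factor sJ; exists v.
Qed.

Lemma Oev_Jsupp : exists m : nat, forall u, supp (Jsupp b) u ->
  qin (fun j => ctr (@evec n P j)) (Bq b) u = ((-1) ^+ m * u (J b.+1)) *: Y b.
Proof.
have [sg Osg] := @qin_evE n P (Bq b) (sliceq_uniq n (cut b) (cut b.+1)).
have eB : [set j in Bq b] = B b by apply/setP=> j; rewrite in_set in_Bq -in_B.
exists (sg (J b)) => u su; apply/ffunP=> T; rewrite Osg eB extZE ffunE.
have [<-|neT] := eqVneq (J b) T.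
  by rewrite disjoint_sym disjoint_BJ mulr1 setUC -J_B.
rewrite mulr0; case: ifP => // dT; suff -> : u (T :|: B b) = 0 by rewrite mulr0.
apply/eqP; apply: contraNT neT => /su/andP[JT]; rewrite J_B subUset => /andP[TJ _].
rewrite eqEsubset; apply/andP; split; apply/subsetP=> i iT.
  have := subsetP JT i iT; rewrite in_setU => /orP[//|iB].
  by rewrite (disjointFr (disjoint_BJ b) iB) in iT.
have := subsetP TJ i iT; rewrite in_setU => /orP[iB|//].
by rewrite (disjointFl dT iB) in iT.
Qed.

(** The word in K already carries [npolar K] factors [delta b]; the power of [PiZ] completes them to
    [delta b ^ s b]. *)
Definition phiR (K : pred 'I_n) : P := PiZ b ^+ (s b - npolar K) * rest b.
Definition wR (K : {set 'I_n}) : A := phiR (mem K) *: qout qT (filter (mem K) (Bq b)) (Y b).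

Lemma inmon_Y : inmon (J b) (Y b).
Proof. by exists 1; rewrite mulr1. Qed.

Lemma chi_mono g : chi g = delta b g ^+ s b * chi' b g.
Proof. by rewrite (chiE b) /cF (negPf nb). Qed.

Lemma qout_thZ (js : seq 'I_n) a u : qout qT js (a *: u) = a *: qout qT js u.
Proof. exact: (@qoutZ n P _ (fun j => lmul (lform (th j)) : {linear A -> A})). Qed.

Lemma act_phiR g K : g \in G ->
  poly_act g (phiR K) = (delta b g ^+ (s b - npolar K) * (chi' b g / dd b g)) *: phiR K.
Proof.
move=> gG; rewrite rmorphM rmorphXn /= act_PiZ // act_rest // exprZn.
by rewrite -scalerAl -scalerAr scalerA.
Qed.

Lemma act_qout_Y g (js : seq 'I_n) : g \in G ->
  ext_act g (qout qT js (Y b)) = (delta b g ^+ count polar js * dd b g)%:MP *: qout qT js (Y b).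
Proof.
move=> gG; rewrite (act_qout_th js gG inmon_Y) (act_Y b gG) qout_thZ.
by rewrite scalerA mpolyCM.
Qed.

Lemma wR_semi_inv K : semi_inv (wR K).
Proof.
move=> g gG; rewrite /wR ext_actZ (act_phiR _ gG) (act_qout_Y _ gG).
set x := qout _ _ _; rewrite -(mul_mpolyC _ (phiR _)) !scalerA; congr (_ *: x).
rewrite mulrAC -mpolyCM; congr (_%:MP * _).
rewrite chi_mono -{2}(subnK (npolar_le (mem K))) exprD -/(npolar (mem K)).
by field; rewrite dd_neq0.
Qed.

Lemma Van_PiZ_rest_neq0 : (Van b != 0) * (rest b != 0).
Proof.
have := @FF_neq0 b 0 (fun _ => r_gt0 b); rewrite /FF /Fac (negPf nb) expr0 mul1r expr1 mulf_eq0.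
by case/norP=> -> ->.
Qed.

Lemma Th_neq0 : Th != 0.
Proof.
rewrite mulf_neq0 ?Van_PiZ_rest_neq0 //; case: ifP => _; last exact: oner_neq0.
by rewrite expf_neq0 ?PiZ_neq0.
Qed.

(** The coefficient carries [delta b] to the power s + 1 - [npolar K] if s > 0, and to the power 0,
    equivalently r, if s = 0. In both cases the matching generator [FF b v0] is [Th * phiR K]. *)
Lemma coef_dvd_R u K : semi_inv u -> supp (Jsupp b) u -> (0 < #|B b|)%N ->
  exists e, qin qT (filter (predC K) (Bq b)) u (J b.+1) = Th * (e * phiR K).
Proof.
move=> Xu su B0; set js := filter _ _; set v := qin qT js u.
pose v0 := if s b == 0%N then (r b).-1 else (s b - npolar K)%N.
have np := npolar_compl K; rewrite B0 andbT in np.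
have FF_Th : FF b v0 = Th * phiR K.
  rewrite /FF /Fac (negPf nb) /Th /phiR expr1 /v0.
  case: eqP np => [-> /= np|_ _]; last by ring.
  by rewrite sub0n expr0; ring.
have [||e ee] := @FF_dvd b v0 (v (J b.+1)); last first.
- by exists e; rewrite ee FF_Th mulrCA.
- move=> g gG; have sv : supp (fun T => T \subset J b.+1) v.
    by have H := @Jsupp_qin_th js u su; move=> T /H/andP[].
  have := coef_act (act_Y b.+1 gG) (supp_TJ sv) (x := delta b g ^+ npolar (predC K) * chi g).
  rewrite /v act_qin_th ?Xu //; last exact: Jsupp_inmon.
  rewrite -/(npolar (predC K)).
  have qZ : qin qT js ((chi g)%:MP *: u) = (chi g)%:MP *: qin qT js u.
    exact: (@qinZ n P _ (fun j => lmul (lform (th j)) : {linear A -> A})).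
  rewrite qZ scalerA -mpolyCM => /(_ erefl) E.
  have [D0 D1] := (dd_neq0 b gG, dd_neq0 b.+1 gG).
  apply: (scalerI D1); rewrite E scalerA [dd b.+1 g * _]mulrC divfK //; congr (_ *: _).
  rewrite chi_mono /dX (negPf nb) /v0 mulrCA mulrA -exprD mulrC; congr (_ * _).
  case: eqP np => [s0 /eqP|s0 /= np].
    rewrite s0 /= addn_eq0 => /andP[_ /eqP ->].
    by rewrite expr0 prednK ?r_gt0 // deltaX.
  congr (_ ^+ _); have le_s := npolar_le K.
  by rewrite -subSn // -[(s b).+1]addn1 -[X in (_ + X - _)%N]np addnA addnAC addnK.
move=> _; rewrite /v0; case: eqP => _; first by rewrite ltn_predL r_gt0.
exact: leq_ltn_trans (leq_subr _ _) (s_lt nb).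
Qed.

(** All the forms together multiply u by a multiple of y_B, which keeps only the coefficient of u at
    [J b], and that is zero. *)
Lemma R_term0 u K : supp (Nsupp b) u -> {in B b, forall j, ~~ K j} ->
  qin qT (filter (predC K) (Bq b)) u (J b.+1) = 0.
Proof.
move=> su nK; have -> : filter (predC K) (Bq b) = Bq b.
  by apply/all_filterP/allP => j; rewrite in_Bq -in_B => /nK.
rewrite qin_lmul_prod -[\prod_(_ <- _) _]mulr1 -qin_lmul_prod qin_th.
have [m ->] := ymon_sign P (sliceq_uniq n (cut b) (cut b.+1)).
have -> : [set j in Bq b] = B b by apply/setP=> j; rewrite in_set in_Bq -in_B.
rewrite -!scalerAl (YB_mul (Nsupp_J su)) (Nsupp_coef su) mulr0 scale0r !scaler0.
by rewrite ffunE.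
Qed.

Lemma R_engine (W : A -> Prop) u :
  (forall u v, W u -> W v -> W (u + v)) -> (forall u, W u -> W (- u)) ->
  (forall K : pred 'I_n, W (qout qT (filter K (Bq b))
     (qin (fun j => ctr (@evec n P j)) (Bq b) (qin qT (filter (predC K) (Bq b)) u)))) ->
  W (Th *: u).
Proof. exact: (theta_engine (sliceq_uniq n (cut b) (cut b.+1)) qin_th). Qed.

Lemma R_term : exists m : nat, forall u (K : pred 'I_n), supp (Nsupp b) u ->
  let K' : {set 'I_n} := [set j in B b | K j] in
  let x := qin qT (filter (predC K) (Bq b)) u (J b.+1) in
  [/\ qout qT (filter K (Bq b)) (qin (fun j => ctr (@evec n P j)) (Bq b) (qin qT (filter (predC K) (Bq b)) u)) =
     ((-1) ^+ m * x) *: qout qT (filter (mem K') (Bq b)) (Y b), npolar K = npolar (mem K')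
   & if K' == set0 then x = 0 else (0 < #|B b|)%N].
Proof.
have [m Om] := Oev_Jsupp; exists m => u K su K' x.
have eK : filter K (Bq b) = filter (mem K') (Bq b).
  by apply: eq_in_filter => j; rewrite in_Bq -in_B => jB; rewrite [mem K' j]in_set jB.
split; last 1 first.
- case: eqP => [K0|/eqP/set0Pn[j]]; last first.
    by rewrite in_set => /andP[jB _]; apply/card_gt0P; exists j.
  apply: R_term0 => // j jB; apply/negP => Kj; have : j \in K' by rewrite in_set jB.
  by rewrite K0 in_set0.
- by rewrite Om ?qout_thZ -?eK //; apply/Jsupp_qin_th/Nsupp_J.
by rewrite /npolar eK.
Qed.

Lemma level_mono : level_data b wR.
Proof.
have [m Rm] := R_term.
have subK (K : pred 'I_n) : [set j in B b | K j] \subset B b.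
  by apply/subsetP=> j; rewrite in_set => /andP[].
split=> [K|u su Xu|u su].
- by rewrite /Nfam; case: ifP => _; [exact: wR_semi_inv | exact: semi_inv_0].
- pose W v := exists2 x, lspan (Nfam b wR) x & v = Th *: x.
  have [x Sx ex] : W (Th *: u); last by rewrite (scaler_injE Th_neq0 ex).
  apply: R_engine => [u1 u2 [x1 S1 ->] [x2 S2 ->]|u1 [x1 S1 ->]|K].
  + by exists (x1 + x2); [exact: lspanD | rewrite scalerDr].
  + by exists (- x1); [exact: lspanN | rewrite scalerN].
  have [-> eK] := Rm u K su; set K' := [set _ in _ | _] in eK *.
  case: ifP => [_ ->|K0 B0].
    by exists 0; [exact: lspan0 | rewrite mulr0 scale0r scaler0].
  have [e ->] := coef_dvd_R K Xu (Nsupp_J su) B0.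
  exists (((-1) ^+ m * e) *: Nfam b wR K'); first exact/lspanZ/lspan_mem.
  rewrite /Nfam K0 subK /wR /phiR eK !scalerA; congr (_ *: _); ring.
apply: (rlspan_scale Th_neq0).
apply: R_engine => [u1 u2|u1|K]; [exact: rlspanD | exact: rlspanN |].
have [-> eK] := Rm u K su; set K' := [set _ in _ | _] in eK *.
case: ifP => [_ ->|K0 _].
  by rewrite mulr0 scale0r; exact/lspan_rlspan/lspan0.
apply: rlspanZ; exists (phiR (mem K')).
  by rewrite mulf_neq0 ?Van_PiZ_rest_neq0 // expf_neq0 ?PiZ_neq0.
by have := lspan_mem (Nfam b wR) K'; rewrite /Nfam K0 subK.
Qed.

End LevelMonomial.
(** [stepone_coef] allows division by [Del b] off the coefficient at [J b]; since [Y b] and [Del b]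
    have the same character, the quotient is semi-invariant for chi ([strip_scalar]). *)
Lemma stepone_split (b : nat) u js : semi_inv u -> supp (fun T => T \subset J b.+1) u ->
  exists (w : A) (c0 : P), [/\ Y b * qin (fun j => ctr (Zv F 0 j)) js u = Del b *: w + c0 *: Y b,
    supp (Nsupp b) w & semi_inv w].
Proof.
move=> Xu su; set v := qin _ js u; set U := Y b * v.
have sv : supp (fun T => T \subset J b.+1) v by apply: sub_qin.
have sU := supp_YM sv; rewrite -/U in sU.
have [|w eU wT] := @edvd_split n P (J b) U (Del b) (Del_neq0 b).
  move=> T neT; have [->|/sU/andP[JT TJ]] := eqVneq (U T) 0; first exact: mdvd0.
  by apply: (@stepone_coef b u Xu js T su); rewrite /Nsupp JT TJ neT.
have sw : supp (Nsupp b) w by move=> T /wT[neT /sU/andP[JT TJ]]; rewrite /Nsupp JT TJ neT.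
exists w, (U (J b)); split=> // g gG.
have cw : supp (fun T => (#|J b| < #|T|)%N) w.
  by move=> T /sw /and3P[JT _ neT]; apply: proper_card; rewrite properEneq eq_sym neT JT.
have nJ v0 : supp (fun T => (#|J b| < #|T|)%N) v0 -> v0 (J b) = 0.
  by move=> sv0; apply/eqP; case: eqP => // /eqP/sv0; rewrite ltnn.
have gU : ext_act g U = (dd b g)%:MP *: ((chi g)%:MP *: U).
  rewrite /U ext_actM act_Y // act_qin => [|j i]; last exact: Zv0_act.
  rewrite Xu // qin_ctrZ -/v.
  by rewrite -scalerAl -scalerAr.
apply: (@strip_scalar n P (J b) (poly_act g) (ext_act g) (Del b) (dd b g)%:MP (chi g)%:MP (U (J b)) U w).
- exact: ext_actD.
- exact: ext_actZ.
- exact: eU.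
- exact: gU.
- exact: act_Y.
- by rewrite mul_mpolyC act_Del.
- exact: nJ.
- by apply/nJ/card_act.
- exact: Del_neq0.
by rewrite mpolyC_eq0 dd_neq0.
Qed.

(** * Gluing the blocks into a family indexed by all subsets *)

Section Assembly.
Variables (w : nat -> {set 'I_n} -> A) (fb : P).
Hypothesis lvl : forall b, (b < l)%N -> level_data b (w b).
Hypotheses (fb_neq0 : fb != 0) (fb_semi_inv : semi_inv fb%:A) (fb_dvd : forall p, semi_inv p%:A -> mdvd fb p).

Let top (T : {set 'I_n}) : nat := \max_(j in T) bl j.
Let Q0 (T : {set 'I_n}) (b : nat) : seq 'I_n := [seq j <- sliceq n 0 (cut b) | j \in T].

(** The last block met by T selects the level, its intersection with T the member of that level, and
    the rest of T the contractions applied to it. This encodes all such triples without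
    repetition. *)
Definition gens (T : {set 'I_n}) : A :=
  if T == set0 then fb%:A
  else qout (fun j => ctr (Zv F 0 j)) (Q0 T (top T)) (w (top T) (T :&: B (top T))).

Lemma gens_semi_inv T : semi_inv (gens T).
Proof.
rewrite /gens; case: ifP => [_|/negbT T0]; first exact: fb_semi_inv.
have T_gt0 : (0 < #|T|)%N by rewrite card_gt0.
have [j jT ej] := eq_bigmax_cond (fun j => bl j : nat) T_gt0; rewrite -/(top T) in ej.
have /lvl[wX _ _] : (top T < l)%N by rewrite ej ltn_ord.
have := @semi_inv_qout 0 (Q0 T (top T)) (w (top T) (T :&: B (top T))); rewrite cut0; apply.
have := wX (T :&: B (top T)); rewrite /Nfam subsetIr /= ifT //.
by apply/set0Pn; exists j; rewrite in_setI jT in_B ej eqxx.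
Qed.

Lemma gens_level (b : nat) (K' : pred 'I_n) (K : {set 'I_n}) : K \subset B b -> K != set0 ->
  lspan gens (qout (fun j => ctr (Zv F 0 j)) (filter K' (sliceq n 0 (cut b))) (w b K)).
Proof.
move=> KB K0; pose T : {set 'I_n} := [set j in J b | K' j] :|: K.
have inJ j : j \in J b -> j \notin B b by move=> jJ; rewrite (disjointFl (disjoint_BJ b)).
have eB : T :&: B b = K.
  apply/setP=> j; rewrite !in_setI in_setU in_set; have [jB|njB] := boolP (j \in B b).
    by rewrite andbT (negbTE (contraL (@inJ j) jB)).
  by rewrite andbF; apply/esym/negbTE; apply: contra njB; apply: (subsetP KB).
have eT : top T = b.
  apply/eqP; rewrite eqn_leq; apply/andP; split.
    apply/bigmax_leqP => j; rewrite in_setU in_set => /orP[/andP[]|/(subsetP KB)].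
      by rewrite in_J => /ltnW.
    by rewrite in_B => /eqP->.
  have [j jK] := set0Pn _ K0; have := subsetP KB j jK; rewrite in_B => /eqP<-.
  by apply: (leq_bigmax_cond (F := fun j => bl j : nat)); rewrite in_setU jK orbT.
have T0 : T != set0.
  by have [j jK] := set0Pn _ K0; apply/set0Pn; exists j; rewrite in_setU jK orbT.
have := lspan_mem gens T; rewrite /gens (negPf T0) eT eB.
suff -> : Q0 T b = filter K' (sliceq n 0 (cut b)) by [].
apply: eq_in_filter => j; rewrite mem_sliceq /= => jb.
have jJ : j \in J b by rewrite inE.
by rewrite in_setU in_set jJ /= (negbTE (contra (subsetP KB j) (inJ j jJ))) orbF.
Qed.

Lemma qout_Nspan (b : nat) (K' : pred 'I_n) u : lspan (Nfam b (w b)) u ->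
  lspan gens (qout (fun j => ctr (Zv F 0 j)) (filter K' (sliceq n 0 (cut b))) u).
Proof.
have q0 : qout (fun j => ctr (Zv F 0 j)) (filter K' (sliceq n 0 (cut b))) 0 = 0.
  by have := qout_ctrZ (Zv F 0) (filter K' (sliceq n 0 (cut b))) 0 0; rewrite !scale0r.
move=> [c ->]; elim: (index_enum _) => [|K rs IH].
  by rewrite big_nil q0; apply: lspan0.
rewrite big_cons qout_ctrD; apply: lspanD => //.
rewrite [qout _ _ _]qout_ctrZ; apply: lspanZ; rewrite /Nfam.
by case: ifP => [/andP[KB K0]|_]; [exact: gens_level | rewrite q0; exact: lspan0].
Qed.

Lemma Y_supp (b : nat) : supp (fun T => T \subset J b) (Y b).
Proof. exact: supp_mon. Qed.

Lemma Del_engine (b : nat) (W : A -> Prop) u :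
  (forall u v, W u -> W v -> W (u + v)) -> (forall u, W u -> W (- u)) ->
  (forall K : pred 'I_n, W (qout (fun j => ctr (Zv F 0 j)) (filter K (sliceq n 0 (cut b)))
     (Y b * qin (fun j => ctr (Zv F 0 j)) (filter (predC K) (sliceq n 0 (cut b))) u))) ->
  W (Del b *: u).
Proof. exact: (moore_engine ch_prime cardF (leq0n _) (cut_leq b)). Qed.

Lemma gens_semi_inv_span (b : nat) : (b <= l)%N -> forall u, supp (fun T => T \subset J b) u ->
  semi_inv u -> lspan gens u.
Proof.
elim: b => [|b IH] bl_ u su Xu.
  have J0 : J 0 = set0 by rewrite /J cut0 slicenn.
  have eu : u = (u set0)%:A.
    rewrite {1}[u]ext_sum_mon (bigD1 set0) //= big1 ?addr0 // => T neT.
    have [->|/su] := eqVneq (u T) 0; first by rewrite scale0r.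
    by rewrite J0 subset0 (negPf neT).
  have [|c ec] := fb_dvd (p := u set0); first by rewrite -eu.
  rewrite eu ec -scalerA; apply: lspanZ; have := lspan_mem gens set0.
  by rewrite /gens eqxx.
have [_ wspan _] := lvl bl_.
(* Semi-invariance of e is part of W so that u - e can enter the induction hypothesis after division
   by [Del b]. *)
pose W v := exists e, [/\ lspan gens e, semi_inv e & supp (fun T => T \subset J b) (v - Del b *: e)].
have [e [eS eX se]] : W (Del b *: u).
  apply: Del_engine => [u1 u2 [e1 [S1 X1 s1]] [e2 [S2 X2 s2]]|u1 [e1 [S1 X1 s1]]|K].
  - exists (e1 + e2); split; [exact: lspanD|exact: semi_inv_D|].
    exact: (supp_sub_scaleD s1 s2).
  - exists (- e1); split; [exact: lspanN|exact: semi_inv_N|].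
    exact: (supp_sub_scaleN s1).
  have [v [c0 [-> sv Xv]]] := stepone_split (filter (predC K) (sliceq n 0 (cut b))) Xu su.
  exists (qout (fun j => ctr (Zv F 0 j)) (filter K (sliceq n 0 (cut b))) v); split.
  - exact/qout_Nspan/wspan.
  - by have := @semi_inv_qout 0 (filter K (sliceq n 0 (cut b))) v Xv; rewrite cut0.
  rewrite qout_ctrD [qout _ _ (Del b *: v)]qout_ctrZ.
  by rewrite addrC addKr; apply/sub_qout/suppZ/Y_supp.
have -> : u = (u - e) + e by rewrite subrK.
apply: lspanD eS; apply: IH (ltnW bl_) _ _ _; last exact/semi_inv_D/semi_inv_N.
move=> T uT; apply: se; rewrite -scalerBr extZE.
by rewrite mulf_neq0 ?Del_neq0.
Qed.

Lemma gens_rspan (b : nat) : (b <= l)%N -> forall u, supp (fun T => T \subset J b) u -> rlspan gens u.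
Proof.
elim: b => [|b IH] bl_ u su.
  have J0 : J 0 = set0 by rewrite /J cut0 slicenn.
  have -> : u = (u set0)%:A.
    rewrite {1}[u]ext_sum_mon (bigD1 set0) //= big1 ?addr0 // => T neT.
    have [->|/su] := eqVneq (u T) 0; first by rewrite scale0r.
    by rewrite J0 subset0 (negPf neT).
  exists fb => //; rewrite scalerA mulrC -scalerA; apply: lspanZ.
  by have := lspan_mem gens set0; rewrite /gens eqxx.
have [_ _ wrspan] := lvl bl_.
apply: (rlspan_scale (Del_neq0 b)); apply: Del_engine => [u1 u2|u1|K].
- exact: rlspanD.
- exact: rlspanN.
set U := Y b * _.
have sU : supp (fun T => (J b \subset T) && (T \subset J b.+1)) U by exact/supp_YM/sub_qin.
have [|v eU vT] := @edvd_split n P (J b) U 1 (oner_neq0 _).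
  by move=> T _; exists (U T); rewrite mulr1.
have sv : supp (Nsupp b) v by move=> T /vT[neT /sU/andP[JT TJ]]; rewrite /Nsupp JT TJ neT.
rewrite eU scale1r qout_ctrD.
apply: rlspanD; last by apply: IH (ltnW bl_) _ _; apply/sub_qout/suppZ/Y_supp.
have [H H0 Hv] := wrspan v sv; exists H => //.
by rewrite -qout_ctrZ; apply: qout_Nspan.
Qed.

Lemma J_l : J l = setT.
Proof. by apply/setP=> j; rewrite in_J ltn_ord inE. Qed.

Lemma gens_basis : [/\ forall T, semi_inv (gens T), forall u, semi_inv u -> lspan gens u
  & forall u, rlspan gens u].
Proof.
have sl u : supp (fun T => T \subset J l) u by move=> T _; rewrite J_l subsetT.
split=> [T|u Xu|u]; first exact: gens_semi_inv.
  exact: (gens_semi_inv_span (leqnn l) (sl u) Xu).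
exact: (gens_rspan (leqnn l) (sl u)).
Qed.

End Assembly.


Definition wlevel (b : nat) : {set 'I_n} -> A :=
  if insub b is Some b' then (if gl b' then wGL b' else wR b') else fun=> 0.

Lemma wlevelP (b : nat) : (b < l)%N -> level_data b (wlevel b).
Proof.
move=> bl_; rewrite /wlevel insubT; case: ifP => [gb|/negbT nb].
  exact: (level_GL (b := Sub b bl_) gb).
exact: (level_mono (b := Sub b bl_) nb).
Qed.

(** Applying g to the expansion and dividing by chi g gives a second expansion of u, so the
    coefficients agree by independence. *)
Lemma invariant_coef (e : {set 'I_n} -> A) (c : {set 'I_n} -> P) u :
  (forall T, semi_inv (e T)) -> (forall v, rlspan e v) -> semi_inv u -> u = \sum_T c T *: e T ->
  forall T, c T \in poly_invariants G.
Proof.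
move=> eX espan Xu uE T; rewrite unfold_in; apply/forall_inP => g gG; apply/eqP.
have chi0 := chi_neq0 gG.
have e0 : \sum_T (poly_act g (c T) - c T) *: e T = 0.
  apply: (@scaler_injE n P (chi g)%:MP); first by rewrite mpolyC_eq0.
  rewrite scaler0 scaler_sumr (eq_bigr (fun T => ext_act g (c T *: e T) - (chi g)%:MP *: (c T *: e T))).
    by rewrite sumrB -ext_act_sum -scaler_sumr -uE Xu // subrr.
  move=> T' _; rewrite ext_actZ (eX T' g gG).
  exact: scale_sub.
by apply/eqP; rewrite -subr_eq0 (rlspan_free espan e0).
Qed.

Theorem semi_invariants_basis : exists e : {set 'I_n} -> A,
  [/\ forall T, semi_inv (e T),
      forall u, semi_inv u -> exists2 c : {set 'I_n} -> P, forall T, c T \in poly_invariants G & u = \sum_T c T *: e T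
    & forall c : {set 'I_n} -> P, \sum_T c T *: e T = 0 -> forall T, c T = 0].
Proof.
have [eX espan erspan] := gens_basis wlevelP fbase_neq0 fbase_semi_inv fbase_dvd.
exists (gens wlevel fbase); split=> // [u Xu|c]; last exact: rlspan_free.
have [c uE] := espan u Xu; exists c => //.
exact: invariant_coef eX erspan Xu uE.
Qed.
End Group.

(** * Block matrices *)

Section Parabolic.
Lemma eq_parabolic (F : finFieldType) (l : nat) (n_ : 'I_l -> nat)
    (H H' : forall i, {set 'M[F]_(n_ i)}) :
  (forall i, H i = H' i) -> parabolic H = parabolic H'.
Proof.
move=> e; apply/setP=> g; rewrite !inE; congr (_ && _).
by apply: eq_forallb => i; rewrite e.
Qed.

Lemma GimpP (F : finFieldType) (m a k : nat) (h : 'M[F]_k) :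
  h \in Gimp F m a k <-> exists t : 'S_k, exists w : 'I_k -> F,
    [/\ forall j, w j ^+ m = 1, (\prod_j w j) ^+ (m %/ a) = 1
      & forall i j, h i j = if i == t j then w j else 0].
Proof.
split=> [/imset2P[_ d /imsetP[t _ ->] /imsetP[w]]|[t [w [wm wa hE]]]].
  rewrite inE => /andP[/forallP wm /eqP wa] -> ->.
  exists t^-1%g, (fun j => w 0 j); split=> [j|//|i j]; first exact/eqP.
  rewrite mul_mx_diag !mxE -(inj_eq (@perm_inj _ t) i) permKV.
  by case: eqP => _; rewrite ?mul1r ?mul0r.
apply/imset2P; exists (perm_mx t^-1%g) (diag_mx (\row_j w j)).
- by apply/imsetP; exists t^-1%g.
- apply/imsetP; exists (\row_j w j) => //; rewrite inE.
  apply/andP; split; first by apply/forallP => j; rewrite mxE wm.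
  by rewrite (eq_bigr w) ?wa // => j _; rewrite mxE.
apply/matrixP=> i j; rewrite mul_mx_diag !mxE hE -(inj_eq (@perm_inj _ t^-1%g) i) permK.
by case: eqP => _; rewrite ?mul1r ?mul0r.
Qed.

(** In F the m-th roots of unity are those of order dividing gcd(m, q-1), by Bezout. *)
Lemma Gimp_gcd (F : finFieldType) (m k : nat) : (0 < m)%N ->
  Gimp F m 1 k = Gimp F (gcdn m #|F|.-1) 1 k.
Proof.
move=> m0; have q1 : (0 < #|F|.-1)%N by have := finRing_gt1 F; case: #|F| => [|[]].
have root (x : F) : (x ^+ m == 1) = (x ^+ gcdn m #|F|.-1 == 1).
  apply/eqP/eqP => xm; last first.
    by rewrite -(divnK (dvdn_gcdl m #|F|.-1)) mulnC exprM xm expr1n.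
  have x0 : x != 0.
    by apply: contra_eq_neq xm => ->; rewrite expr0n gtn_eqF // eq_sym oner_neq0.
  have xq : x ^+ #|F|.-1 = 1.
    by apply: (mulIf x0); rewrite mul1r -exprSr prednK ?expf_card // ltnW // finRing_gt1.
  have [u v euv _] := egcdnP #|F|.-1 m0.
  have : x ^+ (u * m) = x ^+ (v * #|F|.-1 + gcdn m #|F|.-1) by rewrite euv.
  by rewrite exprD ![(_ * m)%N]mulnC ![(_ * _.-1)%N]mulnC !exprM xm xq !expr1n mul1r.
apply/setP=> h; apply/idP/idP => /GimpP[t [w [wm _ hE]]]; apply/GimpP; exists t, w; split=> // [j|].
- by apply/eqP; rewrite -root wm.
- by rewrite divn1 -prodrXl big1 // => j _; apply/eqP; rewrite -root wm.
- by apply/eqP; rewrite root wm.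
by rewrite divn1 -prodrXl big1 // => j _; apply/eqP; rewrite root wm.
Qed.

Lemma Gimp_unit (F : finFieldType) (m a k : nat) h : (0 < m)%N -> h \in Gimp F m a k -> h \in unitmx.
Proof.
move=> m0 /imset2P[_ d /imsetP[t _ ->] /imsetP[w]].
rewrite inE => /andP[/forallP wm _] -> ->; rewrite unitmx_mul unitmx_perm /=.
rewrite unitmxE det_diag unitfE; apply/prodf_neq0 => j _; have := wm j.
by apply: contraTneq => ->; rewrite expr0n gtn_eqF // eq_sym oner_neq0.
Qed.

Variables (F : finFieldType) (l : nat) (n_ : 'I_l -> nat).
Local Notation n := (\sum_i n_ i)%N.
Local Notation bl := (@tagnat.sig1 l n_).
Local Notation Rk := (@tagnat.Rank l n_ _).
Implicit Types (g h : 'M[F]_n) (b : 'I_l).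

Lemma bl_mono (i j : 'I_n) : (i <= j)%N -> (bl i <= bl j)%N.
Proof. exact: (@tagnat.le_sig1 l n_ i j). Qed.

Lemma Rank_inj b : injective (@tagnat.Rank l n_ b).
Proof. by move=> k k' /(congr1 val)/eqP; rewrite tagnat.eq_Rank eqxx => /eqP/val_inj. Qed.

Lemma Rank_sig b (i : 'I_n) : bl i = b -> exists k : 'I_(n_ b), i = Rk k.
Proof. by move=> <-; exists (tagnat.sig2 i); rewrite tagnat.sig2K. Qed.

Lemma block_big (R : Type) (idx : R) (op : Monoid.com_law idx) b (f : 'I_n -> R) :
  \big[op/idx]_(i | bl i == b) f i = \big[op/idx]_(k < n_ b) f (Rk k).
Proof.
rewrite (reindex _ (onW_bij _ (@tagnat.rank_bij l n_))) /=.
rewrite (eq_bigl (fun p => (tag p == b) && true)) => [|p]; last by rewrite tagnat.rankE tagnat.Rank1K andbT.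
rewrite (eq_bigr (fun p => f (Rk (tagged p)))) => [|p _]; last by rewrite tagnat.rankE.
by rewrite -(sig_big_dep (fun i => i == b) (fun _ _ => true) (fun i k => f (Rk k))) big_pred1_eq.
Qed.

Lemma submxblockE g b b' k k' : submxblock g b b' k k' = g (Rk k) (Rk k').
Proof. by rewrite mxE. Qed.

Definition btri g := [forall i, forall j, (bl j < bl i)%N ==> (g i j == 0)].

Lemma btriP g : reflect (forall i j, (bl j < bl i)%N -> g i j = 0) (btri g).
Proof.
apply: (iffP idP) => [/forallP gT i j ji|gT].
  by have /forallP/(_ j)/implyP/(_ ji)/eqP := gT i.
by apply/forallP=> i; apply/forallP=> j; apply/implyP=> /gT->.
Qed.

Lemma btri_mul g h : btri g -> btri h -> btri (g *m h).
Proof.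
move=> /btriP gT /btriP hT; apply/btriP=> i j ji; rewrite mxE big1 // => k _.
have [ki|ik] := ltnP (bl k) (bl i); first by rewrite gT ?mul0r.
by rewrite hT ?mulr0 // (leq_trans ji).
Qed.

Lemma btri1 : btri 1%:M.
Proof. by apply/btriP=> i j ji; rewrite mxE; case: eqP ji => // ->; rewrite ltnn. Qed.

(* Left multiplication by [g] is injective on the finite set of block upper    *)
(* triangular matrices, hence onto.                                           *)
Lemma btri_inv g : g \in unitmx -> btri g -> exists2 h, btri h & g *m h = 1%:M.
Proof.
move=> gU gT; pose T := [set h : 'M[F]_n | btri h].
have gI : injective (mulmx g : 'M[F]_n -> 'M[F]_n) by apply: can_inj (mulKmx gU).
have gTT : (mulmx g) @: T = T.
  apply/eqP; rewrite eqEcard card_imset // leqnn andbT.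
  by apply/subsetP=> _ /imsetP[h hT ->]; rewrite !inE in hT *; apply: btri_mul.
have : 1%:M \in (mulmx g) @: T by rewrite gTT inE btri1.
by case/imsetP=> h; rewrite inE => hT e; exists h.
Qed.

Lemma submxblock_mul g h b : btri g -> btri h ->
  submxblock (g *m h) b b = submxblock g b b *m submxblock h b b.
Proof.
move=> /btriP gT /btriP hT; apply/matrixP=> k k'; rewrite submxblockE !mxE.
under [RHS]eq_bigr do rewrite !submxblockE.
rewrite -(block_big _ b (fun i => g (Rk k) i * h i (Rk k'))) [RHS]big_mkcond /=.
apply: eq_bigr => i _; have [ib|ib|/val_inj->] := ltngtP (bl i) b; last by rewrite eqxx.
  by rewrite gT ?tagnat.Rank1K // mul0r if_same.
by rewrite hT ?tagnat.Rank1K // mulr0 if_same.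
Qed.

Lemma btri_unit g : btri g -> (g \in unitmx) = [forall b, submxblock g b b \in unitmx].
Proof.
move=> gT; apply/idP/forallP => [gU b|gB].
  have [h hT gh] := btri_inv gU gT; have := submxblock_mul b gT hT.
  rewrite gh => e; suff /mulmx1_unit[] : submxblock g b b *m submxblock h b b = 1%:M by [].
  rewrite -e; apply/matrixP=> k k'; rewrite submxblockE !mxE.
  by rewrite (inj_eq (@Rank_inj b)).
rewrite -row_free_unit; apply: inj_row_free => v vg.
have gE := btriP _ gT.
(* Forward substitution: once the earlier blocks of v vanish, block b of [v *m g] is that of v times
   the b-th diagonal block. *)
have vb m (i : 'I_n) : (bl i < m)%N -> v 0 i = 0.
  elim: m i => // m IH i; rewrite ltnS leq_eqVlt => /orP[/eqP im|/IH//].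
  set b := bl i in im; have [k ->] := Rank_sig (erefl b).
  pose w : 'rV[F]_(n_ b) := \row_k v 0 (Rk k).
  suff /rowP/(_ k) : w = 0 by rewrite !mxE.
  suff : w *m submxblock g b b = 0.
    by move/(congr1 (mulmx^~ (invmx (submxblock g b b)))); rewrite mulmxK ?gB // mul0mx.
  apply/rowP=> k'; transitivity ((v *m g) 0 (Rk k')); last by rewrite vg !mxE.
  rewrite [LHS]mxE [RHS]mxE.
  under [LHS]eq_bigr do rewrite mxE submxblockE.
  rewrite -(block_big _ b (fun i => v 0 i * g i (Rk k'))) [LHS]big_mkcond /=.
  apply: eq_bigr => j _; have [jb|jb|/val_inj->] := ltngtP (bl j) b; last by rewrite eqxx.
    by rewrite IH ?mul0r ?if_same // -im.
  by rewrite gE ?tagnat.Rank1K // mulr0 if_same.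
by apply/rowP=> i; rewrite mxE (vb (bl i).+1).
Qed.

Lemma monomial_blockP b (r : 'I_l -> nat) g : (0 < r b)%N ->
  monomial_block bl r b g <-> submxblock g b b \in Gimp F (r b) 1 (n_ b).
Proof.
move=> r0; pose kk (i : 'I_n) := [pick k : 'I_(n_ b) | Rk k == i].
have kkR k : kk (Rk k) = Some k.
  rewrite /kk; case: pickP => [k' /eqP/Rank_inj->//|/(_ k)]; by rewrite eqxx.
have blR (k : 'I_(n_ b)) : bl (Rk k) = b by rewrite tagnat.Rank1K.
split=> [[t [w [tI tb gE]]]|/GimpP[t [w [wr _ gE]]]].
  pose u k := odflt k (kk (t (Rk k))).
  have tR k : t (Rk k) = Rk (u k).
    have [k' ek] := Rank_sig (proj1 (tb _ (blR k))).
    by rewrite /u ek kkR.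
  have uI : injective u.
    move=> k k' e; apply: (@Rank_inj b); apply: tI; rewrite ?inE ?blR //.
    by rewrite !tR e.
  apply/GimpP; exists (perm uI), (fun k => w (Rk k)); split=> [k||k k'].
  - by case: (tb _ (blR k)).
  - by rewrite divn1 -prodrXl big1 // => k _; case: (tb _ (blR k)).
  by rewrite submxblockE gE ?blR // tR permE (inj_eq (@Rank_inj b)).
exists (fun i => if kk i is Some k then Rk (t k) else i), (fun i => if kk i is Some k then w k else 1).
split=> [i j|j jb|i j ib jb].
- rewrite !inE => /eqP/Rank_sig[k ->] /eqP/Rank_sig[k' ->]; rewrite !kkR.
  by move/Rank_inj/perm_inj->.
- by have [k ->] := Rank_sig jb; rewrite kkR blR.
have [[k ->] [k' ->]] := (Rank_sig ib, Rank_sig jb).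
by rewrite kkR -submxblockE gE (inj_eq (@Rank_inj b)).
Qed.

Variables (gl : pred 'I_l) (r : 'I_l -> nat).
Hypothesis r_gt0 : forall b, (0 < r b)%N.
Definition Gb b : {set 'M[F]_(n_ b)} := if gl b then GL F (n_ b) else Gimp F (r b) 1 (n_ b).

Lemma parabolicP g : g \in parabolic Gb <-> in_parabolic bl gl r g.
Proof.
have triE : [forall i : 'I_l, forall j : 'I_l, (j < i)%N ==> (submxblock g i j == 0)] = btri g.
  apply/idP/idP => [/forallP gT|/btriP gT].
    apply/btriP=> i j ji; have /forallP/(_ (bl j))/implyP/(_ ji)/eqP := gT (bl i).
    move/matrixP/(_ (tagnat.sig2 i) (tagnat.sig2 j)); rewrite submxblockE mxE.
    by rewrite !tagnat.sig2K.
  apply/forallP=> b; apply/forallP=> b'; apply/implyP=> bb; apply/eqP/matrixP=> k k'.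
  by rewrite submxblockE mxE gT // !tagnat.Rank1K.
rewrite inE triE; split=> [/andP[/forallP gB gT]|[gU gT gm]].
  split; [|exact/btriP|].
    rewrite btri_unit //; apply/forallP => b; have := gB b; rewrite /Gb.
    by case: ifP => _; [rewrite inE | apply: Gimp_unit].
  by move=> b nb; apply/monomial_blockP => //; have := gB b; rewrite /Gb (negPf nb).
have {}gT : btri g by apply/btriP.
rewrite gT andbT; apply/forallP=> b; rewrite /Gb; case: ifP => [_|/negbT/gm].
  by rewrite inE; have := gU; rewrite btri_unit // => /forallP/(_ b).
by move/monomial_blockP; apply.
Qed.

End Parabolic.

(** * Free modules over the invariants *)

Section Packaging.
Lemma free_of_rank_family (R : comNzRingType) (V : lmodType R) (K : {pred R}) (M : {pred V})
    (I : finType) (e : I -> V) (N : nat) : #|I| = N ->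
  0 \in M -> {in M &, forall u v, u + v \in M} -> {in K & M, forall c u, c *: u \in M} ->
  (forall i, e i \in M) ->
  (forall u, u \in M -> exists2 c : I -> R, forall i, c i \in K & u = \sum_i c i *: e i) ->
  (forall c : I -> R, (forall i, c i \in K) -> \sum_i c i *: e i = 0 -> forall i, c i = 0) ->
  free_of_rank K M N.
Proof.
move=> <- M0 MD MZ eM espan efree; split=> //.
have sumI (f : I -> V) : \sum_i f i = \sum_(k < #|I|) f (enum_val k).
  by rewrite (reindex _ (onW_bij _ (@enum_val_bij I))).
exists (fun k => e (enum_val k)); split=> [k|u /espan[c cK ->]|c cK ce0 k].
- exact: eM.
- by exists (fun k => c (enum_val k)); [move=> k; apply: cK | rewrite sumI].
have := efree (fun i => c (enum_rank i)) (fun i => cK _) _ (enum_val k).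
rewrite enum_valK; apply; rewrite sumI -[RHS]ce0; apply: eq_bigr => k' _.
by rewrite enum_valK.
Qed.

Lemma sum_single (V : zmodType) (I : finType) (i : I) (u : V) :
  \sum_j (if j == i then u else 0) = u.
Proof. by rewrite -big_mkcond big_pred1_eq. Qed.

Lemma sum_pair (V : zmodType) (I J : finType) (f : I * J -> V) :
  \sum_x f x = \sum_i \sum_j f (i, j).
Proof. by rewrite (pair_bigA _ (fun i j => f (i, j))); apply: eq_bigr => -[]. Qed.

Lemma scale_swap (R : comNzRingType) (V : lmodType R) (c k : R) (x : V) : c *: (k *: x) = k *: (c *: x).
Proof. by rewrite !scalerA mulrC. Qed.

Lemma scale_sumC (R : comNzRingType) (V : lmodType R) (I : finType) (c k : R) (d : I -> R) (x : I -> V) :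
  c *: \sum_i d i *: (k *: x i) = k *: (c *: \sum_i d i *: x i).
Proof.
rewrite [RHS]scale_swap; congr (_ *: _); rewrite scaler_sumr.
by apply: eq_bigr => i _; apply: scale_swap.
Qed.

(** Discrete Fourier transform of a sequence of period a: the components sum to [x 0], and shifting
    the sequence multiplies the j-th component by eta^j. *)
Lemma cyclic_spectral (F : fieldType) (R : comNzRingType) (c : {rmorphism F -> R}) (V : lmodType R)
    (a : nat) (eta : F) (x : nat -> V) : a.-primitive_root eta -> (forall m, x (m + a)%N = x m) ->
  let Pr (y : nat -> V) (j : nat) := c (a%:R^-1) *: \sum_(m < a) c (eta^-1 ^+ (m * j)) *: y m in
  \sum_(j < a) Pr x j = x 0 /\ forall j, Pr (fun m => x m.+1) j = c (eta ^+ j) *: Pr x j.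
Proof.
move=> prim per Pr; have a0 := prim_order_gt0 prim.
have eta0 : eta != 0 by rewrite (prim_root_eq0 prim) -lt0n.
split=> [|j].
  rewrite /Pr -scaler_sumr exchange_big /=.
  rewrite (eq_bigr (fun m : 'I_a => c (\sum_(j < a) (eta^-1 ^+ m) ^+ j) *: x m)) => [|m _]; last first.
    by rewrite -scaler_suml rmorph_sum; congr (_ *: _); apply: eq_bigr => j _; rewrite exprM.
  rewrite (bigD1 (Ordinal a0)) //= [X in _ + X]big1 ?addr0 => [|m nm].
    rewrite (eq_bigr (fun=> 1)) => [|j _]; last exact: expr1n.
    rewrite sumr_const card_ord scalerA -rmorphM /= mulVf ?rmorph1 ?scale1r //.
    exact: prim_root_natf_neq0 prim.
  suff -> : \sum_(j < a) (eta^-1 ^+ m) ^+ j = 0 by rewrite rmorph0 scale0r.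
  have : (eta^-1 ^+ m - 1) * (\sum_(j < a) (eta^-1 ^+ m) ^+ j) = 0.
    by rewrite -subrX1 -exprM mulnC exprM exprVn (prim_expr_order prim) invr1 expr1n subrr.
  move/eqP; rewrite mulf_eq0 => /orP[|/eqP//].
  rewrite subr_eq0 exprVn invr_eq1 -(expr0 eta) (eq_prim_root_expr prim) mod0n modn_small //.
  by move=> m0; case/negP: nm; apply/eqP/val_inj/eqP.
rewrite /Pr !scalerA -rmorphM [eta ^+ j * _]mulrC rmorphM -scalerA; congr (_ *: _).
rewrite scaler_sumr.
pose f m : V := c (eta ^+ j * eta^-1 ^+ (m * j)) *: x m.
have fS m : c (eta^-1 ^+ (m * j)) *: x m.+1 = f m.+1.
  by rewrite /f mulSn exprD mulrA -exprMn mulfV // expr1n mul1r.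
have fa : f a = f 0%N.
  rewrite /f -[in x a](add0n a) per mul0n expr0 exprM exprVn (prim_expr_order prim).
  by rewrite invr1 expr1n.
rewrite (eq_bigr (fun m : 'I_a => f m.+1)) => [|m _]; last exact: fS.
rewrite [RHS](eq_bigr (fun m : 'I_a => f m)) => [|m _]; last by rewrite scalerA -rmorphM.
case: a a0 fa {prim per Pr fS} => // a _ fa.
by rewrite big_ord_recr [RHS]big_ord_recl /= fa addrC.
Qed.

Lemma fin_prim_root (F : finFieldType) (m : nat) : (m %| #|F|.-1)%N ->
  exists w : F, m.-primitive_root w.
Proof.
move=> mq; have q1 : (0 < #|F|.-1)%N by have := finRing_gt1 F; case: #|F| => [|[]].
pose rs := [seq x <- enum F | x != 0].
have /hasP[z _ zp] : has #|F|.-1.-primitive_root rs.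
  apply: has_prim_root => //.
  - apply/allP=> x; rewrite mem_filter => /andP[x0 _]; rewrite unity_rootE; apply/eqP.
    by apply: (mulIf x0); rewrite mul1r -exprSr prednK ?expf_card // ltnW // finRing_gt1.
  - exact/filter_uniq/enum_uniq.
  have <- : #|predC1 (0 : F)| = #|F|.-1 by rewrite cardC1.
  rewrite cardE; apply: uniq_leq_size => [|x]; first exact: enum_uniq.
  by rewrite mem_enum mem_filter mem_enum andbT.
exists (z ^+ (#|F|.-1 %/ m)); exact: dvdn_prim_root.
Qed.

End Packaging.

(** * From semi-invariants to invariants: the trivial character *)

Section Main.
Lemma card_sets (m : nat) : #|{set 'I_m}| = (2 ^ m)%N.
Proof.
have := card_powerset [set: 'I_m]; rewrite cardsT card_ord => <-; apply: eq_card => S.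
by rewrite powersetE subsetT.
Qed.

Lemma ext_invariantsP (n : nat) (F : finFieldType) (G : {set 'M[F]_n}) (u : extalg n {mpoly F[n]}) :
  reflect (forall g, g \in G -> ext_act g u = u) (u \in ext_invariants G).
Proof.
rewrite unfold_in; apply: (iffP forall_inP) => gu g gG; first exact/eqP/gu.
by apply/eqP/gu.
Qed.

Lemma poly_invariantsP (n : nat) (F : finFieldType) (G : {set 'M[F]_n}) (x : {mpoly F[n]}) :
  reflect (forall g, g \in G -> poly_act g x = x) (x \in poly_invariants G).
Proof.
rewrite unfold_in; apply: (iffP forall_inP) => gu g gG; first exact/eqP/gu.
by apply/eqP/gu.
Qed.

Lemma ext_invariants0 (n : nat) (F : finFieldType) (G : {set 'M[F]_n}) : 0 \in ext_invariants G.
Proof. by apply/ext_invariantsP=> g _; apply: ext_act0. Qed.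

Lemma ext_invariantsD (n : nat) (F : finFieldType) (G : {set 'M[F]_n}) :
  {in ext_invariants G &, forall u v, u + v \in ext_invariants G}.
Proof.
move=> u v /ext_invariantsP Gu /ext_invariantsP Gv; apply/ext_invariantsP=> g gG.
by rewrite ext_actD (Gu g gG) (Gv g gG).
Qed.

Lemma ext_invariantsZ (n : nat) (F : finFieldType) (G G' : {set 'M[F]_n}) : G' \subset G ->
  {in poly_invariants G & ext_invariants G', forall c u, c *: u \in ext_invariants G'}.
Proof.
move=> /subsetP sG c u /poly_invariantsP Gc /ext_invariantsP Gu; apply/ext_invariantsP=> g gG.
by rewrite ext_actZ (Gu g gG) (Gc g (sG g gG)).
Qed.

Variables (p e : nat) (F : finFieldType) (l : nat) (n_ : 'I_l -> nat).
Hypotheses (p_prime : prime p) (cardF : #|F| = (p ^ e)%N).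
Local Notation n := (\sum_i n_ i)%N.
Local Notation bl := (@tagnat.sig1 l n_).
Local Notation P := {mpoly F[n]}.
Local Notation A := (extalg n P).
Local Notation q := #|F|.

Section SemiInvariants.
Variables (gl : pred 'I_l) (r s : 'I_l -> nat).
Hypothesis r_dvd : forall b, (r b %| q.-1)%N.
Hypothesis r_gl : forall b, gl b -> r b = q.-1.
Hypothesis n_lt : forall b, ~~ gl b -> (n_ b < p)%N.
Hypothesis s_lt : forall b, ~~ gl b -> (s b < r b)%N.
Local Notation G := (parabolic (Gb F n_ gl r)).

Lemma dvd_q1_gt0 m : (m %| q.-1)%N -> (0 < m)%N.
Proof. by apply: dvdn_gt0; have := finRing_gt1 F; case: q => [|[]]. Qed.

Lemma two_neq0_block (i j : 'I_n) : i != j -> bl i = bl j -> ~~ gl (bl i) -> 2%:R != 0 :> F.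
Proof.
move=> ne eb nb; have [k ek] := Rank_sig (erefl (bl i)); have [k' ek'] := Rank_sig (esym eb).
have n1 : (1 < n_ (bl i))%N.
  have : (k : nat) != k'.
    by rewrite val_eqE; apply: contraNneq ne => kk; rewrite ek ek' kk.
  by have := ltn_ord k; have := ltn_ord k'; lia.
have chF := card_finPcharP cardF p_prime; rewrite -(dvdn_pcharf chF).
by apply: contraTN (leq_ltn_trans n1 (n_lt nb)) => /(dvdn_leq (isT : (0 < 2)%N)); rewrite -leqNgt.
Qed.

Lemma parabolic_semi_basis : exists b : {set 'I_n} -> A,
  [/\ forall T, semi_inv bl gl G s (b T),
      forall u, semi_inv bl gl G s u ->
        exists2 c : {set 'I_n} -> P, forall T, c T \in poly_invariants G & u = \sum_T c T *: b T
    & forall c : {set 'I_n} -> P, \sum_T c T *: b T = 0 -> forall T, c T = 0].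
Proof.
have [w w_prim] := fin_all_exists (fun b => fin_prim_root (r_dvd b)).
have GP g : g \in G <-> in_parabolic bl gl r g by apply: parabolicP => b; apply/dvd_q1_gt0/r_dvd.
exact: (semi_invariants_basis p_prime cardF (@bl_mono l n_) r_dvd r_gl two_neq0_block GP w_prim s_lt).
Qed.

End SemiInvariants.

(** Replacing r by gcd(r, q-1), and by q-1 on GL blocks, leaves the group unchanged and provides the
    divisibility assumed for semi-invariants; then take s = 0. *)
Lemma invariants_free (gl : pred 'I_l) (r : 'I_l -> nat) :
  (forall b, ~~ gl b -> (0 < r b)%N /\ (n_ b < p)%N) ->
  let G := parabolic (Gb F n_ gl r) in
  free_of_rank (poly_invariants G) (ext_invariants G) (2 ^ n).
Proof.
move=> rn; pose r' b := if gl b then q.-1 else gcdn (r b) q.-1.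
have -> : parabolic (Gb F n_ gl r) = parabolic (Gb F n_ gl r').
  apply: eq_parabolic => b; rewrite /Gb /r'; case: ifP => // /negbT/rn[r0 _].
  exact: Gimp_gcd.
set G := parabolic _; have r'_dvd b : (r' b %| q.-1)%N.
  by rewrite /r'; case: ifP => _; rewrite ?dvdnn ?dvdn_gcdr.
have r'_gl b : gl b -> r' b = q.-1 by rewrite /r' => ->.
have [b [bX bspan bfree]] := @parabolic_semi_basis gl r' (fun=> 0%N) r'_dvd
  r'_gl (fun b nb => proj2 (rn b nb)) (fun b _ => dvd_q1_gt0 (r'_dvd b)).
have chi1 g : chi bl gl (fun=> 0%N) g = 1 by apply: big1 => i _; rewrite expr0.
have semi_invE u : semi_inv bl gl G (fun=> 0%N) u <-> u \in ext_invariants G.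
  split=> [Xu|/ext_invariantsP Xu g gG]; last by rewrite (Xu g gG) chi1 mpolyC1 scale1r.
  by apply/ext_invariantsP=> g gG; rewrite (Xu g gG) chi1 mpolyC1 scale1r.
apply: (free_of_rank_family (e := b)) => [||||T|u /semi_invE|c _].
- exact: card_sets.
- exact: ext_invariants0.
- exact: ext_invariantsD.
- exact: ext_invariantsZ.
- exact/semi_invE/bX.
- exact: bspan.
exact: bfree.
Qed.

End Main.

(** * Splitting under the diagonal torus *)

Section Imprimitive.
Variables (p e : nat) (F : finFieldType) (l : nat) (n_ : 'I_l -> nat).
Hypotheses (p_prime : prime p) (cardF : #|F| = (p ^ e)%N).
Hypothesis n_gt0 : forall b, (0 < n_ b)%N.
Local Notation n := (\sum_i n_ i)%N.
Local Notation bl := (@tagnat.sig1 l n_).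
Local Notation Rk := (@tagnat.Rank l n_ _).
Local Notation P := {mpoly F[n]}.
Local Notation A := (extalg n P).
Local Notation q := #|F|.
Implicit Types (g h : 'M[F]_n) (b : 'I_l) (u v : A).

Variables (r a : 'I_l -> nat).
Hypothesis a_gt0 : forall b, (0 < a b)%N.
Hypothesis a_dvd : forall b, (a b %| r b)%N.
Hypothesis r_dvd : forall b, (r b %| q.-1)%N.
Hypothesis n_lt : forall b, (n_ b < p)%N.

Local Notation Gbar := (parabolic (fun b => Gimp F (r b) 1 (n_ b))).
Local Notation Ga := (parabolic (fun b => Gimp F (r b) (a b) (n_ b))).
Local Notation del := (delta bl).

Let r_gt0 b : (0 < r b)%N. Proof. exact: dvd_q1_gt0 (r_dvd b). Qed.

Lemma in_Gbar g : g \in Gbar <-> in_parabolic bl xpred0 r g.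
Proof. exact: (@parabolicP F l n_ xpred0 r r_gt0 g). Qed.

Lemma in_block b (i : 'I_n) : (i \in B bl b) = (bl i == b).
Proof. by rewrite (in_B (@bl_mono l n_)). Qed.

Lemma delta_submx b g : del b g = \prod_k \sum_i submxblock g b b i k.
Proof.
rewrite /delta (eq_bigl _ _ (in_block b)) (block_big _ b); apply: eq_bigr => k _.
rewrite (eq_bigl _ _ (in_block b)) (block_big _ b); apply: eq_bigr => i _.
by rewrite submxblockE.
Qed.

(** Column sums of a monomial matrix are its nonzero entries, so the extra condition no longer
    mentions a choice of permutation and entries. *)
Lemma Gimp_colprod (m c k : nat) (h : 'M[F]_k) : (h \in Gimp F m c k) =
  (h \in Gimp F m 1 k) && ((\prod_j \sum_i h i j) ^+ (m %/ c) == 1).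
Proof.
have colw (t : 'S_k) (w : 'I_k -> F) : (forall i j, h i j = if i == t j then w j else 0) ->
    \prod_j \sum_i h i j = \prod_j w j.
  move=> hE; apply: eq_bigr => j _; rewrite (bigD1 (t j)) //= hE eqxx big1 ?addr0 // => i /negPf ne.
  by rewrite hE ne.
apply/idP/andP => [/GimpP[t [w [wm wc hE]]]|[/GimpP[t [w [wm _ hE]]] /eqP wc]].
  split; last by rewrite (colw t w hE) wc.
  by apply/GimpP; exists t, w; split=> //; rewrite divn1 -prodrXl big1.
by apply/GimpP; exists t, w; split=> //; rewrite -(colw t w hE).
Qed.

Lemma in_Ga g : g \in Ga <-> g \in Gbar /\ forall b, del b g ^+ (r b %/ a b) = 1.
Proof.
rewrite !inE; split=> [/andP[/forallP gB gT]|[/andP[/forallP gB gT] gd]].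
  split=> [|b]; last by have := gB b; rewrite Gimp_colprod -delta_submx => /andP[_ /eqP].
  by rewrite gT andbT; apply/forallP=> b; have := gB b; rewrite Gimp_colprod => /andP[].
rewrite gT andbT; apply/forallP=> b.
by rewrite Gimp_colprod gB -delta_submx gd eqxx.
Qed.

Definition i0 b : 'I_n := tagnat.Rank b (Ordinal (n_gt0 b)).
(** Placed at the first index of block b, it has [delta b] equal to x and the other deltas 1, so
    these elements represent Gbar modulo Ga. *)
Definition tor b (x : F) : 'M[F]_n := diag1 (i0 b) x.

Lemma bl_i0 b : bl (i0 b) = b. Proof. exact: tagnat.Rank1K. Qed.

Lemma torE b x i j : tor b x i j = if i == j then (if i == i0 b then x else 1) else 0.
Proof. exact: diag1E. Qed.

Lemma tor_mull b x g i j : (tor b x *m g) i j = (if i == i0 b then x else 1) * g i j.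
Proof.
rewrite mxE (bigD1 i) //= torE eqxx [X in _ + X]big1 ?addr0 // => k /negPf ne.
by rewrite torE eq_sym ne mul0r.
Qed.

Lemma tor_mulr b x g i j : (g *m tor b x) i j = g i j * (if j == i0 b then x else 1).
Proof.
rewrite mxE (bigD1 j) //= torE eqxx [X in _ + X]big1 ?addr0 // => k /negPf ne.
by rewrite torE ne mulr0.
Qed.

Lemma torM b x y : tor b x *m tor b y = tor b (x * y).
Proof.
apply/matrixP=> i j; rewrite tor_mull !torE; case: (i =P j) => _; last by rewrite mulr0.
by case: eqP; rewrite ?mulr1.
Qed.

Lemma tor1 b : tor b 1 = 1%:M.
Proof. by apply/matrixP=> i j; rewrite torE mxE if_same; case: (i =P j). Qed.

Lemma torC b b' x y : tor b x *m tor b' y = tor b' y *m tor b x.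
Proof.
apply/matrixP=> i j; rewrite tor_mull tor_mulr !torE; case: (i =P j) => [->|_]; first exact: mulrC.
by rewrite mulr0 mul0r.
Qed.

Lemma tor_Gbar b x : x ^+ r b = 1 -> tor b x \in Gbar.
Proof.
move=> xr; apply: (diag1_G r_dvd (bl := bl) (gl := xpred0)); first exact: in_Gbar.
by rewrite bl_i0.
Qed.

Lemma delta_tor b b' x : del b' (tor b x) = if b == b' then x else 1.
Proof. by rewrite /tor (delta_diag1 (@bl_mono l n_)) bl_i0. Qed.

Lemma Gbar_block g b : g \in Gbar -> exists t w,
  [/\ {in B bl b &, injective t}, t @: B bl b = B bl b,
    forall j, j \in B bl b -> w j ^+ r b = 1
    & forall i j, i \in B bl b -> j \in B bl b -> g i j = if i == t j then w j else 0].
Proof. by move=> gG; apply: (mono_G (@bl_mono l n_) in_Gbar gG). Qed.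

Lemma tor_conj b x y g : x ^+ r b = 1 -> y ^+ r b = 1 -> g \in Gbar ->
  tor b x *m g *m tor b y \in Gbar /\
  forall b', del b' (tor b x *m g *m tor b y) = (if b == b' then x * y else 1) * del b' g.
Proof.
move=> xr yr gG; set g' := _ *m _ *m _.
have gE i j : g' i j = (if i == i0 b then x else 1) * g i j * (if j == i0 b then y else 1).
  by rewrite tor_mulr tor_mull.
have D (z : F) b' : \prod_(j in B bl b') (if j == i0 b then z else 1) = if b == b' then z else 1.
  rewrite -big_mkcondr; case: eqP => [<-|nb].
    rewrite (eq_bigl (pred1 (i0 b))) ?big_pred1_eq // => i /=; rewrite in_block.
    by case: (i =P i0 b) => [->|]; rewrite ?andbF // bl_i0 eqxx.
  apply: big_pred0 => i; rewrite in_block; case: (i =P i0 b) => [->|]; rewrite ?andbF //.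
  by rewrite bl_i0 andbT; apply/eqP.
have g'E b' t w : (forall i j, i \in B bl b' -> j \in B bl b' -> g i j = if i == t j then w j else 0) ->
    forall i j, i \in B bl b' -> j \in B bl b' -> g' i j =
    if i == t j then (if t j == i0 b then x else 1) * w j * (if j == i0 b then y else 1) else 0.
  move=> E i j iB jB; rewrite gE E //; case: (i =P t j) => [->//|_].
  by rewrite mulr0 mul0r.
split=> [|b'].
  apply/in_Gbar; have [gU gT gM] := proj1 (in_Gbar g) gG; split.
  - rewrite !unitmx_mul gU andbT /=.
    have torU z : z ^+ r b = 1 -> tor b z \in unitmx.
      by move/tor_Gbar/in_Gbar => [].
    by rewrite !torU.
  - by move=> i j ji; rewrite gE gT // mulr0 mul0r.
  move=> b' _; have [t [w [tI tB wr E]]] := Gbar_block b' gG.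
  exists t, (fun j => (if t j == i0 b then x else 1) * w j * (if j == i0 b then y else 1)).
  have inB i : bl i = b' -> i \in B bl b' by rewrite in_block => ->.
  have blB i : i \in B bl b' -> bl i = b' by rewrite in_block => /eqP.
  split=> [i j|j /inB jB|i j /inB iB /inB jB]; last exact: (g'E b' t w E i j iB jB).
    by rewrite !inE => /eqP/inB iB /eqP/inB jB; apply: tI.
  have tjB : t j \in B bl b' by rewrite -tB imset_f.
  split; first exact: blB.
  have one (z : F) (i : 'I_n) : z ^+ r b = 1 -> i \in B bl b' -> (if i == i0 b then z else 1) ^+ r b' = 1.
    by move=> zr /blB ib; case: eqP => [ei|]; rewrite ?expr1n // -ib ei bl_i0.
  by rewrite !exprMn !one // wr // !mulr1.
have [t [w [tI tB wr E]]] := Gbar_block b' gG.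
rewrite (deltaE tB (g'E _ _ _ E)) (deltaE tB E) !big_split /= D.
have -> : \prod_(j in B bl b') (if t j == i0 b then x else 1) = if b == b' then x else 1.
  by rewrite -(big_imset (fun k => if k == i0 b then x else 1)) //= tB D.
by case: (b == b'); rewrite ?mulr1 ?mul1r // mulrAC.
Qed.

Definition Ga_inv u := forall g, g \in Ga -> ext_act g u = u.

Lemma expr_inv1 (x : F) m : x ^+ m = 1 -> x^-1 ^+ m = 1.
Proof. by move=> xm; rewrite exprVn xm invr1. Qed.

Lemma root_r_neq0 b (x : F) : x ^+ r b = 1 -> x != 0.
Proof. exact: root_neq0 (r_gt0 b). Qed.

Lemma Ga_inv_tor b x u : x ^+ r b = 1 -> Ga_inv u -> Ga_inv (ext_act (tor b x) u).
Proof.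
move=> xr Mu g /in_Ga[gG gd]; have x0 := root_r_neq0 xr.
have [cG cd] := tor_conj (expr_inv1 xr) xr gG.
have me : g *m tor b x = tor b x *m (tor b x^-1 *m g *m tor b x).
  by rewrite !mulmxA torM mulfV // tor1 mul1mx.
rewrite -(ext_actMM g) me (ext_actMM (tor b x)).
congr (ext_act _ _); apply: (Mu); apply/in_Ga; split=> [|b']; first exact: cG.
by rewrite cd mulVf // if_same mul1r gd.
Qed.

Lemma tor_Ga b x : x ^+ (r b %/ a b) = 1 -> tor b x \in Ga.
Proof.
move=> xa; apply/in_Ga; split=> [|b'].
  by apply: tor_Gbar; rewrite -(divnK (a_dvd b)) exprM xa expr1n.
by rewrite delta_tor; case: eqP => [<-|]; rewrite ?expr1n.
Qed.

Variable zeta : 'I_l -> F.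
Hypothesis zeta_prim : forall b, (r b).-primitive_root (zeta b).

Definition eta b : F := zeta b ^+ (r b %/ a b).

Lemma eta_prim b : (a b).-primitive_root (eta b).
Proof. exact: dvdn_prim_root. Qed.

Definition eig b (k : nat) u := ext_act (tor b (zeta b)) u = (eta b ^+ k)%:MP *: u.
Definition tor_pow b u (m : nat) : A := ext_act (tor b (zeta b ^+ m)) u.
Definition eig_proj b u (j : nat) : A :=
  ((a b)%:R^-1)%:MP *: \sum_(m < a b) ((eta b)^-1 ^+ (m * j))%:MP *: tor_pow b u m.

Lemma zeta_r b : zeta b ^+ r b = 1. Proof. exact: prim_expr_order. Qed.

Lemma zetaX_r b m : (zeta b ^+ m) ^+ r b = 1.
Proof. by rewrite -exprM mulnC exprM zeta_r expr1n. Qed.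

Lemma tor_powS b u m : ext_act (tor b (zeta b)) (tor_pow b u m) = tor_pow b u m.+1.
Proof. by rewrite /tor_pow -ext_actMM torM exprS. Qed.

Lemma tor_pow0 b u : tor_pow b u 0 = u.
Proof. by rewrite /tor_pow expr0 tor1 ext_act_id. Qed.

Lemma tor_pow_per b u m : Ga_inv u -> tor_pow b u (m + a b) = tor_pow b u m.
Proof.
move=> Mu; rewrite /tor_pow exprD -torM ext_actMM; congr (ext_act _ _); apply: (Mu); apply: tor_Ga.
by rewrite -exprM mulnC divnK // zeta_r.
Qed.

Lemma act_lin g c (I : finType) (d : I -> F) (x : I -> A) :
  ext_act g (c%:MP *: \sum_i (d i)%:MP *: x i) = c%:MP *: \sum_i (d i)%:MP *: ext_act g (x i).
Proof.
rewrite ext_actZ poly_actC ext_act_sum; congr (_ *: _); apply: eq_bigr => i _.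
by rewrite ext_actZ poly_actC.
Qed.

Lemma eig_proj_sum b u : Ga_inv u -> \sum_(j < a b) eig_proj b u j = u.
Proof.
move=> Mu; have [+ _] := cyclic_spectral (@mpolyC n F) (eta_prim b) (fun m => tor_pow_per b m Mu).
by rewrite tor_pow0.
Qed.

Lemma act_eig_proj b u j : ext_act (tor b (zeta b)) (eig_proj b u j) =
  ((a b)%:R^-1)%:MP *: \sum_(m < a b) ((eta b)^-1 ^+ (m * j))%:MP *: tor_pow b u m.+1.
Proof. by rewrite /eig_proj act_lin; under [X in _ *: X = _]eq_bigr do rewrite tor_powS. Qed.

Lemma eig_proj_eig b u j : Ga_inv u -> eig b j (eig_proj b u j).
Proof.
move=> Mu; have [_ E] := cyclic_spectral (@mpolyC n F) (eta_prim b) (fun m => tor_pow_per b m Mu).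
rewrite /eig act_eig_proj; exact: (E j).
Qed.

Lemma eig_proj_Ga_inv b u j : Ga_inv u -> Ga_inv (eig_proj b u j).
Proof.
move=> Mu g gG; rewrite {1}/eig_proj act_lin.
under [X in _ *: X = _]eq_bigr => m _ do rewrite (Ga_inv_tor (zetaX_r b m) Mu gG).
by [].
Qed.

Lemma eig_proj_eig' b b' u j k : eig b' k u -> eig b' k (eig_proj b u j).
Proof.
move=> Eu; rewrite /eig {1}/eig_proj act_lin.
have tor_powE m : ext_act (tor b' (zeta b')) (tor_pow b u m) = (eta b' ^+ k)%:MP *: tor_pow b u m.
  rewrite /tor_pow -(ext_actMM (tor b' _)) torC (ext_actMM (tor b _)) Eu ext_actZ.
  by rewrite poly_actC.
under [X in _ *: X = _]eq_bigr => m _ do rewrite tor_powE.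
exact: scale_sumC.
Qed.

Lemma eig_tor b x u m : ext_act (tor b (zeta b)) u = x%:MP *: u ->
  ext_act (tor b (zeta b ^+ m)) u = (x ^+ m)%:MP *: u.
Proof.
move=> Eu; elim: m => [|m IH]; first by rewrite expr0 tor1 ext_act_id expr0 mpolyC1 scale1r.
have -> : tor b (zeta b ^+ m.+1) = tor b (zeta b) *m tor b (zeta b ^+ m) by rewrite torM exprS.
rewrite ext_actMM IH ext_actZ poly_actC Eu scalerA -mpolyCM exprSr.
exact: erefl.
Qed.

(** The exponents of the characters of Gbar trivial on Ga: multiples of r_b/a_b. *)
Definition sk (k : 'I_l -> nat) b : nat := (r b %/ a b * k b)%N.
Local Notation semi_inv_k k := (semi_inv bl xpred0 Gbar (sk k)).

(** [bs] lists the blocks where g may fail the condition defining Ga; one torus factor is split off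
    g for each of them. *)
Lemma eig_act (k : 'I_l -> nat) u : Ga_inv u -> (forall b, eig b (k b) u) ->
  forall (bs : seq 'I_l) g, uniq bs -> g \in Gbar ->
  (forall b, b \notin bs -> del b g ^+ (r b %/ a b) = 1) ->
  ext_act g u = (\prod_(b <- bs) del b g ^+ sk k b)%:MP *: u.
Proof.
move=> Mu Eu; elim=> [|b bs IH] g /=.
  move=> _ gG gd; rewrite big_nil mpolyC1 scale1r; apply: (Mu); apply/in_Ga; split=> // b.
  by apply: gd.
case/andP=> nb Ubs gG gd.
have dr : del b g ^+ r b = 1.
  exact: (deltaX (@bl_mono l n_) in_Gbar (b := b) gG (isT : ~~ xpred0 b)).
have [c dc] := prim_rootP (zeta_prim b) dr.
have zr := zetaX_r b c; have z0 := root_r_neq0 zr.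
have [g'G g'd] := tor_conj (expr_inv1 zr) (expr1n F (r b)) gG.
rewrite tor1 mulmx1 in g'G g'd; set g' := _ *m g in g'G g'd.
have gE : g = tor b (zeta b ^+ c) *m g' by rewrite /g' mulmxA torM mulfV // tor1 mul1mx.
have sd b' : b' != b -> del b' g' = del b' g.
  by move=> ne; rewrite g'd [b == b']eq_sym (negPf ne) mul1r.
rewrite {1}gE (ext_actMM (tor b _)) IH //; last first.
  move=> b' nb'; have [->|ne] := eqVneq b' b.
    by rewrite g'd eqxx mulr1 dc mulVf // expr1n.
  by rewrite sd // gd // inE negb_or ne.
rewrite ext_actZ poly_actC.
have -> : ext_act (tor b (zeta b ^+ c)) u = (del b g ^+ sk k b)%:MP *: u.
  have -> : del b g ^+ sk k b = (eta b ^+ k b) ^+ c.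
    by rewrite dc /sk /eta -!exprM; congr (_ ^+ _); rewrite mulnC mulnA.
  by apply: eig_tor; apply: Eu.
rewrite scalerA -mpolyCM mulrC big_cons; congr (_%:MP *: _); congr (_ * _).
rewrite big_seq [RHS]big_seq; apply: eq_bigr => b' b'bs; rewrite sd //.
by apply: contraNneq nb => <-.
Qed.

Lemma in_Ga_Gbar g : g \in Ga -> g \in Gbar.
Proof. by case/in_Ga. Qed.

Lemma chi_k (k : 'I_l -> nat) g : chi bl xpred0 (sk k) g = \prod_(b : 'I_l) del b g ^+ sk k b.
Proof. by []. Qed.

Lemma semi_inv_k_Ga_inv (k : 'I_l -> nat) u : semi_inv_k k u -> Ga_inv u.
Proof.
move=> Xu g gG; have [gbG gd] := proj1 (in_Ga g) gG.
have c1 : \prod_(b : 'I_l) del b g ^+ sk k b = 1.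
  by apply: big1 => b _; rewrite /sk exprM gd expr1n.
by rewrite (Xu g gbG) chi_k c1 mpolyC1 scale1r.
Qed.

Lemma eig_semi_inv_k (k : 'I_l -> nat) u : Ga_inv u -> (forall b, eig b (k b) u) -> semi_inv_k k u.
Proof.
move=> Mu Eu g gG; have := eig_act Mu Eu (index_enum_uniq 'I_l) gG.
by rewrite chi_k => -> // b; rewrite mem_index_enum.
Qed.

Lemma semi_inv_k_eig (k : 'I_l -> nat) b u : semi_inv_k k u -> eig b (k b) u.
Proof.
move=> Xu; have c1 : \prod_(b' : 'I_l) del b' (tor b (zeta b)) ^+ sk k b' = eta b ^+ k b.
  rewrite (bigD1 b) //= [X in _ * X]big1 => [|b' /negPf ne].
    by rewrite mulr1 delta_tor eqxx /sk exprM.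
  by rewrite delta_tor eq_sym ne expr1n.
by rewrite /eig (Xu _ (tor_Gbar (zeta_r b))) chi_k c1.
Qed.

Local Notation Kt := {dffun forall b : 'I_l, 'I_(a b)}.
Definition kn (k : Kt) b : nat := k b.

Definition decomposed u := exists2 v : Kt -> A, forall k, semi_inv_k (kn k) (v k) & u = \sum_k v k.

Lemma decomposedD u v : decomposed u -> decomposed v -> decomposed (u + v).
Proof.
move=> [u' Xu ->] [v' Xv ->]; exists (fun k => u' k + v' k); last by rewrite big_split.
by move=> k; apply: semi_inv_D.
Qed.

Lemma decomposed0 : decomposed 0.
Proof.
exists (fun=> 0) => [k|]; first exact: semi_inv_0.
by apply/esym; apply: big1.
Qed.

Lemma eig_decomposed (k : 'I_l -> nat) u : Ga_inv u -> (forall b, (k b < a b)%N) ->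
  (forall b, eig b (k b) u) -> decomposed u.
Proof.
move=> Mu ka Eu; pose k' : Kt := [ffun b => Ordinal (ka b)].
have ek : kn k' =1 k by move=> b; rewrite /kn ffunE.
pose v (k2 : Kt) : A := if k2 == k' then u else 0.
exists v => [k2|]; last exact: (esym (sum_single k' u)).
rewrite /v; case: (k2 =P k') => [->|_]; last exact: semi_inv_0.
apply: (eig_semi_inv_k Mu) => b; rewrite (ek b); exact: (Eu b).
Qed.

(** The torus elements commute, so projecting for one block preserves the eigenvalues already fixed
    for the others. *)
Lemma Ga_inv_decomposed u : Ga_inv u -> decomposed u.
Proof.
(* Only the blocks of index at least m are already diagonalized; the induction starts from m = l,
   where nothing is assumed. *)
suff H m : (m <= l)%N -> forall v (k : 'I_l -> nat), Ga_inv v ->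
    (forall b, (m <= b)%N -> (k b < a b)%N /\ eig b (k b) v) -> decomposed v.
  move=> Mu; apply: (H l (leqnn l) u (fun=> 0%N) Mu) => b.
  by rewrite leqNgt ltn_ord.
elim: m => [|m IH] ml v k Mv kv.
  apply: (@eig_decomposed k v Mv) => b; first exact: (proj1 (kv b (leq0n b))).
  exact: (proj2 (kv b (leq0n b))).
pose b := Ordinal ml; rewrite -(eig_proj_sum b Mv).
apply: (big_ind decomposed) => [||j _]; [exact: decomposed0 | exact: decomposedD |].
pose k' b' : nat := if b' == b then nat_of_ord j else k b'.
apply: (IH (ltnW ml) _ k'); first exact: eig_proj_Ga_inv.
move=> b' mb'; rewrite /k'; have [->|ne] := eqVneq b' b.
  by split; [exact: ltn_ord | exact: eig_proj_eig].
have [|kb' Eb'] := kv b'; last by split; [|exact: eig_proj_eig'].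
rewrite ltn_neqAle mb' andbT; apply: contraNneq ne => mb.
by apply/eqP/val_inj.
Qed.

Lemma scale_const_inj (x y : F) u : x != y -> x%:MP *: u = y%:MP *: u -> u = 0.
Proof.
move=> xy e1; apply: (@scaler_injE _ P (x - y)%:MP); first by rewrite mpolyC_eq0 subr_eq0.
by rewrite scaler0 mpolyCB scalerBl e1 subrr.
Qed.

(** Independence of eigenvectors: a torus element separating k1 from k2, minus its eigenvalue on
    [v k1], kills that term and scales [v k2] by a nonzero constant. *)
Lemma semi_inv_k_free (S : {set Kt}) (v : Kt -> A) : (forall k, semi_inv_k (kn k) (v k)) ->
  \sum_(k in S) v k = 0 -> forall k, k \in S -> v k = 0.
Proof.
have [m] := ubnP #|S|; elim: m S v => // m IH S v leS Xv v0 k2 k2S.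
have [[k1 k1S ne]|/negP nk] := altP (@exists_inP _ (mem S) (fun k1 => k1 != k2)); last first.
  rewrite -[RHS]v0 (bigD1 k2) //= [X in _ + X]big1 ?addr0 // => k /andP[kS nek].
  by case: nk; apply/exists_inP; exists k.
have [b nb] : exists b, kn k1 b != kn k2 b.
  apply/existsP; apply: contraNT ne; rewrite negb_exists => /forallP ek.
  by apply/eqP/ffunP=> b; apply/val_inj/eqP; have := ek b; rewrite negbK.
pose v' k := (eta b ^+ kn k b - eta b ^+ kn k1 b)%:MP *: v k.
have Xv' k : semi_inv_k (kn k) (v' k).
  move=> g gG; rewrite /v' ext_actZ poly_actC (Xv k g gG) !scalerA.
  by rewrite [_ * (chi _ _ _ _)%:MP]mulrC.
have v'0 : \sum_(k in S :\ k1) v' k = 0.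
  have e1 : \sum_(k in S) v' k = 0.
    set x := eta b ^+ kn k1 b.
    have v'E k : v' k = ext_act (tor b (zeta b)) (v k) - x%:MP *: v k.
      by rewrite /v' mpolyCB scalerBl -(semi_inv_k_eig b (Xv k)).
    transitivity (\sum_(k in S) (ext_act (tor b (zeta b)) (v k) - x%:MP *: v k)).
      by apply: eq_bigr => k _; exact: v'E.
    by rewrite sumrB -ext_act_sum -scaler_sumr v0 ext_act0 scaler0 subr0.
  move: e1; rewrite (bigD1 k1) //= {1}/v' subrr mpolyC0 scale0r add0r => e1.
  rewrite -[RHS]e1; apply: eq_bigl => k; rewrite in_setD1 andbC.
  by [].
have leS' : (#|S :\ k1| < m)%N by move: leS; rewrite (cardsD1 k1 S) (k1S : k1 \in S).
have k2S' : k2 \in S :\ k1 by rewrite in_setD1 eq_sym ne.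
have := IH _ _ leS' Xv' v'0 k2 k2S'; rewrite /v' mpolyCB scalerBl => /eqP.
rewrite subr_eq0 => /eqP; apply: scale_const_inj.
rewrite (eq_prim_root_expr (eta_prim b)) !modn_small ?ltn_ord //.
by rewrite eq_sym.
Qed.

Lemma card_Kt : #|Kt| = (\prod_b a b)%N.
Proof.
rewrite card_dep_ffun foldrE big_map big_enum.
by apply: eq_bigr => b _; rewrite card_ord.
Qed.

Lemma sk_lt (k : Kt) b : (sk (kn k) b < r b)%N.
Proof.
have d0 : (0 < r b %/ a b)%N by rewrite divn_gt0 // dvdn_leq.
rewrite -[X in (_ < X)%N](divnK (a_dvd b)) /sk ltn_pmul2l //.
exact: ltn_ord.
Qed.

Lemma semi_inv_sum_invariant (k : Kt) (I : finType) (c : I -> P) (x : I -> A) :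
  (forall i, c i \in poly_invariants Gbar) -> (forall i, semi_inv_k (kn k) (x i)) ->
  semi_inv_k (kn k) (\sum_i c i *: x i).
Proof.
move=> cG Xx; apply: (big_ind (semi_inv_k (kn k))) => [||i _]; [exact: semi_inv_0 | exact: semi_inv_D |].
move=> g gG; have /poly_invariantsP ci := cG i.
by rewrite ext_actZ (ci g gG) (Xx i g gG); apply: scale_swap.
Qed.

Lemma imprimitive_free :
  free_of_rank (poly_invariants Gbar) (ext_invariants Ga) (2 ^ n * \prod_b a b)%N.
Proof.
have [bs /all_and3[bX bspan bfree]] := fin_all_exists (fun k : Kt =>
  parabolic_semi_basis p_prime cardF (gl := xpred0) r_dvd (fun b => False_ind _ \o notF)
    (fun b _ => n_lt b) (fun b _ => sk_lt k b)).
have MP u : Ga_inv u <-> u \in ext_invariants Ga.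
  by split=> [Mu|/ext_invariantsP//]; apply/ext_invariantsP.
apply: (free_of_rank_family (e := fun x : Kt * {set 'I_n} => bs x.1 x.2)) => [||||x|u|c cG].
- by rewrite card_prod card_Kt card_sets mulnC.
- exact: ext_invariants0.
- exact: ext_invariantsD.
- by apply: ext_invariantsZ; apply/subsetP=> g; apply: in_Ga_Gbar.
- by apply/MP/(semi_inv_k_Ga_inv (bX x.1 x.2)).
- move=> /MP/Ga_inv_decomposed[v Xv ->].
  have [c cG vE] := fin_all_exists2 (fun k => bspan k (v k) (Xv k)).
  exists (fun x => c x.1 x.2) => [x|]; first exact: cG.
  by rewrite sum_pair; apply: eq_bigr => k _; exact: vE.
move=> sum0' [k T].
have sum0 := etrans (esym (sum_pair (fun x : Kt * {set 'I_n} => c x *: bs x.1 x.2))) sum0'.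
have Xv k' : semi_inv_k (kn k') (\sum_T c (k', T) *: bs k' T).
  by apply: semi_inv_sum_invariant => T'; [exact: cG | exact: bX].
have sumT : \sum_(k in [set: Kt]) \sum_T c (k, T) *: bs k T = 0.
  by rewrite -[RHS]sum0; apply: eq_bigl => k'; rewrite inE.
exact: (bfree k (fun T => c (k, T)) (semi_inv_k_free Xv sumT (in_setT k)) T).
Qed.

End Imprimitive.

End BlockTriangularInvariants.

Theorem theorem1p2 (p r : nat) (F : finFieldType) (l : nat) (n_ : 'I_l -> nat)
    (p_prime : prime p) (r_gt0 : 0 < r) (cardF : #|F| = p ^ r)
    (n_gt0 : forall i, 0 < n_ i) :
  (forall r_ a_ : 'I_l -> nat,
     (forall i, [/\ 0 < r_ i, 0 < a_ i & a_ i %| r_ i]) ->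
     (forall i, r_ i %| (p ^ r).-1) ->
     (forall i, n_ i < p) ->
     free_of_rank
       (poly_invariants (parabolic (fun i => Gimp F (r_ i) 1 (n_ i))))
       (ext_invariants (parabolic (fun i => Gimp F (r_ i) (a_ i) (n_ i))))
       (2 ^ (\sum_(i < l) n_ i) * \prod_(i < l) a_ i))
  /\
  (forall (a : nat) (r_ : 'I_l -> nat),
     a <= l ->
     (forall i : 'I_l, a <= i -> 0 < r_ i /\ n_ i < p) ->
     let G (i : 'I_l) := if i < a then GL F (n_ i) else Gimp F (r_ i) 1 (n_ i) in
     free_of_rank
       (poly_invariants (parabolic G)) (ext_invariants (parabolic G))
       (2 ^ (\sum_(i < l) n_ i))).
Proof.
split=> [r_ a_ ra r_dvd n_lt|a r_ _ rn G].
  have r_dvdq b : r_ b %| #|F|.-1 by rewrite cardF.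
  have [zeta zeta_prim] := fin_all_exists (fun b => fin_prim_root (r_dvdq b)).
  have a_gt0 b : 0 < a_ b by have [] := ra b.
  have a_dvd b : a_ b %| r_ b by have [] := ra b.
  exact: (imprimitive_free p_prime cardF n_gt0 a_gt0 a_dvd r_dvdq n_lt zeta_prim).
have rn' (b : 'I_l) : ~~ (b < a) -> 0 < r_ b /\ n_ b < p by rewrite -leqNgt; apply: rn.
exact: (invariants_free p_prime cardF (gl := fun b : 'I_l => b < a) rn').
Qed.
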